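(* Let $d\ge2$, let $G=(V,E)$ be a $D$-regular graph with $n=|V|$ vertices, let $m$ be a positive integer dividing $n$, and let $\{V_1,\ldots,V_{n/m}\}$ be a partition of $V$ into sets each of size $m$. Define $\bar\Phi_G:=\mathbb{E}_{i\in[n/m]}\Phi_G(V_i)$. Let $\rho$ be a state on $(\mathbb{C}^d)^{\otimes n}$ (one qudit $Q_v$ per vertex $v$) and define $\bar I:=\mathbb{E}_{i\in[n/m]}I(V_i:V_{-i})_\rho$, where $V_{-i}=V\setminus V_i$. Then there exists a state $\sigma$ on $(\mathbb{C}^d)^{\otimes n}$ such that (1) $\sigma$ is separable with respect to the partition $(V_1,\ldots,V_{n/m})$, i.e. $\sigma=\sum_z p_z\,\sigma_z^{V_1}\otimes\cdots\otimes\sigma_z^{V_{n/m}}$ for some probability distribution $(p_z)$ and states $\sigma_z^{V_i}$ on the qudits of $V_i$; and (2) $$\mathbb{E}_{(i,j)\in E}\big\|\rho^{Q_iQ_j}-\sigma^{Q_iQ_j}\big\|_1\le 9\left(\frac{d^2\bar\Phi_G}{D}\cdot\frac{\bar I}{m}\right)^{1/6}+\frac1m+\frac mn.$$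
   Context: For a subset $S$ of vertices, its expansion is $\Phi_G(S):=\Pr_{(u,v)\in E}[v\notin S\mid u\in S]$, where $(u,v)$ is a uniformly random (ordered) edge. Entropies are in nats: $S(\rho)=-\operatorname{tr}\rho\ln\rho$, and for a state on systems $A,B$ the mutual information is $I(A:B)=S(A)+S(B)-S(AB)$, computed from the reduced states. $\rho^{Q_iQ_j}$ is the two-qudit reduced state, $\|\cdot\|_1$ the trace norm, and $\mathbb{E}_{(i,j)\in E}$ the average over a uniformly random edge. *)

(* Defs.v *)
From HB Require Import structures.
From mathcomp Require Import all_boot all_order all_algebra.
From mathcomp Require Import complex.
From mathcomp Require Import all_classical all_reals all_analysis.

Set Implicit Arguments.
Unset Strict Implicit.
Unset Printing Implicit Defensive.

Import Order.TTheory GRing.Theory Num.Theory.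
Local Open Scope ring_scope.

Definition adjmx (R : realType) (k l : nat) (A : 'M[R[i]]_(k, l)) : 'M[R[i]]_(l, k) :=
  (map_mx (@conjc R) A)^T.

(* the spectrum (eigenvalues listed with algebraic multiplicity): the roots
   of the characteristic polynomial (which splits, C being algebraically closed) *)
Definition spec (R : realType) (k : nat) (A : 'M[R[i]]_k) : seq R[i] :=
  projT1 (closed_field_poly_normal (char_poly A)).

Definition psd (R : realType) (k : nat) (A : 'M[R[i]]_k) : Prop :=
  adjmx A = A /\ forall v : 'cV[R[i]]_k, 0 <= (adjmx v *m A *m v) 0 0.

Definition density (R : realType) (k : nat) (A : 'M[R[i]]_k) : Prop :=
  psd A /\ \tr A = 1.

Definition entropy (R : realType) (k : nat) (A : 'M[R[i]]_k) : R :=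
  - \sum_(l <- spec A) (complex.Re l * ln (complex.Re l)).

Definition trnorm (R : realType) (k : nat) (A : 'M[R[i]]_k) : R :=
  \sum_(l <- spec (adjmx A *m A)) Num.sqrt (complex.Re l).

Definition op (R : realType) (T : finType) := 'M[R[i]]_#|T|.

Definition opE (R : realType) (T : finType) (A : op R T) (x y : T) : R[i] :=
  A (enum_rank x) (enum_rank y).

(* computational basis of (C^d)^{⊗ V} *)
Definition cfg (V : finType) (d : nat) := {ffun V -> 'I_d}.
Definition cfgS (V : finType) (d : nat) (S : {set V}) :=
  {ffun {v : V | v \in S} -> 'I_d}.

Definition restrict (V : finType) (d : nat) (S : {set V}) (x : cfg V d) : cfgS d S :=
  [ffun s => x (val s)].

(* reduced state rho^S = tr_{V \ S} rho *)
Definition ptrace (R : realType) (V : finType) (d : nat) (S : {set V})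
    (rho : op R (cfg V d)) : op R (cfgS d S) :=
  \matrix_(a, b)
    \sum_(x : cfg V d) \sum_(y : cfg V d |
        [&& restrict S x == enum_val a, restrict S y == enum_val b
          & restrict (~: S) x == restrict (~: S) y]) opE rho x y.

Definition mutinf (R : realType) (V : finType) (d : nat) (S : {set V})
    (rho : op R (cfg V d)) : R :=
  entropy (ptrace S rho) + entropy (ptrace (~: S) rho) - entropy rho.

Definition tensor (R : realType) (V : finType) (d k : nat) (P : 'I_k -> {set V})
    (s : forall i : 'I_k, op R (cfgS d (P i))) : op R (cfg V d) :=
  \matrix_(a, b)
    \prod_(i < k) opE (s i) (restrict (P i) (enum_val a)) (restrict (P i) (enum_val b)).

Definition separable (R : realType) (V : finType) (d k : nat) (P : 'I_k -> {set V})
    (sigma : op R (cfg V d)) : Prop :=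
  exists (N : nat) (p : 'I_N -> R) (s : 'I_N -> forall i : 'I_k, op R (cfgS d (P i))),
    [/\ forall z, 0 <= p z, \sum_z p z = 1,
        forall z i, density (s z i)
      & sigma = \sum_z ((p z)%:C)%C *: tensor (s z)].

Definition nedges (V : finType) (e : rel V) : nat :=
  #|[set uv : V * V | e uv.1 uv.2]|.

(* Phi_G(S) = Pr_{(u,v) in E}[v \notin S | u \in S], (u,v) a uniform ordered edge *)
Definition expansion (R : realType) (V : finType) (e : rel V) (S : {set V}) : R :=
  #|[set uv : V * V | [&& e uv.1 uv.2, uv.1 \in S & uv.2 \notin S]]|%:R /
  #|[set uv : V * V | e uv.1 uv.2 && (uv.1 \in S)]|%:R.

Definition edge_avg (R : realType) (V : finType) (e : rel V) (f : V -> V -> R) : R :=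
  (\sum_(u : V) \sum_(v : V | e u v) f u v) / (nedges e)%:R.

(* Main.v *)
(**
Measure every qudit of a random set [C] of vertices with a fixed informationally
complete POVM and let [sigma] be the average over the outcomes of the product of
the conditional states of the blocks; the measured qudits are replaced by maximally
mixed ones.  On an unmeasured pair inside one block [sigma] agrees with [rho].  On an
unmeasured pair [u], [v] in different blocks the error is a sum of operators with
vanishing partial traces, and the POVM can be chosen so that the trace norm of such
an operator is at most [16 d] times the l1 norm of its outcome vector; by Pinsker's
inequality the latter is controlled by the conditional mutual information
[I(u : v | C)] of the outcomes.

For [u] in a block [S] and [v] outside, [I(u : v | C)] is a mixed second difference of
[C |-> I(C n S : C \ S)], a monotone function bounded by [I(S : V \ S)].  When [C]
is grown by random numbers of steps, up to [delta m] inside the block and up to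
[delta n] everywhere, both differences telescope, and the sum over all pairs is at
most [I(S : V \ S) / delta^2].  The classical mutual information of the outcomes is
bounded by the quantum one by comparing resolvents of relative entropies.

A linearised Pinsker inequality with parameter [theta] then bounds the edge average
by [4 delta + 16 d (theta I / (m D delta^2) + Phi / (2 theta))], where [I] and [Phi]
are the block averages; optimising both parameters gives the power [1/6].
*)

(* The linear form of Pinsker's inequality is what brings in the expansion. Its information term is
   nonnegative, so the sum over edges may be enlarged to all pairs separated by a block, where it
   telescopes; its constant term is paid only on edges that leave a block. One random set has to
   serve every block at once. Random sets are therefore handled as averaging operators on functions
   of a set: a union of independent random sets is a composition, the operators commute, and for
   each block its own draws can be moved innermost, where the estimate is uniform in the base set.
   The state itself is built from one best set. The factor [16 d] is [4^2 d]: on two qudits the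
   trace norm costs a factor [d] over the Frobenius norm, and the measurement distorts the Frobenius
   norm of a traceless operator by at most 4 per site, in every dimension. A measured endpoint costs
   the trivial bound 2, and each vertex is measured with probability at most [delta], hence
   [4 delta] per edge. *)
Require Import Defs.
From HB Require Import structures.
From mathcomp Require Import all_boot all_order all_algebra.
From mathcomp Require Import complex ring lra zify.
From mathcomp Require Import all_classical all_reals all_analysis.
Import Order.TTheory GRing.Theory Num.Theory.
Local Open Scope ring_scope.

Set Implicit Arguments.
Unset Strict Implicit.
Unset Printing Implicit Defensive.

(** * Random sets of measured vertices *)

Section RandomSet.
Import boot.finset.
Context {R : realType} {V : finType}.
Implicit Types (h F : {set V} -> R) (Q : ({set V} -> R) -> {set V} -> R).
Implicit Types (B C S : {set V}).

(** The law [w] of a random set [B], seen as an operator: [Q h C] is the mean of [h (B :|: C)].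
    Union is commutative, so any two such operators commute. *)
Definition set_average Q := exists w : {set V} -> R,
  [/\ forall B, 0 <= w B, \sum_B w B = 1 &
      forall h C, Q h C = \sum_B w B * h (B :|: C)].

Lemma set_average_id : set_average id.
Proof.
exists (fun B => (B == set0)%:R); split=> [B||h C]; first exact: ler0n.
- rewrite (bigD1 set0) //= eqxx big1 ?addr0 // => B /negbTE -> //.
- rewrite (bigD1 set0) //= eqxx mul1r set0U big1 ?addr0 // => B /negbTE ->.
  by rewrite mul0r.
Qed.

Lemma set_average_comp Q1 Q2 : set_average Q1 -> set_average Q2 ->
  set_average (Q1 \o Q2).
Proof.
move=> [w1 [w1ge w1s Q1E]] [w2 [w2ge w2s Q2E]].
exists (fun B => \sum_B1 \sum_(B2 | B1 :|: B2 == B) w1 B1 * w2 B2).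
have E (f : {set V} -> R) :
    \sum_B (\sum_B1 \sum_(B2 | B1 :|: B2 == B) w1 B1 * w2 B2) * f B =
    \sum_B1 w1 B1 * \sum_B2 w2 B2 * f (B1 :|: B2).
  under eq_bigr do rewrite mulr_suml.
  rewrite exchange_big /=; apply: eq_bigr => B1 _.
  under eq_bigr do rewrite mulr_suml.
  rewrite (exchange_big_dep xpredT) //= mulr_sumr; apply: eq_bigr => B2 _.
  by rewrite (big_pred1 (B1 :|: B2)) ?mulrA // => B; rewrite eq_sym.
split=> [B||h C].
- by do 2!apply: sumr_ge0 => ? _; apply: mulr_ge0.
- have := E (fun=> 1); under eq_bigr do rewrite mulr1; move=> ->.
  by rewrite -mulr_suml -mulr_suml w1s w2s !mulr1.
- rewrite (E (fun B => h (B :|: C))) /= Q1E; apply: eq_bigr => B1 _.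
  rewrite Q2E; congr (_ * _); apply: eq_bigr => B2 _.
  by rewrite setUA [B2 :|: B1]setUC.
Qed.

Lemma set_average_iter Q n : set_average Q -> set_average (iter n Q).
Proof.
move=> avQ; elim: n => [|n IHn]; first exact: set_average_id.
exact: set_average_comp.
Qed.

(** The number of steps is uniform in [0 .. n - 1]; this makes the average of [Q h - h] telescope
    with a factor [1 / n]. *)
Definition window (n : nat) Q h C : R := n%:R^-1 * \sum_(a < n) iter a Q h C.

Lemma set_average_window n Q : (0 < n)%N -> set_average Q ->
  set_average (window n Q).
Proof.
move=> n_gt0 avQ.
have /choice [w wP] : forall a : 'I_n, exists w : {set V} -> R,
    [/\ forall B, 0 <= w B, \sum_B w B = 1 &
      forall h C, iter a Q h C = \sum_B w B * h (B :|: C)].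
  by move=> a; exact: set_average_iter.
exists (fun B => n%:R^-1 * \sum_(a < n) w a B); split=> [B||h C].
- by rewrite mulr_ge0 ?invr_ge0 // sumr_ge0 // => a _; have [] := wP a.
- rewrite -mulr_sumr exchange_big /= (eq_bigr (fun=> 1)) => [|a _].
    by rewrite sumr_const card_ord mulVf // pnatr_eq0 -lt0n.
  by have [] := wP a.
- rewrite /window; under [RHS]eq_bigr do rewrite -mulrA mulr_suml.
  rewrite -mulr_sumr exchange_big /=; congr (_ * _); apply: eq_bigr => a _.
  by have [_ _ ->] := wP a.
Qed.

Definition add_random (S : {set V}) h C : R :=
  #|S|%:R^-1 * \sum_(v in S) h (v |: C).

Lemma set_average_add (s : V -> {set V}) Q : (0 < #|V|)%N ->
  (forall h C, Q h C = #|V|%:R^-1 * \sum_v h (s v :|: C)) -> set_average Q.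
Proof.
move=> V_gt0 QE; exists (fun B => #|V|%:R^-1 * \sum_v (s v == B)%:R).
have E (f : {set V} -> R) :
    \sum_B (#|V|%:R^-1 * \sum_v (s v == B)%:R) * f B = #|V|%:R^-1 * \sum_v f (s v).
  under eq_bigr do rewrite -mulrA mulr_suml.
  rewrite -mulr_sumr exchange_big /=; congr (_ * _); apply: eq_bigr => v _.
  rewrite (bigD1 (s v)) //= eqxx mul1r big1 ?addr0 // => B.
  by rewrite eq_sym => /negbTE ->; rewrite mul0r.
split=> [B||h C].
- by rewrite mulr_ge0 ?invr_ge0 // sumr_ge0.
- have := E (fun=> 1); under eq_bigr do rewrite mulr1; move=> ->.
  by rewrite sumr_const mulVf // pnatr_eq0 -lt0n.
- by rewrite QE (E (fun B => h (B :|: C))).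
Qed.

Lemma set_average_add_random S : (0 < #|S|)%N -> set_average (add_random S).
Proof.
move=> S_gt0; exists (fun B => #|S|%:R^-1 * \sum_(v in S) ([set v] == B)%:R).
have E (f : {set V} -> R) :
    \sum_B (#|S|%:R^-1 * \sum_(v in S) ([set v] == B)%:R) * f B =
    #|S|%:R^-1 * \sum_(v in S) f [set v].
  under eq_bigr do rewrite -mulrA mulr_suml.
  rewrite -mulr_sumr exchange_big /=; congr (_ * _); apply: eq_bigr => v _.
  rewrite (bigD1 [set v]) //= eqxx mul1r big1 ?addr0 // => B.
  by rewrite eq_sym => /negbTE ->; rewrite mul0r.
split=> [B||h C].
- by rewrite mulr_ge0 ?invr_ge0 // sumr_ge0.
- have := E (fun=> 1); under eq_bigr do rewrite mulr1; move=> ->.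
  by rewrite sumr_const mulVf // pnatr_eq0 -lt0n.
- by rewrite (E (fun B => h (B :|: C))).
Qed.

Lemma set_average_comm Q1 Q2 h : set_average Q1 -> set_average Q2 ->
  Q1 (Q2 h) = Q2 (Q1 h).
Proof.
move=> [w1 [_ _ Q1E]] [w2 [_ _ Q2E]]; apply/funext => C.
rewrite Q1E Q2E; under eq_bigr do rewrite Q2E mulr_sumr.
rewrite exchange_big /=; apply: eq_bigr => B2 _; rewrite Q1E mulr_sumr.
by apply: eq_bigr => B1 _; rewrite mulrCA setUCA.
Qed.

Lemma set_average_le Q h1 h2 C : set_average Q -> (forall C, h1 C <= h2 C) ->
  Q h1 C <= Q h2 C.
Proof.
by move=> [w [w_ge _ QE]] h12; rewrite !QE; apply: ler_sum => B _; apply: ler_wpM2l.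
Qed.

Lemma set_average_cst Q c C : set_average Q -> Q (fun=> c) C = c.
Proof. by move=> [w [_ ws QE]]; rewrite QE -mulr_suml ws mul1r. Qed.

Lemma set_averageD Q h1 h2 C : set_average Q ->
  Q (fun C => h1 C + h2 C) C = Q h1 C + Q h2 C.
Proof.
move=> [w [_ _ QE]]; rewrite !QE -big_split; apply: eq_bigr => B _.
exact: mulrDr.
Qed.

Lemma set_averageZ Q c h C : set_average Q ->
  Q (fun C => c * h C) C = c * Q h C.
Proof.
by move=> [w [_ _ QE]]; rewrite !QE mulr_sumr; apply: eq_bigr => B _; rewrite mulrCA.
Qed.

Lemma set_averageB Q h1 h2 C : set_average Q ->
  Q (fun C => h1 C - h2 C) C = Q h1 C - Q h2 C.
Proof.
move=> avQ; rewrite (@set_averageD Q h1 (fun C => - h2 C)) //; congr (_ + _).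
rewrite -mulN1r -set_averageZ //; congr (Q _ C); apply/funext => B.
by rewrite mulN1r.
Qed.

Lemma set_average_sum Q (I : Type) (r : seq I) (p : pred I) (f : I -> {set V} -> R) C :
  set_average Q ->
  Q (fun C => \sum_(i <- r | p i) f i C) C = \sum_(i <- r | p i) Q (f i) C.
Proof.
move=> [w [_ _ QE]]; rewrite QE; under [RHS]eq_bigr do rewrite QE.
by rewrite exchange_big /=; apply: eq_bigr => B _; rewrite mulr_sumr.
Qed.

Lemma set_average_mono Q h C : set_average Q ->
  (forall v C, h C <= h (v |: C)) -> h C <= Q h C.
Proof.
move=> [w [w_ge ws QE]] hmono.
have hU B : h C <= h (B :|: C).
  rewrite -[B]set_enum; elim: (enum B) => [|v s IHs].
    by rewrite set_nil set0U.
  by rewrite set_cons -setUA; exact: le_trans IHs (hmono _ _).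
rewrite QE -[leLHS]mul1r -ws mulr_suml.
by apply: ler_sum => B _; apply: ler_wpM2l.
Qed.

Lemma set_average_foldr (I : Type) (q : I -> ({set V} -> R) -> {set V} -> R) s :
  (forall i, set_average (q i)) -> set_average (foldr (fun i Q => q i \o Q) id s).
Proof.
move=> avq; elim: s => [|i s IHs] /=; first exact: set_average_id.
exact: set_average_comp.
Qed.

(** Commutation brings the operator of one block innermost, where an estimate valid for every base
    set can be applied. *)
Lemma foldr_average_rem (I : eqType) (q : I -> ({set V} -> R) -> {set V} -> R)
    s i h : (forall i, set_average (q i)) -> i \in s ->
  foldr (fun i Q => q i \o Q) id s h =
  foldr (fun i Q => q i \o Q) id (rem i s) (q i h).
Proof.
move=> avq; elim: s => //= j s IHs; rewrite in_cons.
have [<-{j} _|ji] := eqVneq i j; last by move=> /= /IHs ->.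
by apply: set_average_comm => //; exact: set_average_foldr.
Qed.

Definition mixed_diff F u v C : R :=
  F (u |: (v |: C)) - F (u |: C) - F (v |: C) + F C.

(** For the cut information of [S] the mixed difference is a conditional mutual information; this is
    the abstract form of its nonnegativity. *)
Definition supermodular_across S F := forall u v C,
  u \in S -> v \notin S -> 0 <= mixed_diff F u v C.

Section OneBlock.
Variables (S : {set V}) (F : {set V} -> R) (c : R).
Hypotheses (S_gt0 : (0 < #|S|)%N).
Hypotheses (F_super : supermodular_across S F).
Hypotheses (F_ge0 : forall C, 0 <= F C) (F_le : forall C, F C <= c).
Hypotheses (F_mono : forall v C, F C <= F (v |: C)).

Let n : R := #|V|%:R.
Let m : R := #|S|%:R.
Let T := add_random [set: V].
Let TS := add_random S.
Let K h C := n^-1 * \sum_v h ((if v \in S then set0 else [set v]) :|: C).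
(* Adding a uniform vertex, [T], differs from [K], which discards draws from [S],
   only by steps of [TS].  Lengthening the window of [TS] absorbs them ([TX]), so
   that [T] may be traded for [K], along which the sums telescope. *)
Let g C := \sum_(u in S) \sum_(v in ~: S) mixed_diff F u v C.
Let X a C := \sum_(s < a) iter s TS g C.

Let V_gt0 : (0 < #|V|)%N. Proof. exact: leq_trans S_gt0 (max_card _). Qed.
Let n_gt0 : 0 < n. Proof. by rewrite ltr0n. Qed.
Let m_gt0 : 0 < m. Proof. by rewrite ltr0n. Qed.
Let avT : set_average T. Proof. by apply: set_average_add_random; rewrite cardsT. Qed.
Let avTS : set_average TS. Proof. exact: set_average_add_random. Qed.
Let avK : set_average K.
Proof. exact: (set_average_add (s := fun v => if v \in S then set0 else [set v])). Qed.

Let KE h C : K h C = n^-1 * (\sum_(v in ~: S) h (v |: C) + m * h C).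
Proof.
rewrite /K (bigID (mem S)) /= addrC; congr (_ * (_ + _)).
- rewrite (eq_bigl (fun v => v \notin S)) //.
  by under eq_bigl do rewrite -in_setC; apply: eq_bigr => v; rewrite in_setC => /negbTE ->.
- by under eq_bigr => v -> do rewrite set0U; rewrite sumr_const -mulr_natl.
Qed.

Let TE h C : T h C = K h C - n^-1 * m * h C + n^-1 * m * TS h C.
Proof.
rewrite KE /T /TS /add_random cardsT -/n -/m.
have -> : \sum_(v in [set: V]) h (v |: C) =
    \sum_(v in ~: S) h (v |: C) + \sum_(v in S) h (v |: C).
  rewrite (bigID (mem S)) /= addrC; congr (_ + _); apply: eq_bigl => v.
    by rewrite !inE.
  by rewrite inE.
by field; rewrite !gt_eqF.
Qed.

(** A draw of [K] that falls into [S] leaves the set unchanged and contributes nothing to [K F - F],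
    so drawing from all of [V] instead of [~: S] only makes the normalisation [n]. *)
Let gE C : g C = m * n * (TS (K F) C - TS F C - K F C + F C).
Proof.
have KF C' : K F C' - F C' = n^-1 * \sum_(v in ~: S) (F (v |: C') - F C').
  rewrite KE sumrB sumr_const -[F C' *+ _]mulr_natl.
  have -> : #|~: S|%:R = n - m by rewrite /n /m -(cardsC S) natrD addrC addKr.
  by field; rewrite gt_eqF.
have -> : TS (K F) C - TS F C - K F C + F C =
          TS (fun C => (K F C - F C)) C - (K F C - F C).
  by rewrite set_averageB //; ring.
rewrite -[X in _ - X](set_average_cst _ C avTS) -set_averageB //.
rewrite /TS /add_random -/m -mulrA [n * _]mulrCA mulVKf ?gt_eqF // mulr_sumr.
apply: eq_bigr => u uS; rewrite !KF -mulrBr mulVKf ?gt_eqF // -sumrB.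
by apply: eq_bigr => v _; rewrite /mixed_diff setUCA; ring.
Qed.

Let g_ge0 C : 0 <= g C.
Proof.
apply: sumr_ge0 => u uS; apply: sumr_ge0 => v; rewrite in_setC => vS.
exact: F_super.
Qed.

Let KhK h C : (forall C, 0 <= h C) -> n^-1 * m * h C <= K h C.
Proof.
move=> h_ge0; rewrite KE mulrDr mulrA lerDr mulr_ge0 ?invr_ge0 ?(ltW n_gt0) //.
by apply: sumr_ge0.
Qed.

(** The excess of [T] over [K] on [X a] is [m / n] times [TS (X a) - X a], which telescopes to
    [iter a TS g - g]. Since [K] stays put with weight at least [m / n], the new summand
    [iter a TS g] of [X a.+1] pays for it. *)
Let TX a C : T (X a) C <= K (X a.+1) C.
Proof.
have XS C' : X a.+1 C' = X a C' + iter a TS g C' by rewrite /X big_ord_recr.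
have TSX C' : TS (X a) C' = X a.+1 C' - g C'.
  rewrite /X (set_average_sum _ _ _ _ avTS) big_ord_recl /= addrC addKr.
  by apply: eq_bigr => i _; rewrite -iterS.
rewrite TE TSX.
have -> : K (X a.+1) C = K (X a) C + K (iter a TS g) C.
  by rewrite -set_averageD //; congr (K _ C); apply/funext => C'; rewrite XS.
have iter_ge0 C' : 0 <= iter a TS g C'.
  rewrite -(set_average_cst 0 C' (set_average_iter a avTS)).
  exact: set_average_le (set_average_iter a avTS) g_ge0.
have := KhK C iter_ge0; rewrite XS.
have : 0 <= n^-1 * m * g C by rewrite !mulr_ge0 ?invr_ge0 ?(ltW n_gt0) ?(ltW m_gt0).
lra.
Qed.

Let TXb b a C : iter b T (X a) C <= iter b K (X (a + b)%N) C.
Proof.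
elim: b a C => [|b IHb] a C; first by rewrite addn0.
rewrite iterSr; apply: le_trans (set_average_le _ (set_average_iter b avT) (TX a)) _.
rewrite -[iter b T (K _)](set_average_comm _ avK (set_average_iter b avT)).
by rewrite addnS -addSn iterS; apply: set_average_le.
Qed.

(** The first telescoping, along [TS]: [X a] is [m n] times [(K - 1) (TS^a - 1) F]. *)
Let XE a C : X a C =
  m * n * (K (iter a TS F) C - iter a TS F C - K F C + F C).
Proof.
elim: a => [|a IHa]; first by rewrite /X big_ord0 /=; ring.
rewrite /X big_ord_recr /= -/(X a C) {}IHa.
have -> : iter a TS g C = m * n * (iter a TS (TS (K F)) C - iter a TS (TS F) C
   - iter a TS (K F) C + iter a TS F C).
  have av := set_average_iter a avTS.
  rewrite -!set_averageB // -set_averageD // -set_averageZ //.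
  by congr (iter a TS _ C); apply/funext => C'; exact: gE.
rewrite -!iterSr.
rewrite -(set_average_comm F avK (set_average_iter a.+1 avTS)).
rewrite -(set_average_comm F avK (set_average_iter a avTS)) /=; ring.
Qed.

Lemma window_mixed_diff (a b : nat) C : (0 < a)%N -> (0 < b)%N ->
  window b T (window a TS g) C <= m * n * c / (a%:R * b%:R).
Proof.
move=> a_gt0 b_gt0.
have E : window b T (window a TS g) C = (b%:R * a%:R)^-1 * \sum_(j < b) iter j T (X a) C.
  rewrite /window invfM -mulrA; congr (_ * _); rewrite mulr_sumr.
  by apply: eq_bigr => j _; rewrite -set_averageZ //; exact: set_average_iter.
rewrite {}E mulrC [a%:R * _]mulrC ler_wpM2r ?invr_ge0 ?mulr_ge0 //.
pose Y C := m * n * (iter (a + b) TS F C - F C).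
have XY : X (a + b)%N = fun C => K Y C - Y C.
  by apply/funext => C'; rewrite XE /Y set_averageZ // set_averageB //; ring.
(* [TXb] produces the length [a + j]. Enlarging it to the common length [a + b], which is allowed
   because [g] is nonnegative, leaves a function independent of [j], and the sum over [j] telescopes
   along [K]. *)
have leb : \sum_(j < b) iter j T (X a) C <= \sum_(j < b) iter j K (X (a + b)%N) C.
  apply: ler_sum => j _; apply: le_trans (TXb _ _ _) _.
  apply: set_average_le; first exact: set_average_iter.
  have -> : (a + b = a + j + (b - j))%N by rewrite -addnA subnKC // ltnW.
  move=> C'; rewrite /X [leRHS]big_split_ord /= lerDl; apply: sumr_ge0 => s _.
  set k := (_ + s)%N; rewrite -(set_average_cst 0 C' (set_average_iter k avTS)).
  exact: set_average_le (set_average_iter k avTS) g_ge0.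
apply: le_trans leb _; rewrite {}XY.
have -> : \sum_(j < b) iter j K (fun C => K Y C - Y C) C = iter b K Y C - Y C.
  move: Y => Y; elim: b {b_gt0} => [|j IHj]; first by rewrite big_ord0 subrr.
  rewrite big_ord_recr /= IHj (set_averageB _ _ _ (set_average_iter j avK)).
  by rewrite -[X in _ + (X - _)]/(iter j K (K Y) C) -iterSr /=; ring.
rewrite /Y (set_averageZ _ (fun C => iter (a + b) TS F C - F C) C (set_average_iter b avK)).
rewrite -mulrBr.
apply: ler_wpM2l; first by rewrite mulr_ge0 ?ltW.
rewrite set_averageB; last exact: set_average_iter.
have avb := set_average_iter b avK; have ava := set_average_iter (a + b) avTS.
have h1 : iter b K (iter (a + b) TS F) C <= c.
  rewrite -(set_average_cst c C avb); apply: set_average_le => // C'.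
  by rewrite -(set_average_cst c C' ava); apply: set_average_le.
have h2 : F C <= iter b K F C by apply: set_average_mono.
have h3 : 0 <= iter (a + b) TS F C.
  by rewrite -(set_average_cst 0 C ava); apply: set_average_le.
lra.
Qed.

End OneBlock.

(** The mean number of steps of the window is [(n - 1) / 2], and each step adds [v] with probability
    at most [q]. *)
Lemma window_mem (v : V) Q C q (n : nat) (d : R) : (0 < n)%N -> 0 <= q ->
  (n%:R - 1) * q <= 2 * d -> set_average Q ->
  (forall C, Q (fun C => (v \in C)%:R) C <= (v \in C)%:R + q) ->
  window n Q (fun C => (v \in C)%:R) C <= (v \in C)%:R + d.
Proof.
move=> n_gt0 q_ge0 nqd avQ Qv.
have itQ k C' : iter k Q (fun C => (v \in C)%:R) C' <= (v \in C')%:R + k%:R * q.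
  elim: k C' => [|k IHk] C'; first by rewrite mul0r addr0.
  rewrite iterS; apply: le_trans (set_average_le C' avQ IHk) _.
  rewrite set_averageD // (set_average_cst _ _ avQ) mulrSr mulrDl mul1r addrA addrAC.
  by rewrite lerD2r.
rewrite /window ler_pdivrMl ?ltr0n //.
apply: (@le_trans _ _ (\sum_(k < n) ((v \in C)%:R + k%:R * q))).
  by apply: ler_sum => k _; exact: itQ.
rewrite big_split /= sumr_const card_ord -[X in X + _ <= _]mulr_natl mulrDr lerD2l -mulr_suml.
have -> : \sum_(k < n) k%:R = n%:R * (n%:R - 1) / 2 :> R.
  elim: n {n_gt0 nqd} => [|n IHn]; first by rewrite big_ord0 !mul0r.
  by rewrite big_ord_recr /= IHn -natr1; field.
have n0 : 0 <= n%:R :> R by [].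
have := ler_wpM2l n0 nqd; nra.
Qed.

Lemma add_random_mem (v : V) S C : (0 < #|S|)%N ->
  add_random S (fun C => (v \in C)%:R) C <= (v \in C)%:R + (v \in S)%:R / #|S|%:R.
Proof.
move=> S_gt0; rewrite /add_random.
apply: (@le_trans _ _ (#|S|%:R^-1 * \sum_(u in S) ((v \in C)%:R + (u == v)%:R))).
  rewrite ler_wpM2l ?invr_ge0 //; apply: ler_sum => u _.
  by rewrite !inE eq_sym; case: (u == v); case: (v \in C); rewrite /= ?addr0 ?add0r ?lerDl.
rewrite big_split /= sumr_const -[X in _ * (X + _)]mulr_natl mulrDr mulKf ?pnatr_eq0 -?lt0n //.
rewrite lerD2l [leRHS]mulrC ler_wpM2l ?invr_ge0 //.
rewrite -natr_sum ler_nat.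
have [vS|vS] := boolP (v \in S).
  by rewrite (bigD1 v) //= eqxx big1 // => u /andP[_ /negbTE ->].
by rewrite big1 // => u uS; case: eqP => // uv; rewrite -uv uS in vS.
Qed.

(* The random set is the union of a uniformly random number, at most [d |V|], of
   uniform vertices and, for each block, of a uniformly random number, at most
   [d m], of uniform vertices of the block. *)
Lemma exists_random_set (k : nat) (P : 'I_k -> {set V}) (m : nat) (d : R) :
  (0 < #|V|)%N -> (0 < m)%N -> (forall i, #|P i| = m) ->
  (forall i j, i != j -> [disjoint P i & P j]) -> 0 < d ->
  exists2 Q, set_average Q &
    (forall v, Q (fun C => (v \in C)%:R) set0 <= d) /\
    (forall i F c, supermodular_across (P i) F -> (forall C, 0 <= F C) ->
      (forall C, F C <= c) -> (forall v C, F C <= F (v |: C)) ->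
      Q (fun C => \sum_(u in P i) \sum_(v in ~: P i) mixed_diff F u v C) set0
        <= c / d ^+ 2).
Proof.
move=> V_gt0 m_gt0 Pm Pdisj d_gt0.
(* The step count takes [N S >= d |S|] values, while its mean is at most [d |S| / 2]. Thus rounding
   [d |S|] costs nothing in either estimate. *)
pose N S := (Num.truncn (d * #|S|%:R)).+1.
have N_ge S : d * #|S|%:R <= (N S)%:R by rewrite ltW // truncnS_gt.
have N_mem (S : {set V}) v C : (0 < #|S|)%N ->
    window (N S) (add_random S) (fun C => (v \in C)%:R) C
      <= (v \in C)%:R + (v \in S)%:R * (d / 2).
  move=> S_gt0; apply: (@window_mem _ _ _ ((v \in S)%:R / #|S|%:R)) => //.
  - rewrite /N -natr1 addrK mulrCA -[leRHS]mulrCA ler_wpM2l // [2 * _]mulrC divfK //.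
    by rewrite ler_pdivrMr ?ltr0n // truncn_le ?mulr_ge0 // ltW.
  - exact: set_average_add_random.
  - by move=> C'; exact: add_random_mem.
pose q j := window (N (P j)) (add_random (P j)).
have Pj_gt0 j : (0 < #|P j|)%N by rewrite Pm.
have avq j : set_average (q j).
  by apply: set_average_window => //; exact: set_average_add_random.
pose T := window (N [set: V]) (add_random [set: V]).
have avT : set_average T.
  by apply: set_average_window => //; apply: set_average_add_random; rewrite cardsT.
pose G s := foldr (fun j Q => q j \o Q) id s.
exists (G (enum 'I_k) \o T); first by apply: set_average_comp => //; exact: set_average_foldr.
split=> [v|i F c Fs F0 Fc Fm].
- have GE s C : G s (fun C => (v \in C)%:R) C <=
      (v \in C)%:R + \sum_(j <- s) (v \in P j)%:R * (d / 2).
    elim: s C => [|j s IHs] C; first by rewrite big_nil addr0.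
    rewrite /= -/(G s) big_cons; apply: le_trans (set_average_le C (avq j) IHs) _.
    rewrite set_averageD // (set_average_cst _ _ (avq j)) addrA lerD2r.
    exact: N_mem.
  have avG s : set_average (G s) by exact: set_average_foldr.
  have T_le C : T (fun C => (v \in C)%:R) C <= (v \in C)%:R + d / 2.
    by have := @N_mem [set: V] v C; rewrite cardsT inE mul1r => ->.
  apply: le_trans (set_average_le set0 (avG _) T_le) _.
  rewrite set_averageD // (set_average_cst _ _ (avG _)).
  have := GE (enum 'I_k) set0; rewrite in_set0 add0r -mulr_suml.
  (* A vertex lies in at most one block, so the draws inside blocks contribute at most [d / 2], as
     do the global draws. *)
  suff : \sum_(j <- enum 'I_k) (v \in P j)%:R <= 1 :> R by nra.
  rewrite big_enum /= -natr_sum lern1.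
  have [[j vj]|noj] := pselect (exists j, v \in P j).
    rewrite (bigD1 j) //= vj big1 // => l lj; case vl: (v \in P l) => //.
    by have /disjointFr := Pdisj _ _ lj => /(_ v vl); rewrite vj.
  by rewrite big1 // => j _; case vj: (v \in P j) => //; case: noj; exists j.
- have ie : i \in enum 'I_k by rewrite mem_enum.
  (* The draws of the other blocks merely enlarge the base set [C], in which the bound for block [i]
     is uniform. *)
  rewrite /= /G (foldr_average_rem _ avq ie).
  have avG s : set_average (G s) by exact: set_average_foldr.
  rewrite -/(G _) -[q i (T _)](set_average_comm _ avT (avq i)).
  rewrite -(set_average_cst (c / d ^+ 2) set0 (avG (rem i (enum 'I_k)))).
  apply: set_average_le => // C.
  have := @window_mixed_diff _ F c (Pj_gt0 i) Fs F0 Fc Fm (N (P i)) (N [set: V]) C isT isT.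
  move=> /le_trans; apply.
  have c_ge0 : 0 <= c by exact: le_trans (F0 set0) (Fc set0).
  have := N_ge (P i); have := N_ge [set: V]; rewrite cardsT => hV hP.
  have n0 : 0 < #|V|%:R :> R by rewrite ltr0n.
  have m0 : 0 < #|P i|%:R :> R by rewrite ltr0n.
  rewrite ler_pdivrMr; last by rewrite mulr_gt0 ?ltr0n.
  rewrite [leRHS]mulrAC ler_pdivlMr ?exprn_gt0 //.
  have := ler_pM (mulr_ge0 (ltW d_gt0) (ltW m0)) (mulr_ge0 (ltW d_gt0) (ltW n0)) hP hV.
  by move=> /(ler_wpM2l c_ge0); apply: le_trans; rewrite le_eqVlt; apply/orP; left; apply/eqP; ring.
Qed.

End RandomSet.

(** * Mutual information of measurement outcomes *)

Section ScalarInequalities.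
Import numFieldNormedType.Exports.
Local Open Scope classical_set_scope.
Local Open Scope ring_scope.
Context {R : realType}.
Implicit Types (f df : R -> R) (a b x r : R).

Lemma le_of_derive_ge0 f df a b : a <= b ->
  (forall x, a <= x <= b -> is_derive x 1 f (df x)) ->
  (forall x, a < x < b -> 0 <= df x) -> f a <= f b.
Proof.
rewrite le_eqVlt => /predU1P[-> //|ab] fd df_ge0.
have fd' x : x \in `]a, b[ -> is_derive x 1 f (df x).
  by rewrite in_itv => /andP[ax xb]; apply: fd; rewrite !ltW.
have fc : {within `[a, b]%classic, continuous f}.
  apply: derivable_within_continuous => x; rewrite in_itv => /fd xd.
  exact: ex_derive.
have [c] := MVT ab fd' fc; rewrite in_itv => /df_ge0 c_ge0 fba.
by rewrite -subr_ge0 fba mulr_ge0 // subr_ge0 ltW.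
Qed.

(** The rational function agrees with [ln] to third order at 1: the difference has derivative
    [(x - 1)^3 / (x (x + 2))^2], hence its minimum 0 at [x = 1]. *)
Lemma ln_lower_bound r : 0 < r ->
  (r - 1) * (5 * r + 1) / (2 * r * (r + 2)) <= ln r.
Proof.
move=> r_gt0.
pose f x : R := ln x - (x - 1) * (5 * x + 1) * (2 * x * (x + 2))^-1.
pose df x : R := (x - 1) ^+ 3 / (x ^+ 2 * (x + 2) ^+ 2).
have fd x : 0 < x -> is_derive x 1 f (df x).
  move=> x0; have x2 : x + 2 != 0 by rewrite gt_eqF // addr_gt0.
  have den : 2 * x * (x + 2) != 0 by rewrite !mulf_neq0 // gt_eqF.
  have lnd := is_derive1_ln x0.
  have Vd : is_derive x 1 (fun x : R => (2 * x * (x + 2))^-1)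
      (- (2 * x * (x + 2)) ^- 2 *: (4 * x + 4)).
    apply: is_deriveV => //; apply: is_derive_eq; rewrite /GRing.scale /=; ring.
  have Nd : is_derive x 1 (fun x : R => (x - 1) * (5 * x + 1)) (10 * x - 4).
    by apply: is_derive_eq; rewrite /GRing.scale /=; ring.
  have fE : f = (@ln R - (fun x : R => (x - 1) * (5 * x + 1)) *
                         (fun x : R => (2 * x * (x + 2))^-1))%R by [].
  rewrite fE; apply: is_derive_eq; rewrite /GRing.scale /= /df; field.
  by rewrite x2 gt_eqF.
have f1 : f 1 = 0 by rewrite /f ln1 subrr !mul0r subr0.
suff : 0 <= f r by rewrite /f subr_ge0.
have dfE x : df x = (x - 1) * ((x - 1) ^+ 2 / (x ^+ 2 * (x + 2) ^+ 2)).
  by rewrite /df exprS mulrA.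
have q_ge0 x : 0 <= (x - 1) ^+ 2 / (x ^+ 2 * (x + 2) ^+ 2).
  by rewrite divr_ge0 ?sqr_ge0 // mulr_ge0 ?sqr_ge0.
have [r1|r1] := leP 1 r.
  rewrite -f1; apply: (le_of_derive_ge0 (df := df)) => // x /andP[x1 _].
    by apply: fd; exact: lt_le_trans x1.
  by rewrite dfE mulr_ge0 // subr_ge0 ltW.
rewrite -oppr_le0 -oppr0 -f1.
apply: (le_of_derive_ge0 (f := fun x => - f x) (df := fun x => - df x)); first exact: ltW.
  move=> x /andP[rx _]; have := fd x (lt_le_trans r_gt0 rx) => ?.
  exact: is_deriveN.
by move=> x /andP[_ x1]; rewrite dfE -mulNr mulr_ge0 // opprB subr_ge0 ltW.
Qed.

(** The pointwise inequality behind Pinsker's, [3 (r - 1)^2 <= (2 r + 4) (r ln r - r + 1)] at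
    [r = P / Q], in homogeneous form. *)
Lemma xlnx_lower_bound (P Q : R) : 0 <= P -> 0 <= Q -> (Q = 0 -> P = 0) ->
  3 * (P - Q) ^+ 2 / (2 * (P + 2 * Q)) <= P * (ln P - ln Q) - P + Q.
Proof.
rewrite le_eqVlt => /predU1P[<- Q_ge0 _|P_gt0].
  rewrite mul0r subr0 !add0r sqrrN.
  have [->|Q0] := eqVneq Q 0; first by rewrite expr0n mulr0 mul0r.
  by rewrite ler_pdivrMr ?mulr_gt0 ?lt0r ?Q0 //; nra.
rewrite le_eqVlt => /predU1P[<- /(_ erefl) P0|Q_gt0 _].
  by rewrite P0 ltxx in P_gt0.
have := ln_lower_bound (divr_gt0 P_gt0 Q_gt0).
rewrite ln_div ?posrE // => /(ler_wpM2l (ltW P_gt0)) h.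
apply: (@le_trans _ _ (P * ((P / Q - 1) * (5 * (P / Q) + 1) /
   (2 * (P / Q) * (P / Q + 2))) - P + Q)); last by rewrite lerD2r lerD2r.
rewrite le_eqVlt; apply/orP; left; apply/eqP; field.
by rewrite !gt_eqF //; lra.
Qed.

(* Pinsker's inequality with its square root linearised pointwise. *)
Lemma abs_diff_xlnx (P Q t : R) : 0 <= P -> 0 <= Q -> (Q = 0 -> P = 0) -> 0 < t ->
  `|P - Q| <= t * (P * (ln P - ln Q) - P + Q) + (P + 2 * Q) / (6 * t).
Proof.
move=> P_ge0 Q_ge0 QP t_gt0.
have := xlnx_lower_bound P_ge0 Q_ge0 QP => /(ler_wpM2l (ltW t_gt0)) h.
apply: le_trans (lerD h (lexx _)).
have [s0|s_neq0] := eqVneq (P + 2 * Q) 0.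
  have [-> ->] : P = 0 /\ Q = 0 by split; lra.
  by rewrite subrr normr0 expr0n /= !(mulr0, mul0r, addr0).
have s_gt0 : 0 < P + 2 * Q by rewrite lt0r s_neq0; lra.
rewrite -subr_ge0.
have -> : t * (3 * (P - Q) ^+ 2 / (2 * (P + 2 * Q))) + (P + 2 * Q) / (6 * t) - `|P - Q| =
   (3 * t * `|P - Q| - (P + 2 * Q)) ^+ 2 / (6 * t * (P + 2 * Q)).
  rewrite -[(P - Q) ^+ 2]real_normK ?num_real //; field.
  by rewrite s_neq0 gt_eqF.
by rewrite divr_ge0 ?sqr_ge0 // !mulr_ge0 // ltW.
Qed.

End ScalarInequalities.

(** * Outcome strings on varying subsets, kept in a single function type *)

Section FrozenSums.
Import boot.finset.
Context {V Om : finType} (o0 : Om) {W : nmodType}.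
Implicit Types (C : {set V}) (z : {ffun V -> Om}) (u v : V) (o : Om).

Definition upd z u o : {ffun V -> Om} := [ffun w => if w == u then o else z w].

(* The coordinates outside [C] are frozen to [o0]. *)
Definition sum_on C (h : {ffun V -> Om} -> W) : W :=
  \sum_(z : {ffun V -> Om} | [forall w, (w \notin C) ==> (z w == o0)]) h z.

Lemma upd_id z u o : upd z u o u = o. Proof. by rewrite ffunE eqxx. Qed.

Lemma upd_neq z u o w : w != u -> upd z u o w = z w.
Proof. by rewrite ffunE => /negbTE ->. Qed.

Lemma sum_onU1 C u h : u \notin C ->
  sum_on (u |: C) h = sum_on C (fun z => \sum_o h (upd z u o)).
Proof.
move=> uC; rewrite /sum_on pair_big_dep /=.
rewrite (reindex_onto (fun x : {ffun V -> Om} * Om => upd x.1 u x.2)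
  (fun z => (upd z u o0, z u))) => [|z _]; last first.
  by apply/ffunP => w; rewrite ffunE /=; case: eqVneq => [->|wu] //; rewrite upd_neq.
apply: eq_bigl => -[z o] /=; rewrite andbT; apply/andP/forallP => [[/forallP zu]|zC].
  rewrite xpair_eqE upd_id eqxx andbT => /eqP zE w; apply/implyP => wC.
  have [wu|wu] := eqVneq w u; first by rewrite -zE wu upd_id.
  by have := zu w; rewrite !inE negb_or wu wC /= upd_neq.
split; last first.
  rewrite xpair_eqE upd_id eqxx andbT; apply/eqP/ffunP => w; rewrite !ffunE.
  by case: eqVneq => // ->; have := zC u; rewrite uC /= => /eqP.
apply/forallP => w; rewrite !inE negb_or; apply/implyP => /andP[wu wC].
by rewrite upd_neq //; have := zC w; rewrite wC.
Qed.

Lemma sum_on_set0 h : sum_on set0 h = h [ffun=> o0].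
Proof.
rewrite /sum_on (big_pred1 [ffun=> o0]) // => z; apply/forallP/eqP => [zE|-> w].
  by apply/ffunP => w; have := zE w; rewrite inE ffunE => /eqP.
by rewrite ffunE eqxx implybT.
Qed.

Lemma sum_on_setT h : sum_on [set: V] h = \sum_z h z.
Proof. by apply: eq_bigl => z; apply/forallP => w; rewrite inE. Qed.

Lemma eq_sum_on C h1 h2 : h1 =1 h2 -> sum_on C h1 = sum_on C h2.
Proof. by move=> h12; apply: eq_bigr. Qed.

End FrozenSums.

(** * Entropy, conditional information and cut information of classical outcomes *)

Section ConsistentFamily.
Import boot.finset.
Context {R : realType} {V Om : finType} (o0 : Om).
Implicit Types (C S : {set V}) (z : {ffun V -> Om}) (u v : V) (o : Om).
Local Notation sum_on := (sum_on o0).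

Variable p : {set V} -> {ffun V -> Om} -> R.

(* [p C z] is the probability that the coordinates in [C] read as in [z]. *)
Definition consistent_family :=
  [/\ forall C z, 0 <= p C z, forall z, p set0 z = 1,
      forall C u z o, u \notin C -> p C (upd z u o) = p C z &
      forall C u z, u \notin C -> \sum_o p (u |: C) (upd z u o) = p C z].

Definition ent C : R := - sum_on C (fun z => p C z * ln (p C z)).

Definition cond_info u v C : R :=
  ent (u |: C) + ent (v |: C) - ent C - ent (u |: (v |: C)).

Definition cut_info S C : R := ent (C :&: S) + ent (C :\: S) - ent C.

Hypothesis pP : consistent_family.
Let p_ge0 : forall C z, 0 <= p C z. Proof. by case: pP. Qed.
Let p_set0 : forall z, p set0 z = 1. Proof. by case: pP. Qed.
Let p_upd : forall C u z o, u \notin C -> p C (upd z u o) = p C z.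
Proof. by case: pP. Qed.
Let p_marg : forall C u z, u \notin C -> \sum_o p (u |: C) (upd z u o) = p C z.
Proof. by case: pP. Qed.

Lemma sum_on_marginal1 C u h : u \notin C ->
  (forall z o, h (upd z u o) = h z) ->
  sum_on (u |: C) (fun z => p (u |: C) z * h z) = sum_on C (fun z => p C z * h z).
Proof.
move=> uC hu; rewrite sum_onU1 //; apply: eq_sum_on => z.
by under eq_bigr do rewrite hu; rewrite -mulr_suml p_marg.
Qed.

Lemma sum_on_marginal C C' h : C \subset C' ->
  (forall u z o, u \notin C -> h (upd z u o) = h z) ->
  sum_on C' (fun z => p C' z * h z) = sum_on C (fun z => p C z * h z).
Proof.
move=> CC' hC.
have {CC'} -> : C' = [set:: enum (C' :\: C)] :|: C.
  by rewrite set_enum setUC setDE setUIr setUCr setIT; exact/esym/setUidPr.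
have : {subset enum (C' :\: C) <= ~: C}.
  by move=> u; rewrite mem_enum !inE => /andP[].
elim: (enum _) (enum_uniq (C' :\: C)) => [_ _|u s IHs /= /andP[us s_uniq] sC].
  by rewrite set_nil set0U.
have uC : u \notin C by have := sC u; rewrite !inE eqxx => ->.
rewrite set_cons -setUA sum_on_marginal1 => [|| z o]; last exact: hC.
- by apply: IHs => // v vs; apply: sC; rewrite inE vs orbT.
- by rewrite !inE negb_or us.
Qed.

Lemma consistent_le C C' z : C \subset C' -> p C' z <= p C z.
Proof.
move=> CC'; have {CC'} -> : C' = [set:: enum C'] :|: C.
  by rewrite set_enum; exact/esym/setUidPl.
elim: (enum C') => [|u s IHs]; first by rewrite set_nil set0U.
rewrite set_cons -setUA; apply: le_trans IHs; set D := [set:: s] :|: C.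
have [uD|uD] := boolP (u \in D).
  by rewrite (setUidPr _) // sub1set.
have zE : z = upd z u (z u) by apply/ffunP => w; rewrite ffunE; case: eqP => [->|].
rewrite -(p_marg z uD) (bigD1 (z u)) //= -zE lerDl.
exact: sumr_ge0.
Qed.

Lemma sum_on_total C : sum_on C (p C) = 1.
Proof.
transitivity (sum_on C (fun z => p C z * 1)); first by apply: eq_sum_on => z; rewrite mulr1.
by rewrite (@sum_on_marginal set0 C (fun=> 1)) ?sub0set // sum_on_set0 p_set0 mulr1.
Qed.

Lemma ent_sum C C' : C \subset C' ->
  ent C = - sum_on C' (fun z => p C' z * ln (p C z)).
Proof.
move=> CC'; congr (- _).
by rewrite (sum_on_marginal (h := fun z => ln (p C z)) CC') // => u z o uC; rewrite p_upd.
Qed.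

Section Pair.
Variables (C : {set V}) (u v : V).
Hypotheses (uv : u != v) (uC : u \notin C) (vC : v \notin C).

Let upd2 z o o' := upd (upd z v o') u o.
Let P z o o' := p (u |: (v |: C)) (upd2 z o o').
Let Pu z o := p (u |: C) (upd z u o).
Let Pv z o' := p (v |: C) (upd z v o').

Let uvC : u \notin v |: C. Proof. by rewrite !inE negb_or uv. Qed.
Let vuC : v \notin u |: C. Proof. by rewrite !inE negb_or eq_sym uv. Qed.

Let updC z o o' : upd2 z o o' = upd (upd z u o) v o'.
Proof.
apply/ffunP => w; rewrite !ffunE; case: eqVneq => [->|//].
by rewrite (negbTE uv).
Qed.

Let PuE z o o' : p (u |: C) (upd2 z o o') = Pu z o.
Proof. by rewrite updC p_upd. Qed.
Let PvE z o o' : p (v |: C) (upd2 z o o') = Pv z o'.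
Proof. by rewrite /upd2 p_upd. Qed.
Let PcE z o o' : p C (upd2 z o o') = p C z.
Proof. by rewrite /upd2 !p_upd. Qed.
Let sumP z o : \sum_o' P z o o' = Pu z o.
Proof.
rewrite /Pu -(p_marg _ vuC); apply: eq_bigr => o' _.
by rewrite /P updC setUCA.
Qed.
Let sumP' z o' : \sum_o P z o o' = Pv z o'.
Proof. by rewrite /Pv -(p_marg _ uvC). Qed.
Let sumPu z : \sum_o Pu z o = p C z. Proof. exact: p_marg. Qed.
Let sumPv z : \sum_o' Pv z o' = p C z. Proof. exact: p_marg. Qed.

Let Pu_eq0 z o o' : Pu z o = 0 -> P z o o' = 0.
Proof.
rewrite -sumP => /eqP; rewrite psumr_eq0 => [/allP P0|? _]; last exact: p_ge0.
by have := P0 o'; rewrite mem_index_enum => /(_ isT)/eqP.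
Qed.
Let Pv_eq0 z o o' : Pv z o' = 0 -> P z o o' = 0.
Proof.
rewrite -sumP' => /eqP; rewrite psumr_eq0 => [/allP P0|? _]; last exact: p_ge0.
by have := P0 o; rewrite mem_index_enum => /(_ isT)/eqP.
Qed.
Let Pc_eq0 z o : p C z = 0 -> Pu z o = 0.
Proof.
rewrite -sumPu => /eqP; rewrite psumr_eq0 => [/allP P0|? _]; last exact: p_ge0.
by have := P0 o; rewrite mem_index_enum => /(_ isT)/eqP.
Qed.

Let cond_infoE : cond_info u v C = sum_on C (fun z => \sum_o \sum_o'
  P z o o' * (ln (P z o o') - ln (Pu z o * Pv z o' / p C z))).
Proof.
have sub1 : v |: C \subset u |: (v |: C) by rewrite subsetUr.
have sub2 : u |: C \subset u |: (v |: C) by rewrite setUS // subsetUr.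
have sub3 : C \subset u |: (v |: C) by rewrite setUA subsetUr.
pose D := u |: (v |: C).
have -> : cond_info u v C = sum_on D (fun z =>
    p D z * (ln (p D z) + ln (p C z) - ln (p (u |: C) z) - ln (p (v |: C) z))).
  rewrite /cond_info (ent_sum sub1) (ent_sum sub2) (ent_sum sub3) /ent -/D.
  rewrite [RHS](_ : _ = sum_on D (fun z => p D z * ln (p D z))
    + sum_on D (fun z => p D z * ln (p C z))
    - sum_on D (fun z => p D z * ln (p (u |: C) z))
    - sum_on D (fun z => p D z * ln (p (v |: C) z))); first by ring.
  by rewrite -big_split -!sumrB; apply: eq_bigr => z _ /=; ring.
rewrite /D !sum_onU1 //.
apply: eq_sum_on => z; rewrite exchange_big /=; apply: eq_bigr => o _.
apply: eq_bigr => o' _; rewrite -/(upd2 z o o') PuE PvE PcE -/(P z o o').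
have [P0|P_neq0] := eqVneq (P z o o') 0; first by rewrite P0; ring.
have Pu_gt0 : 0 < Pu z o.
  by rewrite lt0r p_ge0 andbT; apply: contra P_neq0 => /eqP/Pu_eq0 ->.
have Pv_gt0 : 0 < Pv z o'.
  by rewrite lt0r p_ge0 andbT; apply: contra P_neq0 => /eqP/Pv_eq0 ->.
have Pc_gt0 : 0 < p C z.
  by rewrite lt0r p_ge0 andbT; apply: contraTN Pu_gt0 => /eqP/Pc_eq0 ->; rewrite ltxx.
by rewrite ln_div ?lnM ?posrE ?mulr_gt0 //; ring.
Qed.

(** For each [z], both [P] and its product approximation have total mass [p C z]. In the sum of the
    pointwise inequalities the terms [- P + Q] therefore cancel, and [(P + 2 Q) / (6 t)] adds up to
    [(2 t)^-1]. *)
Lemma cond_pinsker t : 0 < t ->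
  sum_on C (fun z => \sum_o \sum_o' `|P z o o' - Pu z o * Pv z o' / p C z|)
    <= t * cond_info u v C + (2 * t)^-1.
Proof.
move=> t_gt0; pose Q z o o' := Pu z o * Pv z o' / p C z.
have Q_ge0 z o o' : 0 <= Q z o o' by rewrite divr_ge0 ?mulr_ge0 ?p_ge0.
have QP z o o' : Q z o o' = 0 -> P z o o' = 0.
  move/eqP; rewrite !mulf_eq0 invr_eq0 -orbA => /or3P[]/eqP.
  - exact: Pu_eq0.
  - exact: Pv_eq0.
  - by move=> /(Pc_eq0 o); exact: Pu_eq0.
have sumPc z : \sum_o \sum_o' P z o o' = p C z.
  by rewrite -sumPu; apply: eq_bigr => o _; exact: sumP.
have sumQ z : \sum_o \sum_o' Q z o o' = p C z.
  under eq_bigr => o _ do rewrite -mulr_suml -mulr_sumr sumPv.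
  rewrite -!mulr_suml sumPu.
  by have [->|Pc0] := eqVneq (p C z) 0; [rewrite !mul0r | rewrite mulfK].
apply: (@le_trans _ _ (sum_on C (fun z => \sum_o \sum_o'
   (t * (P z o o' * (ln (P z o o') - ln (Q z o o')) - P z o o' + Q z o o')
    + (P z o o' + 2 * Q z o o') / (6 * t))))).
  apply: ler_sum => z _; apply: ler_sum => o _; apply: ler_sum => o' _.
  by apply: (abs_diff_xlnx _ _ (@QP z o o')) => //; exact: p_ge0.
rewrite cond_infoE.
have -> : sum_on C (fun z => \sum_o \sum_o'
     (t * (P z o o' * (ln (P z o o') - ln (Q z o o')) - P z o o' + Q z o o')
      + (P z o o' + 2 * Q z o o') / (6 * t))) =
   sum_on C (fun z => t * (\sum_o \sum_o' P z o o' * (ln (P z o o') - ln (Q z o o')))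
      + p C z * (2 * t)^-1).
  apply: eq_sum_on => z.
  transitivity (t * (\sum_o \sum_o' P z o o' * (ln (P z o o') - ln (Q z o o')))
     + (- t + (6 * t)^-1) * (\sum_o \sum_o' P z o o')
     + (t + 2 / (6 * t)) * (\sum_o \sum_o' Q z o o')).
    rewrite !mulr_sumr -!big_split /=; apply: eq_bigr => o _.
    rewrite !mulr_sumr -!big_split /=; apply: eq_bigr => o' _.
    by field; rewrite gt_eqF.
  by rewrite sumPc sumQ; field; rewrite gt_eqF.
rewrite /sum_on big_split /= -mulr_sumr -mulr_suml -/(sum_on C (p C)).
by rewrite sum_on_total mul1r.
Qed.

(** The left side of [cond_pinsker] is nonnegative for every [t]; a negative information would be
    contradicted by a large [t]. *)
Lemma cond_info_ge0_out : 0 <= cond_info u v C.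
Proof.
rewrite leNgt; apply/negP => J_lt0.
pose t : R := 1 + (- cond_info u v C)^-1.
have J_gt0 : 0 < - cond_info u v C by rewrite oppr_gt0.
have t_gt1 : 1 < t by rewrite ltrDl invr_gt0.
have t_gt0 : 0 < t by rewrite (lt_trans ltr01).
have := cond_pinsker t_gt0.
have : 0 <= sum_on C (fun z => \sum_o \sum_o' `|P z o o' - Pu z o * Pv z o' / p C z|).
  by do 3!apply: sumr_ge0 => ? _.
move=> /le_trans h /h; apply/negP; rewrite -ltNge.
have -> : t * cond_info u v C = cond_info u v C - 1.
  by rewrite /t mulrDl mul1r invrN mulNr mulVf // -oppr_eq0 gt_eqF.
have : (2 * t)^-1 < 1 by rewrite invf_lt1 ?mulr_gt0 //; lra.
lra.
Qed.

End Pair.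

Lemma cond_info_ge0 C u v : u != v -> 0 <= cond_info u v C.
Proof.
move=> uv; have [uC|uC] := boolP (u \in C).
  have uCC : u |: C = C by apply/setUidPr; rewrite sub1set.
  by rewrite /cond_info setUCA uCC; lra.
have [vC|vC] := boolP (v \in C).
  have vCC : v |: C = C by apply/setUidPr; rewrite sub1set.
  by rewrite /cond_info vCC; lra.
exact: cond_info_ge0_out.
Qed.

Lemma mixed_diff_cut_info S C u v : u \in S -> v \notin S ->
  mixed_diff (cut_info S) u v C = cond_info u v C.
Proof.
move=> uS vS; rewrite /mixed_diff /cut_info /cond_info.
have vI D : (v |: D) :&: S = D :&: S.
  by apply/setP => w; rewrite !inE; case: eqVneq => // ->; rewrite (negbTE vS) !andbF.
have uD D : (u |: D) :\: S = D :\: S.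
  by apply/setP => w; rewrite !inE; case: eqVneq => // ->; rewrite uS.
by rewrite !uD (setUCA [set u] [set v] C) !vI; ring.
Qed.

Lemma supermodular_cut_info S : supermodular_across S (cut_info S).
Proof.
move=> u v C uS vS; rewrite mixed_diff_cut_info //; apply: cond_info_ge0.
by apply: contraNN vS => /eqP <-.
Qed.

Lemma ent_set0 : ent set0 = 0.
Proof. by rewrite /ent sum_on_set0 p_set0 ln1 mulr0 oppr0. Qed.

Lemma cut_info_sub S C : C \subset S -> cut_info S C = 0.
Proof.
move=> CS; rewrite /cut_info (setIidPl CS).
have /eqP -> : C :\: S == set0 by rewrite setD_eq0.
by rewrite ent_set0; ring.
Qed.

Lemma cut_info_disj S C : C \subset ~: S -> cut_info S C = 0.
Proof.
move=> CS; rewrite /cut_info setDE (setIidPl CS).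
have /eqP -> : C :&: S == set0 by rewrite setI_eq0 disjoints_subset.
by rewrite ent_set0; ring.
Qed.

(** Drop from [C] all vertices on the side of the cut opposite to [v]: then both values are 0.
    Putting these vertices back one at a time can only increase the gain from [v], by
    supermodularity. *)
Lemma cut_info_mono S v C : cut_info S C <= cut_info S (v |: C).
Proof.
pose F := cut_info S.
have [vS|vS] := boolP (v \in S).
  rewrite -[C](setID _ (~: S)) setUC.
  have Fsub : F (v |: (C :\: ~: S)) - F (C :\: ~: S) = 0.
    rewrite /F !cut_info_sub ?subrr //; first by rewrite setDE setCK subsetIr.
    by rewrite subUset sub1set vS setDE setCK subsetIr.
  rewrite -subr_ge0 -[leLHS]Fsub.
  have -> : C :&: ~: S = [set:: enum (C :&: ~: S)] by rewrite set_enum.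
  have : {subset enum (C :&: ~: S) <= ~: S} by move=> w; rewrite mem_enum inE => /andP[].
  elim: (enum _) => [_|w s IHs sS]; first by rewrite set_nil setU0.
  have /IHs h : {subset s <= ~: S} by move=> x xs; apply: sS; rewrite inE xs orbT.
  apply: le_trans h _; have := sS w; rewrite !inE eqxx => /(_ isT) wS.
  have := supermodular_cut_info (C :\: ~: S :|: [set:: s]) vS wS.
  rewrite /mixed_diff set_cons (setUCA (C :\: ~: S) [set w]) -/F; lra.
rewrite -[C](setID _ S) setUC.
have Fdisj : F (v |: (C :\: S)) - F (C :\: S) = 0.
  rewrite /F !cut_info_disj ?subrr //; first by rewrite setDE subsetIr.
  by rewrite subUset sub1set inE vS setDE subsetIr.
rewrite -subr_ge0 -[leLHS]Fdisj.
have -> : C :&: S = [set:: enum (C :&: S)] by rewrite set_enum.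
have : {subset enum (C :&: S) <= S} by move=> w; rewrite mem_enum inE => /andP[].
elim: (enum _) => [_|w s IHs sS]; first by rewrite set_nil setU0.
have /IHs h : {subset s <= S} by move=> x xs; apply: sS; rewrite inE xs orbT.
apply: le_trans h _; have := sS w; rewrite !inE eqxx => /(_ isT) wS.
have := supermodular_cut_info (C :\: S :|: [set:: s]) wS vS.
rewrite /mixed_diff set_cons (setUCA [set w] [set v]) (setUCA (C :\: S) [set w]) -/F.
lra.
Qed.

Lemma cut_info_monoU S B C : cut_info S C <= cut_info S (B :|: C).
Proof.
rewrite -[B]set_enum; elim: (enum B) => [|v s IHs]; first by rewrite set_nil set0U.
by rewrite set_cons -setUA; apply: le_trans IHs (cut_info_mono _ _ _).
Qed.

Lemma cut_info_ge0 S C : 0 <= cut_info S C.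
Proof. by rewrite -(cut_info_sub (sub0set S)) -[C]setU0 cut_info_monoU. Qed.

Lemma cut_info_le S C : cut_info S C <= cut_info S [set: V].
Proof. by have := cut_info_monoU S [set: V] C; rewrite setTU. Qed.

End ConsistentFamily.

(** * Relative entropy under a measurement *)

Section ResolventComparison.
Context {R : realType}.
Local Open Scope classical_set_scope.
Local Open Scope ring_scope.

Lemma is_derive_sum_seq (I : Type) (s : seq I) (f : I -> R -> R) (d : I -> R) (x : R) :
  (forall i, is_derive x 1 (f i) (d i)) ->
  is_derive x 1 (fun x => \sum_(i <- s) f i x) (\sum_(i <- s) d i).
Proof.
move=> fd; elim: s => [|i s IHs].
  rewrite big_nil; under eq_fun do rewrite big_nil.
  exact: is_derive_cst.
rewrite big_cons; under eq_fun do rewrite big_cons.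
exact: (is_deriveD (fd i) IHs).
Qed.

(* Differentiating [sum w x (ln x - ln (y + t x))] in [t] gives minus the
   resolvent sums; both sides vanish at infinity up to the common term
   [- ln t], so comparing the resolvents compares the relative entropies. *)
Lemma relative_entropy_resolvent (I J : finType) (w x y : I -> R) (p q : J -> R) :
  (forall i, 0 <= w i) -> (forall i, 0 <= x i) -> (forall i, 0 <= y i) ->
  (forall i, w i * x i != 0 -> 0 < y i) ->
  (forall j, 0 <= p j) -> (forall j, 0 <= q j) ->
  (forall j, p j != 0 -> 0 < q j) ->
  \sum_i w i * x i = \sum_j p j ->
  (forall t : R, 0 < t -> \sum_j p j ^+ 2 / (q j + t * p j) <=
                      \sum_i w i * (x i ^+ 2 / (y i + t * x i))) ->
  \sum_j p j * (ln (p j) - ln (q j)) <= \sum_i w i * x i * (ln (x i) - ln (y i)).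
Proof.
move=> w0 x0 y0 wxy p0 q0 pq wxp res.
pose H (t : R) : R := \sum_j p j * (ln (p j) - ln (q j + t * p j))
          - \sum_i w i * x i * (ln (x i) - ln (y i + t * x i)).
have term_d (c a b t : R) : 0 <= t -> 0 <= a -> (c * a != 0 -> 0 < b) ->
    is_derive t 1 (fun t => c * a * (ln a - ln (b + t * a)))
      (- (c * (a ^+ 2 / (b + t * a)))).
  move=> t0 a0 cab; have [ca0|ca_neq0] := eqVneq (c * a) 0.
    have -> : - (c * (a ^+ 2 / (b + t * a))) = 0.
      have -> : c * (a ^+ 2 / (b + t * a)) = c * a * (a / (b + t * a)) by ring.
      by rewrite ca0 mul0r oppr0.
    under eq_fun do rewrite ca0 mul0r; exact: is_derive_cst.
  have bt_gt0 : 0 < b + t * a by rewrite ltr_pwDl ?cab ?mulr_ge0.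
  have lind : is_derive t 1 (fun t : R => b + t * a) a.
    by apply: is_derive_eq; rewrite /GRing.scale /=; ring.
  have lnd : is_derive t 1 (fun t : R => ln (b + t * a)) ((b + t * a)^-1 * a).
    exact: (@is_derive1_comp R (@ln R) (fun t => b + t * a) t _ _ (is_derive1_ln bt_gt0) lind).
  have := is_deriveZ (c * a) (is_deriveB (is_derive_cst (ln a) t 1) lnd).
  move=> h; apply: (is_derive_eq h); rewrite /GRing.scale /=; ring.
have Hd (t : R) : 0 <= t -> is_derive t 1 H
    (\sum_j - (1 * (p j ^+ 2 / (q j + t * p j)))
     - \sum_i - (w i * (x i ^+ 2 / (y i + t * x i)))).
  move=> t0; apply: is_deriveB; apply: is_derive_sum_seq => i.
    have := term_d 1 (p i) (q i) t t0 (p0 i); rewrite mul1r => h; exact: h (pq i).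
  exact: (term_d _ _ _ _ t0 (x0 i) (wxy i)).
have H_nd (T : R) : 0 < T -> H 0 <= H T.
  move=> T0.
  apply: (le_of_derive_ge0 (df := fun t => \sum_j - (1 * (p j ^+ 2 / (q j + t * p j)))
     - \sum_i - (w i * (x i ^+ 2 / (y i + t * x i))))) => [|t /andP[t0 _]|t /andP[t0 _]].
  - exact: ltW.
  - exact: Hd.
  - rewrite !sumrN opprK addrC subr_ge0; under eq_bigr do rewrite mul1r.
    exact: res.
pose M := \sum_i w i * y i.
have H_le (T : R) : 0 < T -> H T <= M / T.
  move=> T0.
  have p_le j : p j * (ln (p j) - ln (q j + T * p j)) <= - (p j * ln T).
    have [->|pj0] := eqVneq (p j) 0; first by rewrite !mul0r oppr0.
    have pj_gt0 : 0 < p j by rewrite lt0r pj0 p0.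
    rewrite -mulrN ler_wpM2l // lerBlDr addrC lerBrDl -lnM ?posrE //.
    by rewrite ler_ln ?posrE ?lerDr // ?mulr_gt0 // ltr_pwDl ?pq // mulr_ge0 // ltW.
  have x_ge i : - (w i * x i * ln T) - w i * y i / T <=
      w i * x i * (ln (x i) - ln (y i + T * x i)).
    have [wx0|wx_neq0] := eqVneq (w i * x i) 0.
      by rewrite wx0 !mul0r oppr0 add0r oppr_le0 divr_ge0 ?mulr_ge0 // ltW.
    have y_gt0 := wxy _ wx_neq0.
    have xi_gt0 : 0 < x i.
      by rewrite lt0r x0 andbT; apply: contraNN wx_neq0 => /eqP->; rewrite mulr0.
    have -> : y i + T * x i = T * x i * (1 + y i / (T * x i)).
      by field; rewrite !gt_eqF.
    have r_gt0 : 0 < y i / (T * x i) by rewrite divr_gt0 ?mulr_gt0.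
    rewrite !lnM ?posrE ?mulr_gt0 ?addr_gt0 //.
    have := le_ln1Dx (lt_trans (ltrN10 R) r_gt0).
    have wxi : 0 <= w i * x i by rewrite mulr_ge0.
    move=> /(ler_wpM2l wxi).
    have -> : w i * x i * (y i / (T * x i)) = w i * y i / T by field; rewrite !gt_eqF.
    lra.
  rewrite /H.
  apply: le_trans (lerB (ler_sum _ (fun j _ => p_le j)) (ler_sum _ (fun i _ => x_ge i))) _.
  rewrite big_split /= !sumrN -!mulr_suml wxp -/M; lra.
have H0_le0 : H 0 <= 0.
  rewrite leNgt; apply/negP => H0_gt0.
  have M_ge0 : 0 <= M by apply: sumr_ge0 => i _; rewrite mulr_ge0.
  pose T := (M + 1) / H 0.
  have T_gt0 : 0 < T by rewrite divr_gt0 // ltr_wpDl.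
  have := le_trans (H_nd _ T_gt0) (H_le _ T_gt0).
  rewrite leNgt => /negP; apply; rewrite ltr_pdivrMr // /T mulrCA divff ?gt_eqF //.
  by rewrite mulr1 ltrDl.
move: H0_le0; rewrite /H subr_le0.
under eq_bigr do rewrite mul0r addr0.
by under [leRHS]eq_bigr do rewrite mul0r addr0.
Qed.

End ResolventComparison.

(** * Frames, and relative entropy under a rank-one measurement *)

Section ComplexSums.
Context {R : realType}.

Definition sqn (z : R[i]) : R := complex.Re z ^+ 2 + complex.Im z ^+ 2.

Lemma sqnE (z : R[i]) : real_complex R (sqn z) = z * conjc z.
Proof.
case: z => a b; apply/eqP; rewrite /sqn eq_complex /=.
by apply/andP; split; apply/eqP; ring.
Qed.

Lemma sqn_ge0 (z : R[i]) : 0 <= sqn z. Proof. by rewrite addr_ge0 ?sqr_ge0. Qed.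

Lemma sqn0 : sqn 0 = 0. Proof. by rewrite /sqn /= expr0n addr0. Qed.

Lemma sqn_eq0 (z : R[i]) : (sqn z == 0) = (z == 0).
Proof.
by rewrite /sqn paddr_eq0 ?sqr_ge0 // !sqrf_eq0 eq_complex.
Qed.

Lemma sqnM (a b : R[i]) : sqn (a * b) = sqn a * sqn b.
Proof. by case: a b => [x y] [x' y']; rewrite /sqn /=; ring. Qed.

Lemma sqn_conj (z : R[i]) : sqn (conjc z) = sqn z.
Proof. by case: z => x y; rewrite /sqn /= sqrrN. Qed.

Lemma sqn_real (x : R) : sqn (real_complex R x) = x ^+ 2.
Proof. by rewrite /sqn /= expr0n addr0. Qed.

Lemma sqnB (a b : R[i]) : sqn (a - b) = sqn a + sqn b - 2 * complex.Re (a * conjc b).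
Proof. by case: a b => [x y] [x' y']; rewrite /sqn /=; ring. Qed.

Lemma Re_sum (I : Type) (s : seq I) (P : pred I) (F : I -> R[i]) :
  complex.Re (\sum_(i <- s | P i) F i) = \sum_(i <- s | P i) complex.Re (F i).
Proof. by apply: (big_morph (@complex.Re R)) => [[x y] [x' y']|]. Qed.

Lemma RecM (x : R) (z : R[i]) : complex.Re (real_complex R x * z) = x * complex.Re z.
Proof. by case: z => a b /=; rewrite mul0r subr0. Qed.

Lemma conjcM (a b : R[i]) : conjc (a * b) = conjc a * conjc b.
Proof. exact: rmorphM. Qed.

Lemma conjc_sum (I : Type) (s : seq I) (P : pred I) (F : I -> R[i]) :
  conjc (\sum_(i <- s | P i) F i) = \sum_(i <- s | P i) conjc (F i).
Proof. exact: rmorph_sum. Qed.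

Lemma conjc_prod (I : Type) (s : seq I) (P : pred I) (F : I -> R[i]) :
  conjc (\prod_(i <- s | P i) F i) = \prod_(i <- s | P i) conjc (F i).
Proof. exact: rmorph_prod. Qed.

Lemma conjc_bool (c : bool) : conjc (c%:R : R[i]) = c%:R.
Proof. exact: conjc_nat. Qed.

(** Resolution of the identity [sum_z |e_z><e_z| = 1]. It covers orthonormal bases and rank-one
    POVMs alike. *)
Definition frame (X Z : finType) (e : Z -> X -> R[i]) :=
  forall x y, \sum_z e z x * conjc (e z y) = (x == y)%:R.

Definition coef (X : finType) (e f : X -> R[i]) : R[i] :=
  \sum_x conjc (e x) * f x.

Lemma sum_delta (X : finType) (x : X) (F : X -> R[i]) :
  \sum_y (x == y)%:R * F y = F x.
Proof.
rewrite (bigD1 x) //= eqxx mul1r big1 ?addr0 // => y.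
by rewrite eq_sym => /negbTE ->; rewrite mul0r.
Qed.

Lemma frame_inner (X Z : finType) (e : Z -> X -> R[i]) (f g : X -> R[i]) :
  frame e -> \sum_z conjc (coef (e z) f) * coef (e z) g = coef f g.
Proof.
move=> eP; rewrite /coef.
transitivity (\sum_z \sum_x \sum_y e z x * conjc (e z y) * (conjc (f x) * g y)).
  apply: eq_bigr => z _; rewrite conjc_sum mulr_suml; apply: eq_bigr => x _.
  rewrite mulr_sumr; apply: eq_bigr => y _; rewrite conjcM conjcK; ring.
rewrite exchange_big; apply: eq_bigr => x _; rewrite exchange_big /=.
under eq_bigr do rewrite -mulr_suml eP.
by rewrite sum_delta.
Qed.

Lemma coefxx (X : finType) (f : X -> R[i]) : coef f f = real_complex R (\sum_x sqn (f x)).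
Proof. by rewrite rmorph_sum; apply: eq_bigr => x _; rewrite /= sqnE mulrC. Qed.

Lemma parseval (X Z : finType) (e : Z -> X -> R[i]) (f : X -> R[i]) :
  frame e -> \sum_z sqn (coef (e z) f) = \sum_x sqn (f x).
Proof.
move=> eP; apply: (@complexI R); rewrite -(coefxx f) -(frame_inner f f eP) rmorph_sum.
by apply: eq_bigr => z _; rewrite /= sqnE mulrC.
Qed.

(** The synthesis map is the adjoint of the isometry in [parseval], hence a contraction; here this
    comes from expanding the squared distance between [b] and the coefficients of [psi]. *)
Lemma bessel (X Z : finType) (e : Z -> X -> R[i]) (b : Z -> R[i]) : frame e ->
  \sum_x sqn (\sum_z b z * e z x) <= \sum_z sqn (b z).
Proof.
move=> eP; pose psi x := \sum_z b z * e z x.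
have e1 : \sum_z sqn (coef (e z) psi) = \sum_x sqn (psi x) by exact: parseval.
have e2 : complex.Re (\sum_z b z * conjc (coef (e z) psi)) = \sum_x sqn (psi x).
  transitivity (complex.Re (coef psi psi)); last by rewrite coefxx.
  congr complex.Re; rewrite /coef.
  transitivity (\sum_z \sum_x b z * e z x * conjc (psi x)).
    apply: eq_bigr => z _; rewrite conjc_sum mulr_sumr; apply: eq_bigr => x _.
    by rewrite conjcM conjcK mulrA.
  by rewrite exchange_big; apply: eq_bigr => x _; rewrite -mulr_suml mulrC.
have : 0 <= \sum_z sqn (b z - coef (e z) psi) by apply: sumr_ge0 => z _; exact: sqn_ge0.
under eq_bigr do rewrite sqnB.
rewrite sumrB big_split /= e1 -mulr_sumr -Re_sum e2 -/psi; lra.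
Qed.

(* Monotonicity of the relative entropy of [sum_a l_a |u_a><u_a|] with
   respect to [sum_s mu_s |h_s><h_s|] under the measurement [|e_z><e_z|]: at each
   [t > 0] the resolvent sum is a supremum over [Y] of a concave quadratic form, evaluated
   at [Y = sum_z c_z |e_z><e_z|] with [c = p / (q + t p)]. *)
Lemma measured_relative_entropy (X A S Z : finType) (u : A -> X -> R[i])
    (h : S -> X -> R[i]) (e : Z -> X -> R[i]) (l : A -> R) (mu : S -> R) :
  frame u -> frame h -> frame e ->
  (forall a, \sum_x sqn (u a x) = 1) ->
  (forall a, 0 <= l a) -> (forall s, 0 <= mu s) ->
  (forall a s, sqn (coef (h s) (u a)) * l a != 0 -> 0 < mu s) ->
  forall p q : Z -> R,
  (forall z, p z = \sum_a l a * sqn (coef (e z) (u a))) ->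
  (forall z, q z = \sum_s mu s * sqn (coef (e z) (h s))) ->
  \sum_z p z * (ln (p z) - ln (q z)) <=
  \sum_a \sum_s sqn (coef (h s) (u a)) * l a * (ln (l a) - ln (mu s)).
Proof.
move=> uP hP eP u1 l0 mu0 supp p q pE qE.
have p0 z : 0 <= p z by rewrite pE; apply: sumr_ge0 => a _; rewrite mulr_ge0 ?sqn_ge0.
have q0 z : 0 <= q z by rewrite qE; apply: sumr_ge0 => s _; rewrite mulr_ge0 ?sqn_ge0.
have betaE z a : coef (e z) (u a) = \sum_s coef (e z) (h s) * coef (h s) (u a).
  rewrite -(frame_inner _ _ hP); apply: eq_bigr => s _; congr (_ * _).
  rewrite /coef conjc_sum; apply: eq_bigr => x _.
  by rewrite conjcM conjcK mulrC.
rewrite pair_big_dep /=.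
apply: (relative_entropy_resolvent (w := fun i => sqn (coef (h i.2) (u i.1)))
  (x := fun i => l i.1) (y := fun i => mu i.2)) => //.
- by move=> i; exact: sqn_ge0.
- by move=> [a s]; exact: supp.
- move=> z pz; rewrite lt0r q0 andbT; apply: contraNN pz => /eqP qz.
  rewrite pE; apply/eqP; apply: big1 => a _.
  have [->|la] := eqVneq (l a) 0; first by rewrite mul0r.
  have -> : coef (e z) (u a) = 0; last by rewrite sqn0 mulr0.
  rewrite betaE big1 // => s _.
  have [->|hu] := eqVneq (coef (h s) (u a)) 0; first by rewrite mulr0.
  have mus : 0 < mu s by apply: (supp a); rewrite mulf_neq0 // sqn_eq0.
  move/eqP: qz; rewrite qE psumr_eq0 => [/allP /(_ s)|s' _]; last by rewrite mulr_ge0 ?sqn_ge0.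
  rewrite mem_index_enum => /(_ isT); rewrite /= mulf_eq0 gt_eqF //= sqn_eq0 => /eqP ->.
  by rewrite mul0r.
- rewrite -(pair_big_dep xpredT (fun _ => xpredT)
    (fun a s => sqn (coef (h s) (u a)) * l a)) /=.
  under eq_bigr => a _ do rewrite -mulr_suml parseval // u1 mul1r.
  under [RHS]eq_bigr do rewrite pE.
  rewrite exchange_big /=; apply: eq_bigr => a _.
  by rewrite -mulr_sumr parseval // u1 mulr1.
move=> t t0; rewrite -(pair_big_dep xpredT (fun _ => xpredT)
    (fun a s => sqn (coef (h s) (u a)) * (l a ^+ 2 / (mu s + t * l a)))) /=.
pose c z := p z / (q z + t * p z).
pose y s a := \sum_z real_complex R (c z) * conjc (coef (e z) (h s)) * coef (e z) (u a).
have term a s : 2 * l a * complex.Re (conjc (coef (h s) (u a)) * y s a)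
    - (mu s + t * l a) * sqn (y s a) <=
    sqn (coef (h s) (u a)) * (l a ^+ 2 / (mu s + t * l a)).
  have [D0|D_neq0] := eqVneq (mu s + t * l a) 0.
    have la0 : l a = 0.
      have tl : 0 <= t * l a by rewrite mulr_ge0 // ltW.
      have : t * l a = 0 by have := mu0 s; lra.
      by move/eqP; rewrite mulf_eq0 (gt_eqF t0) => /eqP.
    by rewrite D0 la0 expr0n /= !(mul0r, mulr0) subr0.
  have D_gt0 : 0 < mu s + t * l a by rewrite lt0r D_neq0 addr_ge0 // mulr_ge0 // ltW.
  set D := mu s + t * l a in D_gt0 D_neq0 *.
  rewrite mulrA ler_pdivlMr //.
  have := sqn_ge0 (real_complex R (l a) * coef (h s) (u a) - real_complex R D * y s a).
  rewrite sqnB !sqnM !sqn_real.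
  have -> : complex.Re (real_complex R (l a) * coef (h s) (u a) *
      conjc (real_complex R D * y s a)) =
      l a * D * complex.Re (conjc (coef (h s) (u a)) * y s a).
    rewrite conjcM conjc_real.
    transitivity (complex.Re (real_complex R (l a) * (real_complex R D *
       (coef (h s) (u a) * conjc (y s a))))); first by congr complex.Re; ring.
    rewrite !RecM -mulrA; congr (_ * (_ * _)).
    by case: (coef _ _) (y s a) => [? ?] [? ?] /=; ring.
  by rewrite expr2; nra.
apply: (@le_trans _ _ (\sum_a \sum_s (2 * l a * complex.Re (conjc (coef (h s) (u a)) * y s a)
    - (mu s + t * l a) * sqn (y s a)))); last first.
  by apply: ler_sum => a _; apply: ler_sum => s _; exact: term.
have lin a : \sum_s complex.Re (conjc (coef (h s) (u a)) * y s a) =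
    \sum_z c z * sqn (coef (e z) (u a)).
  rewrite -Re_sum.
  transitivity (complex.Re (\sum_z real_complex R (c z) *
    real_complex R (sqn (coef (e z) (u a))))).
    congr complex.Re; rewrite /y.
    under eq_bigr do rewrite mulr_sumr.
    rewrite exchange_big /=; apply: eq_bigr => z _.
    rewrite sqnE [X in _ = _ * (_ * conjc X)]betaE conjc_sum !mulr_sumr; apply: eq_bigr => s _.
    rewrite conjcM; ring.
  by rewrite Re_sum; apply: eq_bigr => z _; rewrite RecM.
(* [y s a] is the matrix element of [Y] between [h s] and [u a]. Summing over the frame [u] gives
   the squared norm of [Y h_s], and [bessel] bounds [Y^2] by [sum_z c_z^2 |e_z><e_z|]. *)
have quad_s s : \sum_a sqn (y s a) <= \sum_z c z ^+ 2 * sqn (coef (e z) (h s)).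
  pose b z := real_complex R (c z) * coef (e z) (h s).
  have -> : \sum_a sqn (y s a) = \sum_a sqn (coef (u a) (fun x => \sum_z b z * e z x)).
    apply: eq_bigr => a _; rewrite -sqn_conj; congr sqn.
    rewrite /y /coef conjc_sum.
    under [RHS]eq_bigr do rewrite mulr_sumr.
    rewrite exchange_big /=; apply: eq_bigr => z _.
    rewrite !conjcM conjcK conjc_real -/(coef (e z) (h s)) conjc_sum mulr_sumr.
    by apply: eq_bigr => x _; rewrite /b conjcM conjcK; ring.
  rewrite parseval //; apply: le_trans (bessel b eP) _.
  by apply: ler_sum => z _; rewrite /b sqnM sqn_real.
have quad_a a : \sum_s sqn (y s a) <= \sum_z c z ^+ 2 * sqn (coef (e z) (u a)).
  pose b z := real_complex R (c z) * coef (e z) (u a).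
  have -> : \sum_s sqn (y s a) = \sum_s sqn (coef (h s) (fun x => \sum_z b z * e z x)).
    apply: eq_bigr => s _; congr sqn; rewrite /y /coef.
    under [RHS]eq_bigr do rewrite mulr_sumr.
    rewrite exchange_big /=; apply: eq_bigr => z _.
    rewrite -/(coef (e z) (u a)) conjc_sum mulrAC mulr_sumr.
    by apply: eq_bigr => x _; rewrite /b conjcM conjcK; ring.
  rewrite parseval //; apply: le_trans (bessel b eP) _.
  by apply: ler_sum => z _; rewrite /b sqnM sqn_real.
have -> : \sum_a \sum_s (2 * l a * complex.Re (conjc (coef (h s) (u a)) * y s a)
    - (mu s + t * l a) * sqn (y s a)) =
    2 * (\sum_a l a * \sum_z c z * sqn (coef (e z) (u a)))
    - \sum_s mu s * \sum_a sqn (y s a) - t * \sum_a l a * \sum_s sqn (y s a).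
  rewrite [X in _ - X - _](_ : _ = \sum_a \sum_s mu s * sqn (y s a)); last first.
    by rewrite exchange_big /=; apply: eq_bigr => s _; rewrite mulr_sumr.
  rewrite !mulr_sumr -!sumrB; apply: eq_bigr => a _.
  rewrite -lin !mulr_sumr -!sumrB; apply: eq_bigr => s _; ring.
have quads : \sum_s mu s * \sum_a sqn (y s a) <= \sum_z c z ^+ 2 * q z.
  apply: (@le_trans _ _ (\sum_s mu s * \sum_z c z ^+ 2 * sqn (coef (e z) (h s)))).
    by apply: ler_sum => s _; exact: ler_wpM2l.
  rewrite le_eqVlt; apply/orP; left; apply/eqP.
  under eq_bigr do rewrite mulr_sumr.
  rewrite exchange_big /=; apply: eq_bigr => z _; rewrite ?pE ?qE mulr_sumr.
  by apply: eq_bigr => s _; rewrite mulrCA.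
have quada : \sum_a l a * \sum_s sqn (y s a) <= \sum_z c z ^+ 2 * p z.
  apply: (@le_trans _ _ (\sum_a l a * \sum_z c z ^+ 2 * sqn (coef (e z) (u a)))).
    by apply: ler_sum => a _; exact: ler_wpM2l.
  rewrite le_eqVlt; apply/orP; left; apply/eqP.
  under eq_bigr do rewrite mulr_sumr.
  rewrite exchange_big /=; apply: eq_bigr => z _; rewrite ?pE ?qE mulr_sumr.
  by apply: eq_bigr => s _; rewrite mulrCA.
have linE : \sum_a l a * \sum_z c z * sqn (coef (e z) (u a)) = \sum_z c z * p z.
  under eq_bigr do rewrite mulr_sumr.
  rewrite exchange_big /=; apply: eq_bigr => z _; rewrite ?pE ?qE mulr_sumr.
  by apply: eq_bigr => s _; rewrite mulrCA.
rewrite linE.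
(* For this [c] the upper estimates add up, term by term, to exactly the resolvent sum. *)
have -> : \sum_z p z ^+ 2 / (q z + t * p z) =
   2 * (\sum_z c z * p z) - \sum_z c z ^+ 2 * q z - t * \sum_z c z ^+ 2 * p z.
  rewrite !mulr_sumr -!sumrB; apply: eq_bigr => z _; rewrite /c.
  have [D0|D_neq0] := eqVneq (q z + t * p z) 0; first by rewrite D0 invr0; ring.
  by field.
have := ler_wpM2l (ltW t0) quada; lra.
Qed.

End ComplexSums.

(** * Spectra and the trace norm *)

Section Spectrum.
Context {R : realType}.
Local Notation C := (complex R).

Lemma conjCE (z : complex R) : Num.conj z = conjc z.
Proof. by []. Qed.

Lemma char_poly_conj n (P A : 'M[C]_n) : P \in unitmx ->
  char_poly (invmx P *m A *m P) = char_poly A.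
Proof.
move=> Pu; rewrite /char_poly.
have PP : map_mx polyC (invmx P) *m map_mx polyC P = 1%:M.
  by rewrite -map_mxM /= mulVmx // map_mx1.
have -> : char_poly_mx (invmx P *m A *m P) =
    map_mx polyC (invmx P) *m char_poly_mx A *m map_mx polyC P.
  rewrite /char_poly_mx mulmxBr mulmxBl !map_mxM /=; congr (_ - _).
  by rewrite scalar_mxC -mulmxA PP mulmx1.
rewrite !det_mulmx mulrAC -det_mulmx PP det1 mul1r //.
Qed.

Lemma spec_diag n (A : 'M[C]_n) (P : 'M[C]_n) (D : 'rV[C]_n) : P \in unitmx ->
  A = invmx P *m diag_mx D *m P -> perm_eq (spec A) (map (fun i => D 0 i) (enum 'I_n)).
Proof.
move=> Pu AE; apply: prod_XsubC_eq.
rewrite /spec; case: closed_field_poly_normal => s /= sE.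
rewrite big_map big_enum /=.
have := sE; rewrite (monicP (char_poly_monic A)) scale1r => <-.
rewrite AE char_poly_conj // char_poly_trig; last exact: diag_mx_is_trig.
by apply: eq_bigr => i _; rewrite mxE eqxx mulr1n.
Qed.

(** Eigenvectors are indexed by [T] itself, so later spectral arguments are finite sums over [T]
    with no matrix index left. *)
Lemma hermitian_eigenbasis (T : finType) (A : op R T) : adjmx A = A ->
  exists (u : T -> T -> C) (l : T -> R),
  [/\ frame u, forall a b, coef (u a) (u b) = (a == b)%:R,
      forall x y, opE A x y = \sum_a real_complex R (l a) * u a x * conjc (u a y),
      forall F : R -> R, \sum_(z <- spec A) F (complex.Re z) = \sum_a F (l a) &
      trnorm A = \sum_a `|l a|].
Proof.
move=> Aherm.
have Ah : A \is hermsymmx.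
  apply/is_hermitianmxP; rewrite expr0 scale1r -[LHS]Aherm.
  by apply/matrixP => i j; rewrite !mxE.
have := hermitian_normalmx Ah => /orthomx_spectralP.
have Pu := spectral_unitarymx A; have Pun := spectral_unit A.
have Dreal := hermitian_spectral_diag_real Ah.
set P := spectralmx A in Pu Pun *; set D := spectral_diag A in Dreal * => AE.
have PV := invmx_unitary Pu.
have Dk k : real_complex R (complex.Re (D 0 k)) = D 0 k.
  by rewrite RRe_real //; have /mxOverP := Dreal; apply.
(* [A] is [P^* D P] with [P] unitary, so its eigenvectors are the conjugated rows of [P]. *)
exists (fun a x => conjc (P (enum_rank a) (enum_rank x))),
       (fun a => complex.Re (D 0 (enum_rank a))).
split=> [x y|a b|x y|F|].
- have := mulVmx Pun; rewrite PV => /matrixP/(_ (enum_rank x) (enum_rank y)).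
  rewrite !mxE (inj_eq enum_rank_inj) => <-.
  rewrite (reindex _ (onW_bij _ (enum_rank_bij T))) /=.
  by apply: eq_bigr => k _; rewrite conjcK !mxE.
- have := mulmxV Pun; rewrite PV => /matrixP/(_ (enum_rank a) (enum_rank b)).
  rewrite !mxE (inj_eq enum_rank_inj) => <-; rewrite /coef.
  rewrite (reindex _ (onW_bij _ (enum_rank_bij T))) /=.
  by apply: eq_bigr => k _; rewrite conjcK !mxE.
- rewrite /opE {1}AE PV -mulmxA !mxE.
  rewrite (reindex _ (onW_bij _ (enum_rank_bij T))) /=.
  apply: eq_bigr => k _; rewrite conjcK Dk !mxE.
  rewrite (bigD1 (enum_rank k)) //= !mxE eqxx mulr1n big1 ?addr0 => [|j jk].
    by rewrite -conjCE; ring.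
  by rewrite mxE eq_sym (negbTE jk) mulr0n mul0r.
- rewrite (perm_big _ (spec_diag Pun AE)) /= big_map big_enum /=.
  exact: (reindex _ (onW_bij _ (enum_rank_bij T))).
- have AA : adjmx A *m A = invmx P *m diag_mx (\row_k (D 0 k ^+ 2)) *m P.
    rewrite Aherm {1 2}AE !mulmxA mulmxK //.
    rewrite -!mulmxA; congr (_ *m _); rewrite mulmxA; congr (_ *m _).
    by rewrite mulmx_diag; congr diag_mx; apply/rowP => k; rewrite !mxE.
  rewrite /trnorm (perm_big _ (spec_diag Pun AA)) /= big_map big_enum /=.
  rewrite (reindex _ (onW_bij _ (enum_rank_bij T))) /=; apply: eq_bigr => k _.
  rewrite mxE -[in LHS]Dk -sqrtr_sqr; congr Num.sqrt.
  by rewrite /= mulr0 subr0.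
Qed.

Definition quad (T : finType) (k : T -> T -> C) (f : T -> C) : C :=
  \sum_x \sum_y conjc (f x) * k x y * f y.

Lemma quad_mulmx (T : finType) (A : op R T) (v : 'cV[C]_#|T|) :
  (adjmx v *m A *m v) 0 0 = quad (opE A) (fun x => v (enum_rank x) 0).
Proof.
rewrite !mxE (reindex _ (onW_bij _ (enum_rank_bij T))) /= /quad exchange_big /=.
apply: eq_bigr => y _; rewrite mxE mulr_suml.
rewrite (reindex _ (onW_bij _ (enum_rank_bij T))) /=; apply: eq_bigr => x _.
by rewrite !mxE.
Qed.

Lemma psd_quad (T : finType) (A : op R T) (f : T -> C) : psd A ->
  0 <= quad (opE A) f.
Proof.
move=> [_ /(_ (\col_i f (enum_val i)))]; rewrite quad_mulmx.
rewrite (_ : (fun _ => _) = f) //; apply/funext => x.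
by rewrite mxE enum_rankK.
Qed.

Lemma quad_eigen (T : finType) (k : T -> T -> C) (u : T -> T -> C) (l : T -> R) a :
  (forall x y, k x y = \sum_a real_complex R (l a) * u a x * conjc (u a y)) ->
  (forall a b, coef (u a) (u b) = (a == b)%:R) ->
  quad k (u a) = real_complex R (l a).
Proof.
move=> kE ortho; rewrite /quad.
transitivity (\sum_b real_complex R (l b) * (coef (u a) (u b) * coef (u b) (u a))).
  transitivity (\sum_b \sum_x \sum_y
      conjc (u a x) * (real_complex R (l b) * u b x * conjc (u b y)) * u a y).
    rewrite [RHS]exchange_big; apply: eq_bigr => x _; rewrite [RHS]exchange_big.
    by apply: eq_bigr => y _; rewrite kE mulr_sumr mulr_suml.
  apply: eq_bigr => b _; rewrite /coef mulr_suml mulr_sumr; apply: eq_bigr => x _.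
  by rewrite !mulr_sumr; apply: eq_bigr => y _; ring.
rewrite (bigD1 a) //= ortho eqxx !mulr1 big1 ?addr0 // => b ba.
by rewrite ortho eq_sym (negbTE ba) mul0r mulr0.
Qed.

Lemma mxtrace_opE (T : finType) (A : op R T) : \tr A = \sum_x opE A x x.
Proof. by rewrite /mxtrace (reindex _ (onW_bij _ (enum_rank_bij T))). Qed.

Lemma opP (T : finType) (A B : op R T) : (forall x y, opE A x y = opE B x y) -> A = B.
Proof.
move=> AB; apply/matrixP => i j.
by have := AB (enum_val i) (enum_val j); rewrite /opE !enum_valK.
Qed.

Lemma adjmx_opE (T : finType) (A : op R T) :
  (forall x y, opE A x y = conjc (opE A y x)) -> adjmx A = A.
Proof. by move=> AE; apply: opP => x y; rewrite AE /opE !mxE. Qed.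

Lemma adjmxB n (A B : 'M[C]_n) : adjmx A = A -> adjmx B = B -> adjmx (A - B) = A - B.
Proof. by move=> {2}<- {2}<-; apply/matrixP => i j; rewrite !mxE rmorphB. Qed.

(** Positive semidefiniteness as a factorisation. In this form it passes to sums, entrywise
    products, pullbacks and local operations by writing down new vectors, with no eigenvalue
    argument. *)
Definition gram (T : finType) (k : T -> T -> C) :=
  exists (I : finType) (g : I -> T -> C),
    forall x y, k x y = \sum_i g i x * conjc (g i y).

Lemma gram_psd (T : finType) (A : op R T) : gram (opE A) -> psd A.
Proof.
move=> [I [g AE]]; split.
  apply: adjmx_opE => x y; rewrite !AE conjc_sum; apply: eq_bigr => i _.
  by rewrite conjcM conjcK mulrC.
move=> v; pose f x := v (enum_rank x) 0.
rewrite quad_mulmx -/f.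
have -> : quad (opE A) f = \sum_i conjc (coef (g i) f) * coef (g i) f.
  rewrite /quad.
  transitivity (\sum_i \sum_x \sum_y conjc (f x) * (g i x * conjc (g i y)) * f y).
    rewrite [RHS]exchange_big; apply: eq_bigr => x _; rewrite [RHS]exchange_big.
    by apply: eq_bigr => y _; rewrite AE mulr_sumr mulr_suml.
  apply: eq_bigr => i _; rewrite /coef conjc_sum mulr_suml; apply: eq_bigr => x _.
  rewrite mulr_sumr; apply: eq_bigr => y _; rewrite conjcM conjcK; ring.
by apply: sumr_ge0 => i _; rewrite mulrC mulcJ_ge0.
Qed.

Lemma psd_eigenbasis (T : finType) (A : op R T) : psd A ->
  exists (u : T -> T -> C) (l : T -> R),
  [/\ frame u, forall a b, coef (u a) (u b) = (a == b)%:R,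
      forall x y, opE A x y = \sum_a real_complex R (l a) * u a x * conjc (u a y),
      forall F : R -> R, \sum_(z <- spec A) F (complex.Re z) = \sum_a F (l a) &
      forall a, 0 <= l a].
Proof.
move=> Apsd; have [Aherm _] := Apsd.
have [u [l [fu ou AE sE _]]] := hermitian_eigenbasis Aherm.
exists u, l; split=> // a; rewrite -(ler0c (l a)) -(quad_eigen a AE ou).
exact: psd_quad.
Qed.

Lemma gram_of_psd (T : finType) (A : op R T) : psd A -> gram (opE A).
Proof.
move=> /psd_eigenbasis [u [l [_ _ AE _ l0]]].
exists T, (fun a x => real_complex R (Num.sqrt (l a)) * u a x) => x y.
rewrite AE; apply: eq_bigr => a _; rewrite conjcM conjc_real.
rewrite -[in LHS](sqr_sqrtr (l0 a)) expr2 rmorphM /=; ring.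
Qed.

Lemma sum_norm_le (I : finType) (x : I -> R) :
  \sum_i `|x i| <= Num.sqrt #|I|%:R * Num.sqrt (\sum_i x i ^+ 2).
Proof.
have s0 : 0 <= \sum_i x i ^+ 2 by apply: sumr_ge0 => i _; exact: sqr_ge0.
rewrite -sqrtrM //.
have n0 : 0 <= \sum_i `|x i| by apply: sumr_ge0.
rewrite -[leLHS]ger0_norm // -sqrtr_sqr ler_sqrt ?mulr_ge0 //.
have : 0 <= \sum_i \sum_j (`|x i| - `|x j|) ^+ 2.
  by do 2!apply: sumr_ge0 => ? _; exact: sqr_ge0.
have -> : \sum_i \sum_j (`|x i| - `|x j|) ^+ 2 =
    2 * (#|I|%:R * (\sum_i x i ^+ 2)) - 2 * (\sum_i `|x i|) ^+ 2.
  transitivity (\sum_i \sum_j (x i ^+ 2 + x j ^+ 2 - 2 * `|x i| * `|x j|)).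
    apply: eq_bigr => i _; apply: eq_bigr => j _.
    by rewrite -[x i ^+ 2]real_normK ?num_real // -[x j ^+ 2]real_normK ?num_real //; ring.
  under eq_bigr => i _ do rewrite sumrB big_split /= sumr_const -mulr_sumr
    -[x i ^+ 2 *+ _]mulr_natl.
  rewrite sumrB big_split /= -mulr_sumr sumr_const -mulr_suml -mulr_sumr.
  by rewrite -[_ *+ #|I|]mulr_natl expr2; ring.
lra.
Qed.

(** Cauchy-Schwarz on the eigenvalues. For two qudits [#|T|] is [d^2], which is the origin of the
    factor [d] in the pair bound. *)
Lemma trnorm_le_frobenius (T : finType) (A : op R T) : adjmx A = A ->
  trnorm A <= Num.sqrt #|T|%:R * Num.sqrt (\sum_x \sum_y sqn (opE A x y)).
Proof.
move=> /hermitian_eigenbasis [u [l [_ ou AE _ ->]]].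
apply: le_trans (sum_norm_le _) _; apply: ler_wpM2l; first exact: sqrtr_ge0.
rewrite le_eqVlt; apply/orP; left; apply/eqP; congr Num.sqrt; apply/esym.
have fe : frame (fun y a => conjc (u a y)).
  by move=> a b; rewrite -(ou a b); apply: eq_bigr => y _; rewrite conjcK.
transitivity (\sum_x \sum_a sqn (real_complex R (l a) * u a x)).
  apply: eq_bigr => x _.
  transitivity (\sum_a sqn (conjc (real_complex R (l a) * u a x))); last first.
    by apply: eq_bigr => a _; rewrite sqn_conj.
  rewrite -[RHS](parseval _ fe); apply: eq_bigr => y _; rewrite -sqn_conj AE.
  rewrite conjc_sum; congr sqn; apply: eq_bigr => a _.
  by rewrite [LHS]conjcM mulrC.
rewrite exchange_big /=; apply: eq_bigr => a _.
under eq_bigr do rewrite sqnM sqn_real.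
rewrite -mulr_sumr; have := ou a a; rewrite eqxx coefxx.
by move=> /(@complexI R) ->; rewrite mulr1.
Qed.

Lemma sum_quad_trace (T : finType) (A : op R T) (u : T -> T -> C) : frame u ->
  \sum_a quad (opE A) (u a) = \tr A.
Proof.
move=> fu; rewrite mxtrace_opE /quad exchange_big /=; apply: eq_bigr => x _.
rewrite exchange_big /=.
transitivity (\sum_y (x == y)%:R * opE A x y); last exact: sum_delta.
apply: eq_bigr => y _; rewrite eq_sym -(fu y x) mulr_suml.
by apply: eq_bigr => a _; ring.
Qed.

(** In the eigenbasis of [A - B] the eigenvalues are differences of the diagonals of [A] and [B],
    which are two probability vectors. *)
Lemma trnorm_density_sub (T : finType) (A B : op R T) : density A -> density B ->
  trnorm (A - B) <= 2.
Proof.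
move=> [Apsd trA] [Bpsd trB].
have [Ah _] := Apsd; have [Bh _] := Bpsd.
have [u [l [fu ou ABE _ ->]]] := hermitian_eigenbasis (adjmxB Ah Bh).
pose al a := complex.Re (quad (opE A) (u a)).
pose be a := complex.Re (quad (opE B) (u a)).
have al0 a : 0 <= al a.
  by have := psd_quad (u a) Apsd; rewrite lecE => /andP[].
have be0 a : 0 <= be a.
  by have := psd_quad (u a) Bpsd; rewrite lecE => /andP[].
have lE a : l a = al a - be a.
  apply: (@complexI R); rewrite -(quad_eigen a ABE ou).
  have -> : quad (opE (A - B)) (u a) = quad (opE A) (u a) - quad (opE B) (u a).
    rewrite /quad -sumrB; apply: eq_bigr => x _; rewrite -sumrB.
    by apply: eq_bigr => y _; rewrite /opE !mxE; ring.
  rewrite rmorphB /=; congr (_ - _); apply/esym/RRe_real/ger0_real; exact: psd_quad.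
have suma : \sum_a al a = 1 by rewrite -Re_sum sum_quad_trace // trA.
have sumb : \sum_a be a = 1 by rewrite -Re_sum sum_quad_trace // trB.
have -> : 2 = \sum_a (al a + be a) by rewrite big_split /= suma sumb.
apply: ler_sum => a _; rewrite lE; apply: le_trans (ler_normB _ _) _.
by rewrite !ger0_norm.
Qed.

End Spectrum.

(** * An informationally complete measurement of bounded distortion *)

Section Norms.
Context {R : realType}.

Lemma cauchy_schwarz (I : finType) (x y : I -> R) :
  \sum_i x i * y i <= Num.sqrt (\sum_i x i ^+ 2) * Num.sqrt (\sum_i y i ^+ 2).
Proof.
have sq0 (z : I -> R) : 0 <= \sum_i z i ^+ 2.
  by apply: sumr_ge0 => i _; exact: sqr_ge0.
rewrite -sqrtrM //; apply: le_trans (ler_norm _) _; rewrite -sqrtr_sqr.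
rewrite ler_sqrt ?mulr_ge0 //.
have : 0 <= \sum_i \sum_j (x i * y j - x j * y i) ^+ 2.
  by do 2!apply: sumr_ge0 => ? _; exact: sqr_ge0.
have -> : \sum_i \sum_j (x i * y j - x j * y i) ^+ 2 =
    2 * ((\sum_i x i ^+ 2) * (\sum_i y i ^+ 2)) - 2 * (\sum_i x i * y i) ^+ 2.
  transitivity (\sum_i \sum_j (x i ^+ 2 * y j ^+ 2 + y i ^+ 2 * x j ^+ 2
     - 2 * (x i * y i) * (x j * y j))).
    by apply: eq_bigr => i _; apply: eq_bigr => j _; ring.
  under eq_bigr => i _ do rewrite sumrB big_split /= -!mulr_sumr.
  by rewrite sumrB big_split /= -!mulr_suml -mulr_sumr expr2; ring.
lra.
Qed.

Lemma minkowski_sum (I O : finType) (a : O -> I -> R) :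
  Num.sqrt (\sum_i (\sum_o a o i) ^+ 2) <= \sum_o Num.sqrt (\sum_i a o i ^+ 2).
Proof.
pose N := Num.sqrt (\sum_i (\sum_o a o i) ^+ 2).
have N0 : 0 <= N by exact: sqrtr_ge0.
have [N_eq0|N_neq0] := eqVneq N 0.
  by rewrite -/N N_eq0; apply: sumr_ge0 => o _; exact: sqrtr_ge0.
have N_gt0 : 0 < N by rewrite lt0r N_neq0.
rewrite -(ler_pM2r N_gt0) -expr2 sqr_sqrtr; last first.
  by apply: sumr_ge0 => i _; exact: sqr_ge0.
rewrite mulr_suml.
apply: (@le_trans _ _ (\sum_o \sum_i a o i * \sum_o' a o' i)).
  rewrite exchange_big /= le_eqVlt; apply/orP; left; apply/eqP.
  by apply: eq_bigr => i _; rewrite expr2 mulr_suml.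
by apply: ler_sum => o _; exact: cauchy_schwarz.
Qed.

Lemma sqrt_sum_le (I : finType) (a : I -> R) : (forall i, 0 <= a i) ->
  Num.sqrt (\sum_i a i) <= \sum_i Num.sqrt (a i).
Proof.
move=> a0; have s0 : 0 <= \sum_i Num.sqrt (a i).
  by apply: sumr_ge0 => i _; exact: sqrtr_ge0.
rewrite -[leRHS]ger0_norm // -sqrtr_sqr ler_sqrt ?sqr_ge0 // expr2 mulr_suml.
apply: ler_sum => i _; rewrite -[leLHS](sqr_sqrtr (a0 i)) expr2.
rewrite ler_wpM2l ?sqrtr_ge0 // (bigD1 i) //= lerDl.
by apply: sumr_ge0 => j _; exact: sqrtr_ge0.
Qed.

Lemma sqrtD_le (x y : R) : 0 <= x -> 0 <= y ->
  Num.sqrt (x + y) <= Num.sqrt x + Num.sqrt y.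
Proof.
move=> x0 y0.
have s0 : 0 <= Num.sqrt x + Num.sqrt y by rewrite addr_ge0 ?sqrtr_ge0.
rewrite -[leRHS]ger0_norm // -sqrtr_sqr ler_sqrt ?sqr_ge0 //.
rewrite sqrrD !sqr_sqrtr // addrAC lerDl mulrn_wge0 // mulr_ge0 ?sqrtr_ge0 //.
Qed.

End Norms.

(** * Orthogonality of monomials in random eighth roots of unity *)

Section Phases.
Context {R : realType}.
Local Notation C := (complex R).

Lemma exists_eighth_root : exists zeta : C,
  8.-primitive_root zeta /\ zeta * conjc zeta = 1.
Proof.
pose zeta : C := sqrtC (Num.imaginary : C).
have z4 : zeta ^+ 4 = -1 by rewrite (exprM zeta 2 2) sqrtCK sqrCi.
exists zeta; split.
  have z8 : zeta ^+ 8 = 1 by rewrite (exprM zeta 4 2) z4 sqrrN expr1n.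
  have [m mprim m8] := prim_order_exists (isT : (0 < 8)%N) z8.
  have mN4 : ~~ (m %| 4)%N.
    rewrite (prim_order_dvd mprim) z4 eq_sym -subr_eq0 opprK.
    by rewrite -[1 + 1]/(2%:R) pnatr_eq0.
  suff -> : 8%N = m by [].
  have := @dvdn_leq m 8 isT m8; move: m8 mN4 {mprim}.
  by do 9?[case: m => [|m] //].
have : `|zeta| ^+ 4 = 1 by rewrite -normrX z4 normrN1.
move=> /eqP; rewrite pexpr_eq1 ?normr_ge0 // => /eqP zn.
by rewrite -[conjc _]/(Num.conj zeta) -normCK zn expr1n.
Qed.

Variables (zeta : C) (T : finType).
Hypotheses (zeta_prim : 8.-primitive_root zeta) (zeta_norm : zeta * conjc zeta = 1).

Definition phase (t : {ffun T -> 'I_8}) (x : T) : C := zeta ^+ t x.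

Definition phase_mean (F : {ffun T -> 'I_8} -> C) : C :=
  (8%:R ^+ #|T|)^-1 * \sum_t F t.

(** Exponents are lists of indices, so that two monomials agree exactly when the lists satisfy
    [perm_eq]. *)
Definition monomial (s s' : seq T) t : C :=
  (\prod_(x <- s) phase t x) * \prod_(x <- s') conjc (phase t x).

Let zetaV : conjc zeta = zeta ^+ 7.
Proof.
have z8 := prim_expr_order zeta_prim.
by rewrite -[LHS]mulr1 -z8 (exprS zeta 7) mulrA [_ * zeta]mulrC zeta_norm mul1r.
Qed.

(** Exponents up to 4 differ by less than 8, so for [a != b] the ratio [r] is a nontrivial eighth
    root of unity and its geometric sum vanishes. The conjugate is the seventh power, which keeps
    exponents natural. *)
Let root_sum (a b : nat) : (a <= 4)%N -> (b <= 4)%N ->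
  \sum_(k < 8) zeta ^+ k ^+ a * conjc (zeta ^+ k) ^+ b = 8%:R * (a == b)%:R.
Proof.
move=> a4 b4; have z8 := prim_expr_order zeta_prim.
pose r := zeta ^+ (a + 7 * b).
have -> : \sum_(k < 8) zeta ^+ k ^+ a * conjc (zeta ^+ k) ^+ b = \sum_(k < 8) r ^+ k.
  apply: eq_bigr => k _; rewrite -[conjc (_ ^+ _)]/(Num.conj _) rmorphXn /=.
  rewrite -[Num.conj zeta]/(conjc zeta) zetaV /r -!exprM -exprD; congr (_ ^+ _).
  by rewrite mulnDl mulnC -!mulnA [(k * b)%N]mulnC.
have [ab|ab] := eqVneq a b.
  have -> : r = 1 by rewrite /r -ab -{1}[a]mul1n -mulnDl exprM z8 expr1n.
  by under eq_bigr do rewrite expr1n; rewrite sumr_const card_ord mulr1.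
have r_neq1 : r != 1.
  rewrite /r -(prim_order_dvd zeta_prim); clear r; move: ab a4 b4.
  by move: a b => [|[|[|[|[|a]]]]] [|[|[|[|[|b]]]]].
have r8 : r ^+ 8 = 1 by rewrite /r -exprM mulnC exprM z8 expr1n.
apply/eqP; rewrite mulr0; have := subrX1 r 8; rewrite r8 subrr => /esym/eqP.
by rewrite mulf_eq0 subr_eq0 (negbTE r_neq1).
Qed.

Lemma prod_count (s : seq T) (F : T -> C) :
  \prod_(x <- s) F x = \prod_x F x ^+ count_mem x s.
Proof.
elim: s => [|y s IHs].
  by rewrite big_nil big1 // => x _; rewrite expr0.
rewrite big_cons IHs [RHS](bigD1 y) //= [in LHS](bigD1 y) //= eqxx exprS mulrA.
congr (_ * _); apply: eq_bigr => x /negbTE xy.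
by rewrite eq_sym xy.
Qed.

Lemma phase_mean_monomial (s s' : seq T) : (size s <= 4)%N -> (size s' <= 4)%N ->
  phase_mean (monomial s s') = (perm_eq s s')%:R.
Proof.
move=> s4 s'4; rewrite /phase_mean /monomial.
have -> : \sum_t (\prod_(x <- s) phase t x) * (\prod_(x <- s') conjc (phase t x)) =
   \prod_x \sum_(k < 8) zeta ^+ k ^+ count_mem x s * conjc (zeta ^+ k) ^+ count_mem x s'.
  rewrite bigA_distr_bigA; apply: eq_bigr => t _.
  by rewrite (prod_count s) (prod_count s') -big_split.
under eq_bigr => x _ do
  rewrite root_sum ?(leq_trans (count_size _ _)) //.
rewrite big_split /= prodr_const mulKf ?expf_neq0 ?pnatr_eq0 //.
have [/permP ss'|Nss'] := boolP (perm_eq s s').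
  by rewrite big1 // => x _; rewrite ss' eqxx.
have [x /eqP xss'] : exists x, count_mem x s != count_mem x s'.
  apply/existsP; apply: contraNT Nss' => /existsPn ss'.
  by apply/allP => x _; have := ss' x; rewrite negbK.
by rewrite (bigD1 x) //= (negbTE (introN eqP xss')) mul0r.
Qed.

Lemma phase_meanD F G : phase_mean (fun t => F t + G t) = phase_mean F + phase_mean G.
Proof. by rewrite /phase_mean big_split mulrDr. Qed.

Lemma phase_mean_sum (I : finType) (F : I -> {ffun T -> 'I_8} -> C) :
  phase_mean (fun t => \sum_i F i t) = \sum_i phase_mean (F i).
Proof. by rewrite /phase_mean exchange_big mulr_sumr. Qed.

Lemma phase_meanZ c F : phase_mean (fun t => c * F t) = c * phase_mean F.
Proof. by rewrite /phase_mean -mulr_sumr mulrCA. Qed.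

Lemma monomialM s1 s1' s2 s2' t :
  monomial s1 s1' t * conjc (monomial s2 s2' t) = monomial (s1 ++ s2') (s1' ++ s2) t.
Proof.
rewrite /monomial conjcM !conjc_prod !big_cat /=.
under [X in _ * (_ * X)]eq_bigr do rewrite conjcK.
ring.
Qed.

(* Eighth roots of unity separate monomials of degree at most four. *)
Lemma phase_mean_inner (I J : finType) (c : I -> C) (c' : J -> C)
    (s1 s1' : I -> seq T) (s2 s2' : J -> seq T) :
  (forall i j, size (s1 i ++ s2' j) <= 4)%N ->
  (forall i j, size (s1' i ++ s2 j) <= 4)%N ->
  phase_mean (fun t => (\sum_i c i * monomial (s1 i) (s1' i) t) *
     conjc (\sum_j c' j * monomial (s2 j) (s2' j) t)) =
  \sum_i \sum_j c i * conjc (c' j) * (perm_eq (s1 i ++ s2' j) (s1' i ++ s2 j))%:R.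
Proof.
move=> h1 h2.
transitivity (phase_mean (fun t => \sum_i \sum_j c i * conjc (c' j) *
   monomial (s1 i ++ s2' j) (s1' i ++ s2 j) t)).
  congr phase_mean; apply/funext => t; rewrite mulr_suml; apply: eq_bigr => i _.
  rewrite conjc_sum mulr_sumr; apply: eq_bigr => j _.
  by rewrite conjcM -monomialM; ring.
rewrite phase_mean_sum; apply: eq_bigr => i _; rewrite phase_mean_sum.
by apply: eq_bigr => j _; rewrite phase_meanZ phase_mean_monomial.
Qed.

End Phases.

(** On the right, [j] and [l'] can only be matched with [m]; then [m] occurs at least twice on the
    left but once on the right. This separates the monomials of [g12] from those of [g3] below. *)
Lemma perm_eq3F (T : eqType) (m k j l j' l' : T) :
  j != j' -> l != l' -> j != l -> j' != l' -> ~~ perm_eq [:: k; j; l'] [:: m; l; j'].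
Proof.
move=> h1 h2 h3 h4; apply/negP => /permP e.
have ej := e (pred1 j); have el := e (pred1 l'); have em := e (pred1 m).
move: ej el em; rewrite /= !eqxx !addn0.
rewrite [l == j]eq_sym [j' == j]eq_sym (negbTE h1) (negbTE h3) (negbTE h2) (negbTE h4).
case: (eqVneq m j) => [mj|_] /=; last by lia.
case: (eqVneq m l') => [ml'|_] /=; last by lia.
subst l' j; rewrite !eqxx [l == m]eq_sym (negbTE h3) [j' == m]eq_sym (negbTE h1); lia.
Qed.

(** Write [n1 + n4 = n2 + n3] for the counts of an element in [[a; b]], [[c'; d']], [[c; d]],
    [[a'; b']]. One of [n1], [n2] and one of [n3], [n4] is 0, so [n1 - n2 = n3 - n4] forces equal
    positive and negative parts. *)
Lemma perm_eq4 (T : eqType) (a b c d a' b' c' d' : T) :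
  a != c -> a != d -> b != c -> b != d ->
  a' != c' -> a' != d' -> b' != c' -> b' != d' ->
  perm_eq [:: a; b; c'; d'] [:: c; d; a'; b'] ->
  perm_eq [:: a; b] [:: a'; b'] && perm_eq [:: c; d] [:: c'; d'].
Proof.
have disj (x a1 b1 c1 d1 : T) : a1 != c1 -> a1 != d1 -> b1 != c1 -> b1 != d1 ->
    count_mem x [:: a1; b1] = 0 \/ count_mem x [:: c1; d1] = 0.
  move=> h1 h2 h3 h4 /=.
  have [e1|_] := eqVneq a1 x; first by right; rewrite -e1 ![_ == a1]eq_sym (negbTE h1) (negbTE h2).
  have [e1|_] := eqVneq b1 x; first by right; rewrite -e1 ![_ == b1]eq_sym (negbTE h3) (negbTE h4).
  by left.
move=> h1 h2 h3 h4 h1' h2' h3' h4' /permP e.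
have main x : count_mem x [:: a; b] = count_mem x [:: a'; b'] /\
              count_mem x [:: c; d] = count_mem x [:: c'; d'].
  have := e (pred1 x); have := disj x _ _ _ _ h1 h2 h3 h4.
  have := disj x _ _ _ _ h1' h2' h3' h4'.
  rewrite -[[:: a; b; c'; d']]/([:: a; b] ++ [:: c'; d']).
  rewrite -[[:: c; d; a'; b']]/([:: c; d] ++ [:: a'; b']) !count_cat.
  move: (count_mem x [:: a; b]) (count_mem x [:: c; d]) => n1 n2.
  move: (count_mem x [:: a'; b']) (count_mem x [:: c'; d']) => n3 n4.
  by clear; lia.
by apply/andP; split; apply/allP => x _ /=; apply/eqP; have [] := main x.
Qed.

(** * Moments of a quadratic chaos in random phases *)

Section Chaos.
Context {R : realType}.
Local Notation C := (complex R).

Lemma sqnD_le (a b : C) : sqn (a + b) <= 2 * sqn a + 2 * sqn b.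
Proof.
case: a b => [x y] [x' y']; rewrite /sqn /=.
have := sqr_ge0 (x - x'); have := sqr_ge0 (y - y'); lra.
Qed.

Lemma sqn_sum_cauchy (I : finType) (a b : I -> C) :
  sqn (\sum_i a i * conjc (b i)) <= (\sum_i sqn (a i)) * (\sum_i sqn (b i)).
Proof.
have : 0 <= \sum_i \sum_j sqn (a i * b j - a j * b i).
  by do 2!apply: sumr_ge0 => ? _; exact: sqn_ge0.
have -> : \sum_i \sum_j sqn (a i * b j - a j * b i) =
    2 * ((\sum_i sqn (a i)) * (\sum_i sqn (b i))) - 2 * sqn (\sum_i a i * conjc (b i)).
  transitivity (\sum_i \sum_j (sqn (a i) * sqn (b j) + sqn (b i) * sqn (a j)
     - 2 * complex.Re (a i * conjc (b i) * conjc (a j * conjc (b j))))).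
    apply: eq_bigr => i _; apply: eq_bigr => j _; rewrite sqnB !sqnM.
    rewrite [sqn (a j) * _]mulrC; congr (_ - _ * complex.Re _).
    by rewrite !conjcM conjcK; ring.
  under eq_bigr => i _ do rewrite sumrB big_split /= -!mulr_sumr -Re_sum -mulr_sumr -conjc_sum.
  rewrite sumrB big_split /= -!mulr_suml -mulr_sumr -Re_sum -mulr_suml -sqnE /=.
  ring.
lra.
Qed.

Variables (zeta : C) (T : finType).
Hypotheses (zeta_prim : 8.-primitive_root zeta) (zeta_norm : zeta * conjc zeta = 1).

Local Notation mon := (@monomial R zeta T).
Local Notation mean := (@phase_mean R T).

Lemma perm_eq2 (a b c d : T) :
  perm_eq [:: a; b] [:: c; d] = (a == c) && (b == d) || (a == d) && (b == c).
Proof.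
apply/idP/orP => [|[/andP[/eqP -> /eqP ->]|/andP[/eqP -> /eqP ->]]] //; last first.
  by rewrite (perm_catC [:: d] [:: c]).
move=> /permP abcd; have ha := abcd (pred1 a); have hb := abcd (pred1 b).
rewrite /= !eqxx !addn0 in ha hb.
have [ac|ac] := eqVneq a c; first left.
  subst c; move: hb; rewrite [a == b]eq_sym; case: (b == a) => //= hb.
    by move: hb; rewrite eq_sym; case: (b == d) => //; lia.
  by move: hb; rewrite eq_sym; case: (b == d) => //; lia.
have ad : d = a.
  by apply/eqP; move: ha; rewrite [c == a]eq_sym (negbTE ac); case: (d == a) => //; lia.
right; subst d; rewrite eqxx /=; move: hb; rewrite [a == b]eq_sym [c == b]eq_sym.
by case: (b == a); case: (b == c) => //; lia.
Qed.

Lemma phase_conj (t : {ffun T -> 'I_8}) x : phase zeta t x * conjc (phase zeta t x) = 1.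
Proof.
rewrite /phase; have -> : conjc (zeta ^+ t x) = conjc zeta ^+ t x by exact: rmorphXn.
by rewrite -exprMn zeta_norm expr1n.
Qed.

Definition chaos (Y : T -> T -> C) (t : {ffun T -> 'I_8}) : C :=
  \sum_i Y i.1 i.2 * mon [:: i.2] [:: i.1] t.

Lemma chaos_second_moment (Y : T -> T -> C) : (forall x, Y x x = 0) ->
  mean (fun t => chaos Y t * conjc (chaos Y t)) = real_complex R (\sum_i \sum_j sqn (Y i j)).
Proof.
move=> Y0; rewrite /chaos phase_mean_inner // [X in real_complex R X]pair_big_dep rmorph_sum /=.
apply: eq_bigr => -[a b] _; rewrite (bigD1 (a, b)) //= perm_eq2 !eqxx sqnE orbT mulr1.
rewrite big1 ?addr0 // => -[a' b'] /= ab; rewrite perm_eq2.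
have [ba|ba] := eqVneq b a; first by rewrite ba Y0 !mul0r.
have [ba'|ba'] := eqVneq b' a'; first by rewrite ba' Y0 conjc0 mulr0 mul0r.
have [eb|eb] := eqVneq b b'; last by rewrite mulr0.
have [ea|ea] := eqVneq a' a; last by rewrite mulr0.
by rewrite ea eb eqxx in ab.
Qed.

Lemma phase_mean_conj (F : {ffun T -> 'I_8} -> C) :
  mean (fun t => conjc (F t)) = conjc (mean F).
Proof.
rewrite /phase_mean conjcM conjc_sum; congr (_ * _).
by rewrite conjc_inv -natrX conjc_nat.
Qed.

Section FourthMoment.
Variable Y : T -> T -> C.
Hypothesis Y0 : forall x, Y x x = 0.

Let S := \sum_i \sum_j sqn (Y i j).
Let Q : finType := ((T * T) * (T * T))%type.
Let cq (q : Q) : C := Y q.1.1 q.1.2 * conjc (Y q.2.1 q.2.2).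
Let c3 (q : Q) : C := if (q.1.1 != q.2.1) && (q.1.2 != q.2.2) then cq q else 0.
Let B (m k : T) : C := if m == k then 0 else
  \sum_j Y j k * conjc (Y j m) + \sum_l Y m l * conjc (Y k l).
Let sq (q : Q) := [:: q.1.2; q.2.1].
Let sq' (q : Q) := [:: q.1.1; q.2.2].
Let g3 t := \sum_q c3 q * mon (sq q) (sq' q) t.
Let g12 := chaos B.
(* [|chaos Y t|^2] is the constant [g0], plus the terms [g12] in which one of the
   two indices cancels, plus the rest [g3]; the three are orthogonal. *)
Let g0 t := \sum_(i : 'I_1) real_complex R S * mon [::] [::] t.

Let chaos_sq t : chaos Y t * conjc (chaos Y t) = g0 t + g12 t + g3 t.
Proof.
pose F j k j' k' := Y j k * conjc (Y j' k') * mon [:: k; j'] [:: j; k'] t.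
have -> : chaos Y t * conjc (chaos Y t) = \sum_j \sum_k \sum_j' \sum_k' F j k j' k'.
  rewrite pair_big /= /chaos mulr_suml; apply: eq_bigr => i _.
  rewrite pair_big /= conjc_sum mulr_sumr; apply: eq_bigr => j _.
  rewrite conjcM /F -[mon [:: _; _] _ _]/(mon ([:: i.2] ++ [:: j.1]) ([:: i.1] ++ [:: j.2]) t).
  by rewrite -monomialM; ring.
have g3E : g3 t = \sum_j \sum_k \sum_(j' | j' != j) \sum_(k' | k' != k) F j k j' k'.
  rewrite /g3 -(pair_big xpredT xpredT
    (fun i j => c3 (i, j) * mon (sq (i, j)) (sq' (i, j)) t)) /= [RHS]pair_big /=.
  apply: eq_bigr => -[j k] _ /=; rewrite pair_big_dep /= [RHS]big_mkcond /=.
  apply: eq_bigr => -[j' k'] _ /=; rewrite /c3 /= [j == j']eq_sym [k == k']eq_sym.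
  by case: ifP => // _; rewrite mul0r.
have monE j k l : mon [:: k; j] [:: j; l] t = mon [:: k] [:: l] t.
  rewrite /monomial !big_cons !big_nil !mulr1.
  transitivity (phase zeta t k * conjc (phase zeta t l) *
    (phase zeta t j * conjc (phase zeta t j))); first by ring.
  by rewrite phase_conj mulr1.
have monE' j k l : mon [:: k; j] [:: l; k] t = mon [:: j] [:: l] t.
  rewrite /monomial !big_cons !big_nil !mulr1.
  transitivity (phase zeta t j * conjc (phase zeta t l) *
    (phase zeta t k * conjc (phase zeta t k))); first by ring.
  by rewrite phase_conj mulr1.
have g0E : g0 t = \sum_j \sum_k F j k j k.
  rewrite /g0 big_ord1 /monomial !big_nil !mulr1 rmorph_sum /=; apply: eq_bigr => j _.
  rewrite rmorph_sum /=; apply: eq_bigr => k _; rewrite /F sqnE monE.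
  by rewrite /monomial !big_cons !big_nil !mulr1 phase_conj mulr1.
have g12E : g12 t = \sum_j \sum_k \sum_(k' | k' != k) F j k j k' +
                    \sum_j \sum_k \sum_(j' | j' != j) F j k j' k.
  rewrite /g12 /chaos -(pair_big xpredT xpredT (fun m k => B m k * mon [:: k] [:: m] t)) /=.
  transitivity (
      (\sum_m \sum_(k | k != m) (\sum_j Y j k * conjc (Y j m)) * mon [:: k] [:: m] t) +
      (\sum_m \sum_(k | k != m) (\sum_l Y m l * conjc (Y k l)) * mon [:: k] [:: m] t)).
    rewrite -big_split /=; apply: eq_bigr => m _.
    rewrite -big_split /= [RHS]big_mkcond /=; apply: eq_bigr => k _.
    by rewrite /B eq_sym; case: eqP => _ /=; [rewrite mul0r | rewrite mulrDl].
  congr (_ + _).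
  - rewrite [RHS]exchange_big /=.
    transitivity (\sum_m \sum_(k | k != m) \sum_j F j k j m).
      apply: eq_bigr => m _; apply: eq_bigr => k _; rewrite mulr_suml.
      by apply: eq_bigr => j _; rewrite /F monE.
    rewrite (exchange_big_dep xpredT) //=; apply: eq_bigr => k _.
    rewrite exchange_big /=; apply: eq_bigr => j _.
    by apply: eq_bigl => m; rewrite eq_sym.
  - apply: eq_bigr => m _.
    transitivity (\sum_(k | k != m) \sum_l F m l k l); last by rewrite exchange_big.
    apply: eq_bigr => k _; rewrite mulr_suml.
    by apply: eq_bigr => l _; rewrite /F monE'.
rewrite g0E g12E g3E -!big_split /=; apply: eq_bigr => j _.
rewrite -!big_split /=; apply: eq_bigr => k _.
rewrite (bigD1 j) //= (bigD1 k) //=.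
under [X in _ + X = _]eq_bigr => j' _ do rewrite (bigD1 k) //=.
by rewrite big_split /=; ring.
Qed.

Let mean_g0 (J : finType) (c : J -> C) (s s' : J -> seq T) :
  (forall j, size (s j) <= 4)%N -> (forall j, size (s' j) <= 4)%N ->
  (forall j, c j != 0 -> ~~ perm_eq (s' j) (s j)) ->
  mean (fun t => g0 t * conjc (\sum_j c j * mon (s j) (s' j) t)) = 0.
Proof.
move=> h h' cN; rewrite /g0 phase_mean_inner //= big_ord1 big1 // => j _.
have [->|/cN/negbTE ->] := eqVneq (c j) 0; last by rewrite mulr0.
by rewrite conjc0 mulr0 mul0r.
Qed.

Let c3_neq0 q : c3 q != 0 -> [/\ q.1.1 != q.2.1, q.1.2 != q.2.2, q.1.1 != q.1.2 & q.2.1 != q.2.2].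
Proof.
rewrite /c3 /cq; case: ifP => [/andP[h1 h2]|]; last by rewrite eqxx.
rewrite mulf_eq0 negb_or conjc_eq0 => /andP[h3 h4]; split=> //.
  by apply: contra h3 => /eqP ->; rewrite Y0.
by apply: contra h4 => /eqP ->; rewrite Y0.
Qed.

Let mean_g12_g3 : mean (fun t => g12 t * conjc (g3 t)) = 0.
Proof.
rewrite /g12 /chaos /g3 phase_mean_inner // big1 // => -[m k] _; rewrite big1 // => q _ /=.
have [->|/c3_neq0 [h1 h2 h3 h4]] := eqVneq (c3 q) 0; first by rewrite conjc0 mulr0 mul0r.
have [mk|mk] := eqVneq m k; first by rewrite /B mk eqxx !mul0r.
case: q h1 h2 h3 h4 => [[j l] [j' l']] /= h1 h2 h3 h4.
by rewrite (negbTE (perm_eq3F m k h1 h2 h3 h4)) mulr0.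
Qed.

Let mean_sq :
  mean (fun t => (chaos Y t * conjc (chaos Y t)) * conjc (chaos Y t * conjc (chaos Y t))) =
  real_complex R S ^+ 2 + mean (fun t => g12 t * conjc (g12 t)) +
    mean (fun t => g3 t * conjc (g3 t)).
Proof.
have h12 : mean (fun t => g0 t * conjc (g12 t)) = 0.
  apply: mean_g0 => // -[m k] /=; rewrite /B; case: (eqVneq m k) => [_|mk _]; rewrite ?eqxx //.
  by apply/negP => /permP/(_ (pred1 m)); rewrite /= eqxx eq_sym (negbTE mk).
have h3 : mean (fun t => g0 t * conjc (g3 t)) = 0.
  apply: mean_g0 => // q /c3_neq0 [a1 a2 a3 a4]; rewrite /sq /sq' perm_eq2.
  by rewrite (negbTE a3) (negbTE a1).
have h00 : mean (fun t => g0 t * conjc (g0 t)) = real_complex R S ^+ 2.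
  by rewrite /g0 phase_mean_inner // !big_ord1 conjc_real /= mulr1 expr2.
have sym F G : mean (fun t => F t * conjc (G t)) = 0 -> mean (fun t => G t * conjc (F t)) = 0.
  move=> FG; rewrite -[RHS]conjc0 -FG -phase_mean_conj; congr phase_mean; apply/funext => t.
  by rewrite conjcM conjcK mulrC.
transitivity (mean (fun t => g0 t * conjc (g0 t)) + mean (fun t => g0 t * conjc (g12 t))
  + mean (fun t => g0 t * conjc (g3 t)) + mean (fun t => g12 t * conjc (g0 t))
  + mean (fun t => g12 t * conjc (g12 t)) + mean (fun t => g12 t * conjc (g3 t))
  + mean (fun t => g3 t * conjc (g0 t)) + mean (fun t => g3 t * conjc (g12 t))
  + mean (fun t => g3 t * conjc (g3 t))).
  rewrite -!phase_meanD; congr phase_mean; apply/funext => t.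
  by rewrite chaos_sq !rmorphD /=; ring.
by rewrite h00 h12 h3 (sym _ _ h12) (sym _ _ h3) mean_g12_g3 (sym _ _ mean_g12_g3); ring.
Qed.

Let S_ge0 : 0 <= S.
Proof. by do 2!apply: sumr_ge0 => ? _; exact: sqn_ge0. Qed.

(** [B] is the off-diagonal part of [Y^* Y + Y Y^*]. By Cauchy-Schwarz each product has squared
    Frobenius norm at most [S^2], and splitting the sum gives the factor [2 + 2]. *)
Let mean_g12 : complex.Re (mean (fun t => g12 t * conjc (g12 t))) <= 4 * S ^+ 2.
Proof.
rewrite chaos_second_moment => [|x]; last by rewrite /B eqxx.
rewrite /=; pose b1 m k := sqn (\sum_j Y j k * conjc (Y j m)).
pose b2 m k := sqn (\sum_l Y m l * conjc (Y k l)).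
apply: (@le_trans _ _ (\sum_m \sum_k (2 * b1 m k + 2 * b2 m k))).
  apply: ler_sum => m _; apply: ler_sum => k _; rewrite /B.
  by case: eqP => _; [rewrite sqn0 addr_ge0 ?mulr_ge0 ?sqn_ge0 | exact: sqnD_le].
pose col k := \sum_j sqn (Y j k); pose row m := \sum_l sqn (Y m l).
have colS : \sum_k col k = S by rewrite /S exchange_big.
apply: (@le_trans _ _ (\sum_m \sum_k (2 * (col m * col k) + 2 * (row m * row k)))).
  apply: ler_sum => m _; apply: ler_sum => k _.
  by apply: lerD; rewrite ler_wpM2l //; [rewrite mulrC|]; exact: sqn_sum_cauchy.
under eq_bigr => m _ do rewrite big_split /= -!mulr_sumr.
rewrite big_split /= -!mulr_sumr -!mulr_suml colS -[\sum_i row i]/S expr2; lra.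
Qed.

(** Without coincidences, a quadruple shares its monomial only with its images under the exchanges
    [q.1.1] with [q.2.2] and [q.1.2] with [q.2.1], four in all. Bounding each product by the mean of
    the two squares gives four times the sum of [sqn (c3 q)], itself at most [S^2]. *)
Let mean_g3 : complex.Re (mean (fun t => g3 t * conjc (g3 t))) <= 4 * S ^+ 2.
Proof.
rewrite /g3 phase_mean_inner // Re_sum.
pose sg (ab : bool * bool) (q : Q) : Q :=
  ((if ab.1 then q.2.2 else q.1.1, if ab.2 then q.2.1 else q.1.2),
   (if ab.2 then q.1.2 else q.2.1, if ab.1 then q.1.1 else q.2.2)).
have sgK ab : involutive (sg ab) by case: ab => [[] []] [[j l] [j' l']].
have term (q q' : Q) : complex.Re (c3 q * conjc (c3 q') *
      (perm_eq (sq q ++ sq' q') (sq' q ++ sq q'))%:R) <=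
    \sum_(ab : bool * bool) (q' == sg ab q)%:R * ((sqn (c3 q) + sqn (c3 q')) / 2).
  have h0 : 0 <= (sqn (c3 q) + sqn (c3 q')) / 2.
    by rewrite divr_ge0 // addr_ge0 // sqn_ge0.
  have sum0 : 0 <= \sum_(ab : bool * bool) (q' == sg ab q)%:R * ((sqn (c3 q) + sqn (c3 q')) / 2).
    by apply: sumr_ge0 => ab _; rewrite mulr_ge0.
  have [e|_] := boolP (perm_eq _ _); last by rewrite mulr0.
  have [z|/c3_neq0] := eqVneq (c3 q) 0.
    by apply: (le_trans _ sum0); rewrite z !mul0r.
  have [z'|/c3_neq0] := eqVneq (c3 q') 0.
    by move=> _; apply: (le_trans _ sum0); rewrite z' conjc0 mulr0 mul0r.
  move=> [b1 b2 b3 b4] [a1 a2 a3 a4].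
  have [ab qE] : exists ab, q' = sg ab q.
    case: q q' e a1 a2 a3 a4 b1 b2 b3 b4 {h0 sum0} => [[j l] [j' l']] [[J L] [J' L']] /= e.
    move=> a1 a2 a3 a4 b1 b2 b3 b4.
    have := perm_eq4 _ _ _ _ _ _ _ _ e.
    rewrite ![l == j]eq_sym ![L == J]eq_sym ![j' == j]eq_sym ![J' == J]eq_sym.
    move=> /(_ a3 a2 a1 a4 b3 b2 b1 b4); rewrite !perm_eq2 => /andP[].
    move=> /orP[/andP[/eqP -> /eqP ->]|/andP[/eqP -> /eqP ->]]
      /orP[/andP[/eqP -> /eqP ->]|/andP[/eqP -> /eqP ->]].
    - by exists (false, false).
    - by exists (true, false).
    - by exists (false, true).
    - by exists (true, true).
  rewrite mulr1 (bigD1 ab) //= qE eqxx mul1r -qE.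
  have := sqn_ge0 (c3 q - c3 q'); rewrite sqnB => h.
  apply: ler_wpDr; first by apply: sumr_ge0 => x _; rewrite mulr_ge0.
  lra.
apply: (@le_trans _ _ (\sum_q \sum_q' \sum_(ab : bool * bool)
   (q' == sg ab q)%:R * ((sqn (c3 q) + sqn (c3 q')) / 2))).
  by apply: ler_sum => q _; rewrite Re_sum; apply: ler_sum => q' _; exact: term.
have -> : \sum_q \sum_q' \sum_(ab : bool * bool)
   (q' == sg ab q)%:R * ((sqn (c3 q) + sqn (c3 q')) / 2) =
   \sum_(ab : bool * bool) \sum_q sqn (c3 q).
  under eq_bigr do rewrite exchange_big /=.
  rewrite exchange_big /=; apply: eq_bigr => ab _.
  transitivity (\sum_q (sqn (c3 q) + sqn (c3 (sg ab q))) / 2).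
    apply: eq_bigr => q _; rewrite (bigD1 (sg ab q)) //= eqxx mul1r big1 ?addr0 // => q'.
    by move=> /negbTE ->; rewrite mul0r.
  rewrite -mulr_suml big_split /=.
  have -> : \sum_q sqn (c3 (sg ab q)) = \sum_q sqn (c3 q).
    by rewrite [RHS](reindex_inj (inv_inj (sgK ab))).
  by field.
rewrite sumr_const card_prod card_bool -[_ *+ _]mulr_natl ler_wpM2l //.
apply: (@le_trans _ _ (\sum_q sqn (cq q))).
  by apply: ler_sum => q _; rewrite /c3; case: ifP => // _; rewrite sqn0 sqn_ge0.
rewrite -(pair_big xpredT xpredT (fun i j => sqn (cq (i, j)))) /=.
under eq_bigr => i _ do under eq_bigr => j _ do rewrite /cq sqnM sqn_conj /=.
under eq_bigr => i _ do rewrite -mulr_sumr.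
by rewrite -mulr_suml -(pair_big xpredT xpredT (fun i j => sqn (Y i j))) /= expr2.
Qed.

(** The constant is [1 + 4 + 4], from [g0], [g12] and [g3]. *)
Lemma chaos_fourth_moment :
  \sum_t sqn (chaos Y t) ^+ 2 <= 8%:R ^+ #|T| * (9 * (\sum_i \sum_j sqn (Y i j)) ^+ 2).
Proof.
have h8 : 0 < 8%:R ^+ #|T| :> R by rewrite exprn_gt0.
rewrite -ler_pdivrMl //.
have e : real_complex R ((8%:R ^+ #|T|)^-1 * \sum_t sqn (chaos Y t) ^+ 2) =
   mean (fun t => (chaos Y t * conjc (chaos Y t)) * conjc (chaos Y t * conjc (chaos Y t))).
  rewrite /phase_mean rmorphM /= fmorphV rmorphXn /= rmorph_nat rmorph_sum; congr (_ * _).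
  by apply: eq_bigr => t _; rewrite -sqnE conjc_real /= -rmorphM expr2.
have /(congr1 (@complex.Re R)) := e; rewrite mean_sq /= => ->.
have -> (a b c : C) : complex.Re (a + b + c) = complex.Re a + complex.Re b + complex.Re c.
  by case: a b c => [? ?] [? ?] [? ?].
have -> : complex.Re (real_complex R S ^+ 2) = S ^+ 2 by rewrite -rmorphXn.
have := mean_g12; have := mean_g3; rewrite -/S; lra.
Qed.

End FourthMoment.

(** This is the interpolation [(E x^2)^3 <= (E x)^2 E x^4], which turns 9 into its square root 3; it
    is obtained by averaging a pointwise polynomial inequality. *)
Lemma chaos_first_moment (Y : T -> T -> C) : (forall x, Y x x = 0) ->
  8%:R ^+ #|T| * Num.sqrt (\sum_i \sum_j sqn (Y i j)) <=
  3 * \sum_t Num.sqrt (sqn (chaos Y t)).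
Proof.
move=> Y0; set S := \sum_i \sum_j sqn (Y i j).
have S_ge0 : 0 <= S by do 2!apply: sumr_ge0 => ? _; exact: sqn_ge0.
have h8 : 0 < 8%:R ^+ #|T| :> R by rewrite exprn_gt0.
have rhs_ge0 : 0 <= \sum_t Num.sqrt (sqn (chaos Y t)).
  by apply: sumr_ge0 => t _; exact: sqrtr_ge0.
pose r := Num.sqrt S; have rE : r ^+ 2 = S by rewrite sqr_sqrtr.
have [r0|r_neq0] := eqVneq r 0; first by rewrite -/r r0 mulr0 mulr_ge0.
have r_gt0 : 0 < r by rewrite lt0r r_neq0 sqrtr_ge0.
have second : \sum_t sqn (chaos Y t) = 8%:R ^+ #|T| * S.
  apply: (@complexI R); rewrite rmorphM /= rmorphXn /= rmorph_nat -chaos_second_moment //.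
  rewrite /phase_mean mulVKf ?expf_neq0 ?pnatr_eq0 // rmorph_sum.
  by apply: eq_bigr => t _; rewrite /= sqnE.
have fourth := chaos_fourth_moment Y0; rewrite -/S -rE in fourth.
rewrite -rE in second.
(* [x (x - 3 r)^2 (x + 6 r) >= 0], with equality at the values [0] and [3 r]. *)
have pt t : sqn (chaos Y t) / (2 * r) - sqn (chaos Y t) ^+ 2 / (54 * r ^+ 3) <=
    Num.sqrt (sqn (chaos Y t)).
  set x := Num.sqrt _; have x0 : 0 <= x by exact: sqrtr_ge0.
  have <- : x ^+ 2 = sqn (chaos Y t) by rewrite sqr_sqrtr ?sqn_ge0.
  rewrite -subr_ge0.
  have -> : x - (x ^+ 2 / (2 * r) - x ^+ 2 ^+ 2 / (54 * r ^+ 3)) =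
      x * (x - 3 * r) ^+ 2 * (x + 6 * r) / (54 * r ^+ 3) by field.
  apply: divr_ge0; last by rewrite mulr_ge0 // exprn_ge0 // ltW.
  by apply: mulr_ge0; [apply: mulr_ge0 => //; exact: sqr_ge0 | lra].
have : \sum_t (sqn (chaos Y t) / (2 * r) - sqn (chaos Y t) ^+ 2 / (54 * r ^+ 3)) <=
    \sum_t Num.sqrt (sqn (chaos Y t)) by apply: ler_sum => t _; exact: pt.
rewrite sumrB -!mulr_suml second => h.
have h4 : (\sum_t sqn (chaos Y t) ^+ 2) / (54 * r ^+ 3) <= 8%:R ^+ #|T| * r / 6.
  rewrite ler_pdivrMr ?mulr_gt0 ?exprn_gt0 //; apply: le_trans fourth _.
  by rewrite le_eqVlt; apply/orP; left; apply/eqP; field.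
have e2 : 8%:R ^+ #|T| * r ^+ 2 / (2 * r) = 8%:R ^+ #|T| * r / 2 by field.
rewrite e2 in h; rewrite -/r; lra.
Qed.

End Chaos.

(** * Frobenius distortion of the measurement, on one site and on two *)

Section Distortion.
Context {R : realType}.
Local Notation C := (complex R).

Definition frob (T : finType) (X : T -> T -> C) : R :=
  Num.sqrt (\sum_j \sum_k sqn (X j k)).

Definition outcome (T : finType) (phi : T -> C) (X : T -> T -> C) : C :=
  \sum_j \sum_k X j k * (phi k * conjc (phi j)).

(** The bound for one site tensorises: apply it to the second site with the first indices fixed,
    pull the outcome sum out of the l2 norm by Minkowski, then apply it to the first site. Each
    application needs one of the two partial traces to vanish. *)
Lemma outcome_tensor_frob (T Om : finType) (phi : Om -> T -> C) (a : R) :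
  0 <= a ->
  (forall X : T -> T -> C, \sum_x X x x = 0 ->
    frob X <= a * \sum_o Num.sqrt (sqn (outcome (phi o) X))) ->
  forall xi : T -> T -> T -> T -> C,
  (forall k k', \sum_j xi j j k k' = 0) -> (forall j j', \sum_k xi j j' k k = 0) ->
  Num.sqrt (\sum_j \sum_j' frob (xi j j') ^+ 2) <=
  a ^+ 2 * \sum_o \sum_o' Num.sqrt (sqn
    (outcome (phi o) (fun j j' => outcome (phi o') (xi j j')))).
Proof.
move=> a_ge0 phiP xi xi1 xi2.
pose Y o' j j' := outcome (phi o') (xi j j').
have Y_tr o' : \sum_j Y o' j j = 0.
  rewrite /Y /outcome exchange_big big1 // => k _; rewrite exchange_big big1 // => k' _.
  by rewrite -mulr_suml xi1 mul0r.
have frob_ge0 (X : T -> T -> C) : 0 <= frob X by exact: sqrtr_ge0.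
apply: (@le_trans _ _ (a * \sum_o' frob (Y o'))); last first.
  rewrite expr2 -mulrA ler_wpM2l // exchange_big /= mulr_sumr.
  by apply: ler_sum => o' _; exact: phiP.
pose b o' (i : T * T) := Num.sqrt (sqn (Y o' i.1 i.2)).
have bE o' : frob (Y o') = Num.sqrt (\sum_i b o' i ^+ 2).
  rewrite /frob pair_big /=; congr Num.sqrt; apply: eq_bigr => i _.
  by rewrite /b sqr_sqrtr // sqn_ge0.
under [X in _ * X]eq_bigr do rewrite bE.
apply: (@le_trans _ _ (a * Num.sqrt (\sum_i (\sum_o' b o' i) ^+ 2))); last first.
  by rewrite ler_wpM2l // minkowski_sum.
rewrite -[X in X * _]ger0_norm // -sqrtr_sqr -sqrtrM ?sqr_ge0 //.
apply: ler_wsqrtr; rewrite pair_big /= mulr_sumr; apply: ler_sum => -[j j'] _ /=.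
rewrite -exprMn lerXn2r ?nnegrE ?frob_ge0 //.
- by rewrite mulr_ge0 // sumr_ge0 // => o _; exact: sqrtr_ge0.
- exact: phiP.
Qed.

(* The basis vectors with weight [1/4], which see the diagonal of [X], and the
   vectors of eighth roots of unity with weight [3/4], on which the off-diagonal
   part is a chaos with [E |f|^4 <= 9 (E |f|^2)^2]. *)
Lemma exists_povm (T : finType) : exists (Om : finType) (o0 : Om) (phi : Om -> T -> C),
  frame phi /\ forall X : T -> T -> C, \sum_x X x x = 0 ->
    frob X <= 4 * \sum_o Num.sqrt (sqn (outcome (phi o) X)).
Proof.
have [zeta [zp zn]] := @exists_eighth_root R.
pose n8 : R := 8%:R ^+ #|T|.
have n8_gt0 : 0 < n8 by rewrite exprn_gt0.
(* The weights 1/4 and 3/4 balance the constants of the two parts, 1 for the diagonal and 3 for the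
   chaos: [1 / (1/4) = 3 / (3/4) = 4]. Dividing by [n8] spreads 3/4 evenly over the phase
   vectors. *)
pose c : R := Num.sqrt (3 / 4 / n8).
have c2 : c ^+ 2 = 3 / 4 / n8 by rewrite sqr_sqrtr // !divr_ge0 // ltW.
pose phi (o : T + {ffun T -> 'I_8}) (x : T) : C := match o with
  | inl j => real_complex R (1 / 2) * (x == j)%:R
  | inr t => real_complex R c * phase zeta t x
  end.
exists (T + {ffun T -> 'I_8})%type, (inr [ffun=> ord0]), phi; split=> [x y|X X0].
  rewrite big_sumType /=.
  have -> : \sum_t phi (inr t) x * conjc (phi (inr t) y) = real_complex R (3 / 4) * (x == y)%:R.
    transitivity (real_complex R (3 / 4) * phase_mean (monomial zeta [:: x] [:: y])).
      rewrite /phase_mean mulrA mulr_sumr; apply: eq_bigr => t _.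
      rewrite /phi conjcM conjc_real /monomial !big_seq1.
      transitivity (real_complex R c ^+ 2 * (phase zeta t x * conjc (phase zeta t y))).
        by rewrite expr2; ring.
      by rewrite -rmorphXn /= c2 rmorphM /= fmorphV rmorphXn /= rmorph_nat.
    rewrite phase_mean_monomial //; congr (_ * (nat_of_bool _)%:R).
    by apply/idP/eqP => [/perm_mem/(_ x)|-> //]; rewrite !inE eqxx => /esym/eqP.
  have -> : \sum_j phi (inl j) x * conjc (phi (inl j) y) = real_complex R (1 / 4) * (x == y)%:R.
    rewrite (bigD1 x) //= eqxx big1 ?addr0 => [|j /negbTE jx].
      rewrite conjcM conjc_real conjc_bool mulr1 mulrA -rmorphM [y == x]eq_sym /=.
      by congr (real_complex R _ * _); field.
    by rewrite eq_sym jx mulr0 mul0r.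
  have e1 : 1 / 4 + 3 / 4 = 1 :> R by field.
  by rewrite -mulrDl -rmorphD /= e1 mul1r.
pose Y j k := if j == k then 0 else X j k.
have Y0 x : Y x x = 0 by rewrite /Y eqxx.
have dE j : outcome (phi (inl j)) X = real_complex R (1 / 4) * X j j.
  rewrite /outcome (bigD1 j) //= [X in _ + X]big1 ?addr0 => [|k kj].
    rewrite (bigD1 j) //= big1 ?addr0 => [|k kj].
      rewrite eqxx conjcM conjc_real conjc1 !mulr1 -rmorphM /= mulrC.
      by congr (real_complex R _ * _); field.
    by rewrite (negbTE kj) mulr0 mul0r mulr0.
  by rewrite big1 // => l _; rewrite (negbTE kj) mulr0 conjc0 !mulr0.
(* Phases have modulus one, so the diagonal of [X] contributes its trace, which is 0. *)
have cE t : outcome (phi (inr t)) X = real_complex R (3 / 4 / n8) * chaos zeta Y t.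
  rewrite /outcome /chaos -c2 rmorphXn /=.
  rewrite -(pair_big xpredT xpredT (fun j k => Y j k * monomial zeta [:: k] [:: j] t)) /=.
  transitivity (real_complex R c ^+ 2 *
      (\sum_j (\sum_k Y j k * monomial zeta [:: k] [:: j] t + X j j))).
    rewrite mulr_sumr; apply: eq_bigr => j _.
    rewrite [X in _ = _ * (X + _)](bigD1 j) //= Y0 mul0r add0r addrC (bigD1 j) //= mulrDr.
    congr (_ + _).
      rewrite conjcM conjc_real.
      transitivity (real_complex R c ^+ 2 * X j j * (phase zeta t j * conjc (phase zeta t j))).
        by ring.
      by rewrite phase_conj // mulr1.
    rewrite mulr_sumr; apply: eq_bigr => k kj.
    rewrite /Y eq_sym (negbTE kj) /monomial !big_seq1 conjcM conjc_real; ring.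
  by rewrite big_split /= X0 addr0.
rewrite big_sumType /=.
have -> : \sum_j Num.sqrt (sqn (outcome (phi (inl j)) X)) =
    1 / 4 * \sum_j Num.sqrt (sqn (X j j)).
  rewrite mulr_sumr; apply: eq_bigr => j _.
  by rewrite dE sqnM sqn_real sqrtrM ?sqr_ge0 // sqrtr_sqr ger0_norm.
have -> : \sum_t Num.sqrt (sqn (outcome (phi (inr t)) X)) =
    3 / 4 / n8 * \sum_t Num.sqrt (sqn (chaos zeta Y t)).
  rewrite mulr_sumr; apply: eq_bigr => t _.
  by rewrite cE sqnM sqn_real sqrtrM ?sqr_ge0 // sqrtr_sqr ger0_norm // !divr_ge0 // ltW.
have splitX : \sum_j \sum_k sqn (X j k) = \sum_j sqn (X j j) + \sum_j \sum_k sqn (Y j k).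
  rewrite -big_split; apply: eq_bigr => j _ /=.
  rewrite (bigD1 j) //=; congr (_ + _); rewrite [RHS](bigD1 j) //= Y0 sqn0 add0r.
  by apply: eq_bigr => k kj; rewrite /Y eq_sym (negbTE kj).
rewrite /frob splitX.
apply: le_trans (sqrtD_le _ _) _.
- by apply: sumr_ge0 => j _; exact: sqn_ge0.
- by do 2!apply: sumr_ge0 => ? _; exact: sqn_ge0.
have diag : Num.sqrt (\sum_j sqn (X j j)) <= \sum_j Num.sqrt (sqn (X j j)).
  by apply: sqrt_sum_le => j; exact: sqn_ge0.
have off := chaos_first_moment zp zn Y0.
have off' : Num.sqrt (\sum_j \sum_k sqn (Y j k)) <=
    3 / n8 * \sum_t Num.sqrt (sqn (chaos zeta Y t)).
  by rewrite mulrAC ler_pdivlMr // mulrC.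
have -> : 4 * (1 / 4 * (\sum_j Num.sqrt (sqn (X j j))) +
    3 / 4 / n8 * \sum_t Num.sqrt (sqn (chaos zeta Y t))) =
    \sum_j Num.sqrt (sqn (X j j)) + 3 / n8 * \sum_t Num.sqrt (sqn (chaos zeta Y t)).
  by field; rewrite gt_eqF.
exact: lerD.
Qed.

End Distortion.

(** * States after a local measurement *)

Section LocalEvaluation.
Import boot.finset.
Context {R : realType} {V : finType} {d : nat}.
Local Notation C := (complex R).
Local Notation cfg := (cfg V d).
Local Notation restrict := (@Defs.restrict V d).
Local Notation local_op := (V -> 'I_d -> 'I_d -> C).
Implicit Types (k : cfg -> cfg -> C) (B : local_op) (S : {set V}).

(* [ev k B = tr (k (x)_v B_v)]. *)
Definition ev k B : C := \sum_x \sum_y k x y * \prod_v B v (y v) (x v).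

Definition idop (y x : 'I_d) : C := (y == x)%:R.

Definition ketbra (b a : 'I_d) (y x : 'I_d) : C := ((y == b) && (x == a))%:R.

Lemma eq_ev k B B' : (forall v y x, B v y x = B' v y x) -> ev k B = ev k B'.
Proof.
move=> BB'; apply: eq_bigr => x _; apply: eq_bigr => y _; congr (_ * _).
exact: eq_bigr.
Qed.

Lemma prod_bool (I : finType) (b : I -> bool) :
  \prod_i (b i)%:R = [forall i, b i]%:R :> C.
Proof.
have [/forallP h|/forallPn [i /negbTE hi]] := boolP [forall i, b i].
  by rewrite big1 // => i _; rewrite h.
by rewrite (bigD1 i) //= hi mul0r.
Qed.

Lemma ev_ketbra k (x y : cfg) : ev k (fun v => ketbra (y v) (x v)) = k x y.
Proof.
rewrite /ev.
transitivity (\sum_x' (x == x')%:R * \sum_y' (y == y')%:R * k x' y'); last by rewrite !sum_delta.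
apply: eq_bigr => x' _; rewrite mulr_sumr; apply: eq_bigr => y' _.
rewrite prod_bool mulrC mulrA -natrM mulnb; congr (_%:R * _); congr nat_of_bool.
apply/forallP/andP => [h|[/eqP <- /eqP <-] v]; last by rewrite !eqxx.
by split; apply/eqP/ffunP => v; have /andP[/eqP h1 /eqP h2] := h v.
Qed.

Lemma ev_family (J : finType) k (Q : V -> pred J) (M : V -> J -> 'I_d -> 'I_d -> C) :
  \sum_(t : {ffun V -> J} | [forall v, Q v (t v)]) ev k (fun v => M v (t v)) =
  ev k (fun v y x => \sum_(j | Q v j) M v j y x).
Proof.
rewrite /ev exchange_big /=; apply: eq_bigr => x _.
rewrite exchange_big /=; apply: eq_bigr => y _.
by rewrite -mulr_sumr (bigA_distr_big_dep _ (fun v j => M v j (y v) (x v))).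
Qed.

Lemma ev_sum_on (J : finType) (j0 : J) k S (M : V -> J -> 'I_d -> 'I_d -> C) :
  sum_on j0 S (fun t => ev k (fun v => M v (t v))) =
  ev k (fun v y x => if v \in S then \sum_j M v j y x else M v j0 y x).
Proof.
rewrite /sum_on (ev_family k (fun v j => (v \notin S) ==> (j == j0)) M).
apply: eq_ev => v y x; case: ifP => // _; exact: big_pred1_eq.
Qed.

Lemma ev_site (J : finType) k (u : V) (c : J -> C) (M : J -> local_op) B :
  (forall j v y x, v != u -> M j v y x = B v y x) ->
  (forall y x, B u y x = \sum_j c j * M j u y x) ->
  ev k B = \sum_j c j * ev k (M j).
Proof.
move=> MB Bu; rewrite /ev.
under [RHS]eq_bigr do rewrite mulr_sumr.
rewrite [RHS]exchange_big /=; apply: eq_bigr => x _.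
under [RHS]eq_bigr do rewrite mulr_sumr.
rewrite [RHS]exchange_big /=; apply: eq_bigr => y _.
rewrite (bigD1 u) //= Bu mulr_suml mulr_sumr; apply: eq_bigr => j _.
rewrite [in RHS](bigD1 u) //= (eq_bigr (fun v => M j v (y v) (x v))) => [|v vu]; last by rewrite MB.
ring.
Qed.

(** Each local factor is in Kraus form; a tensor product of completely positive maps sends a
    positive kernel to a positive kernel. *)
Lemma ev_gram (A J : finType) k (al : A -> V -> J -> 'I_d -> C) (B : A -> A -> local_op) :
  gram k ->
  (forall a b v y x, B a b v y x = \sum_s al b v s y * conjc (al a v s x)) ->
  gram (fun a b => ev k (B a b)).
Proof.
move=> [I [g kE]] BE.
exists (I * {ffun V -> J})%type,
  (fun (i : I * {ffun V -> J}) a => \sum_x g i.1 x * \prod_v conjc (al a v (i.2 v) (x v))) => a b.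
rewrite -(pair_big xpredT xpredT (fun i (s : {ffun V -> J}) =>
  (\sum_x g i x * \prod_v conjc (al a v (s v) (x v))) *
  conjc (\sum_x g i x * \prod_v conjc (al b v (s v) (x v))))) /=.
transitivity (\sum_i \sum_(s : {ffun V -> J}) \sum_x \sum_y
    g i x * conjc (g i y) * \prod_v (al b v (s v) (y v) * conjc (al a v (s v) (x v)))).
  rewrite /ev; under eq_bigr => x _ do under eq_bigr => y _ do rewrite kE mulr_suml.
  under eq_bigr => x _ do rewrite exchange_big /=.
  rewrite exchange_big /=; apply: eq_bigr => i _.
  rewrite [RHS]exchange_big /=; apply: eq_bigr => x _.
  rewrite [RHS]exchange_big /=; apply: eq_bigr => y _.
  rewrite -mulr_sumr; congr (_ * _).
  rewrite -(bigA_distr_bigA (fun v s => al b v s (y v) * conjc (al a v s (x v)))).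
  by apply: eq_bigr => v _; exact: BE.
apply: eq_bigr => i _; apply: eq_bigr => s _.
rewrite conjc_sum mulr_suml; apply: eq_bigr => x _.
rewrite mulr_sumr; apply: eq_bigr => y _.
rewrite conjcM conjc_prod big_split /=.
under [X in _ = _ * (_ * X)]eq_bigr do rewrite conjcK.
ring.
Qed.

Lemma gram_ge0 (T : finType) (k : T -> T -> C) x : gram k -> 0 <= k x x.
Proof.
by move=> [I [g ->]]; apply: sumr_ge0 => i _; exact: mulcJ_ge0.
Qed.

Lemma gram_eq0 (T : finType) (k : T -> T -> C) x y : gram k -> k x x = 0 -> k x y = 0.
Proof.
move=> [I [g kE]] /eqP; rewrite kE psumr_eq0 => [/allP g0|i _]; last exact: mulcJ_ge0.
rewrite kE big1 // => i _; have := g0 i; rewrite mem_index_enum => /(_ isT) /=.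
by rewrite -sqnE -[0]/(real_complex R 0) (inj_eq (@complexI R)) sqn_eq0 => /eqP ->; rewrite mul0r.
Qed.

Definition mix S (x t : cfg) : cfg := [ffun v => if v \in S then x v else t v].

Lemma ev_mix (j0 : 'I_d) k S (x y : cfg) :
  ev k (fun v => if v \in S then ketbra (y v) (x v) else idop) =
  sum_on j0 (~: S) (fun t => k (mix S x t) (mix S y t)).
Proof.
have -> : sum_on j0 (~: S) (fun t => k (mix S x t) (mix S y t)) =
    sum_on j0 (~: S) (fun t => ev k (fun v =>
      if v \in S then ketbra (y v) (x v) else ketbra (t v) (t v))).
  apply: eq_sum_on => t; rewrite -ev_ketbra; apply: eq_ev => v z z'.
  by rewrite !ffunE; case: ifP.
rewrite (ev_sum_on j0 k (~: S) (fun v j => if v \in S then ketbra (y v) (x v) else ketbra j j)).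
apply: eq_ev => v z z'; rewrite in_setC; case: ifP => //= _.
rewrite /idop /ketbra (bigD1 z) //= eqxx big1 ?addr0 1?eq_sym // => j.
by rewrite eq_sym => /negbTE ->.
Qed.

Definition ext (j0 : 'I_d) S (a : cfgS d S) : cfg :=
  [ffun v => if insub v is Some s then a s else j0].

Lemma extK (j0 : 'I_d) S (a : cfgS d S) : restrict S (ext j0 a) = a.
Proof. by apply/ffunP => s; rewrite !ffunE valK. Qed.

Lemma restrict_eqP S (x y : cfg) :
  reflect (forall v, v \in S -> x v = y v) (restrict S x == restrict S y).
Proof.
apply: (iffP eqP) => [/ffunP h v vS|h].
  by have := h (Sub v vS); rewrite !ffunE SubK.
by apply/ffunP => s; rewrite !ffunE; apply: h; exact: valP.
Qed.

Lemma restrict_mix S (x t : cfg) : restrict S (mix S x t) = restrict S x.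
Proof. by apply/eqP/restrict_eqP => v vS; rewrite ffunE vS. Qed.

Lemma sum_cfgS (W : nmodType) (j0 : 'I_d) S (h : cfgS d S -> W) :
  \sum_a h a = sum_on j0 S (fun x => h (restrict S x)).
Proof.
rewrite /sum_on (reindex_onto (@ext j0 S) (@Defs.restrict V d S)) => [|x /forallP xS]; last first.
  apply/ffunP => v; rewrite ffunE; case: insubP => [s _ <-|vS]; first by rewrite ffunE.
  by have := xS v; rewrite vS => /eqP.
apply: eq_big => [a|a _]; last by rewrite extK.
rewrite extK eqxx andbT; apply/esym/forallP => v; apply/implyP => vS.
by rewrite ffunE insubN.
Qed.

Lemma ptraceE (j0 : 'I_d) S (A : op R cfg) (x y : cfg) :
  opE (ptrace S A) (restrict S x) (restrict S y) =
  sum_on j0 (~: S) (fun t => opE A (mix S x t) (mix S y t)).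
Proof.
rewrite -ev_mix /opE mxE !enum_rankK /ev; apply: eq_bigr => x' _.
rewrite big_mkcond; apply: eq_bigr => y' _ /=.
pose agree v := if v \in S then (y' v == y v) && (x' v == x v) else y' v == x' v.
rewrite (eq_bigr (fun v => (agree v)%:R)).
  rewrite prod_bool; set b := [&& _, _ & _]; suff -> : [forall v, agree v] = b.
    by case: b; rewrite ?mulr1 ?mulr0.
  rewrite /b; apply/forallP/and3P => [h|[/restrict_eqP h1 /restrict_eqP h2 /restrict_eqP h3] v].
    split; apply/restrict_eqP => v vS; have := h v; rewrite /agree.
    - by rewrite vS => /andP[_ /eqP].
    - by rewrite vS => /andP[/eqP].
    - by rewrite -[v \in S]negbK -in_setC vS => /eqP.
  rewrite /agree; have [vS|vS] := boolP (v \in S); first by rewrite h1 // h2 // !eqxx.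
  by rewrite h3 ?in_setC // eqxx.
by move=> v _; rewrite /agree; case: ifP.
Qed.

End LocalEvaluation.

Lemma sum_option (W : nmodType) (J : finType) (f : option J -> W) :
  \sum_s f s = f None + \sum_j f (Some j).
Proof.
rewrite (bigD1 None) //=; congr (_ + _).
rewrite (reindex_omap Some id) => [|[]] //=; apply: eq_bigl => j.
by rewrite eqxx.
Qed.

(** * Unnormalised conditional states and outcome probabilities *)

Section MeasuredStates.
Import boot.finset.
Context {R : realType} {V : finType} {d : nat} {Om : finType} (o0 : Om) (i0 : 'I_d).
Local Notation C := (complex R).
Local Notation cfg := (cfg V d).
Local Notation restrict := (@Defs.restrict V d).
Variables (phi : Om -> 'I_d -> C) (k : cfg -> cfg -> C).
Hypotheses (phiP : frame phi) (kP : gram k) (k_tr : \sum_x k x x = 1).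
Implicit Types (S M : {set V}) (z : {ffun V -> Om}) (x y : cfg) (u v : V) (o : Om).

Definition proj o (b a : 'I_d) : C := phi o b * conjc (phi o a).

(* Sites of [M] are measured, with outcome [o]. A site that is measured and
   also kept is replaced by the maximally mixed state. *)
Definition site_op (keep meas : bool) o (x y b a : 'I_d) : C :=
  if meas then
    if keep then real_complex R (d%:R^-1) * (x == y)%:R * proj o b a else proj o b a
  else if keep then ketbra y x b a else idop b a.

(* The reduced state on [S], multiplied by the probability of the outcome [z] on [M]. *)
Definition pstate S M z x y : C :=
  ev k (fun v => site_op (v \in S) (v \in M) (z v) (x v) (y v)).

Let d_neq0 : d%:R != 0 :> R.
Proof. by rewrite pnatr_eq0 -lt0n (leq_ltn_trans _ (ltn_ord i0)). Qed.

Lemma sum_ketbra b a : \sum_(j < d) ketbra j j b a = idop b a :> C.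
Proof.
rewrite /idop /ketbra (bigD1 b) //= eqxx big1 ?addr0 1?eq_sym // => j.
by rewrite eq_sym => /negbTE ->.
Qed.

Lemma sum_proj b a : \sum_o proj o b a = idop b a.
Proof. exact: phiP. Qed.

Lemma sum_site_op meas o (x y b a : 'I_d) :
  \sum_j site_op true meas o j j b a = site_op false meas o x y b a.
Proof.
rewrite /site_op; case: meas; last exact: sum_ketbra.
under eq_bigr do rewrite eqxx mulr1.
rewrite sumr_const card_ord -[_ *+ _]mulr_natl mulrA -(rmorph_nat (real_complex R)).
by rewrite -rmorphM /= mulfV // mul1r.
Qed.

Lemma pstate_local S M z z' x x' y y' :
  (forall v, v \in S -> x v = x' v) -> (forall v, v \in S -> y v = y' v) ->
  (forall v, v \in M -> z v = z' v) -> pstate S M z x y = pstate S M z' x' y'.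
Proof.
move=> xx yy zz; apply: eq_ev => v b a; rewrite /site_op.
have [vS|] := boolP (v \in S); have [vM|] := boolP (v \in M) => //; last first.
- by rewrite zz.
- by rewrite xx // yy.
- by rewrite zz // xx // yy.
Qed.

Lemma pstate_marginal S S' M z x y : S' \subset S ->
  sum_on i0 (S :\: S') (fun t => pstate S M z (mix S' x t) (mix S' y t)) =
  pstate S' M z x y.
Proof.
move=> /fintype.subsetP S'S; pose N v (j : 'I_d) := site_op (v \in S) (v \in M) (z v)
  (if v \in S' then x v else j) (if v \in S' then y v else j).
transitivity (sum_on i0 (S :\: S') (fun t => ev k (fun v => N v (t v)))).
  by apply: eq_sum_on => t; apply: eq_ev => v b a; rewrite /N !ffunE; case: ifP.
rewrite ev_sum_on; apply: eq_ev => v b a; rewrite /N in_setD.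
case: ifP => [/andP[/negbTE -> ->]|]; first exact: sum_site_op.
have [/S'S -> //|_] := boolP (v \in S'); rewrite /= => ->.
by rewrite /site_op.
Qed.

Lemma pstate_gram S M z : gram (pstate S M z).
Proof.
(* Kraus vectors of the site operations: those of rank one use only the index [None]; the identity
   and the maximally mixed replacement use [Some j], one vector per basis state. *)
pose al x v (s : option 'I_d) (a : 'I_d) : C :=
  if v \in M then
    if v \in S then
      if s is Some j then real_complex R (Num.sqrt d%:R^-1) * (j == x v)%:R * phi (z v) a else 0
    else if s is Some _ then 0 else phi (z v) a
  else if v \in S then if s is Some _ then 0 else (a == x v)%:R
  else if s is Some j then (a == j)%:R else 0.
apply: (ev_gram (al := al)) => // x y v b a; rewrite /al /site_op.
rewrite sum_option /=; case: ifP => _; case: ifP => _.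
- rewrite mul0r add0r (bigD1 (x v)) //= [X in _ + X]big1 ?addr0 => [|j /negbTE jx].
    rewrite eqxx mulr1 !conjcM conjc_real /proj.
    rewrite -[in LHS](sqr_sqrtr (a := d%:R^-1)) ?invr_ge0 // expr2 rmorphM /=; ring.
  by rewrite jx mulr0 mul0r conjc0 mulr0.
- by rewrite big1 ?addr0 // => j _; rewrite mul0r.
- by rewrite big1 ?addr0 // => [|j _]; rewrite ?mul0r // conjc_bool -natrM mulnb.
- rewrite mul0r add0r (bigD1 a) //= big1 ?addr0 => [|j].
    by rewrite eqxx conjc1 mulr1.
  by rewrite eq_sym => /negbTE ->; rewrite conjc0 mulr0.
Qed.

Definition prob M z : R := complex.Re (pstate set0 M z [ffun=> i0] [ffun=> i0]).

Lemma pstate_set0 M z x y : pstate set0 M z x y = real_complex R (prob M z).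
Proof.
rewrite /prob RRe_real ?ger0_real ?gram_ge0 //; last exact: pstate_gram.
by apply: pstate_local => // v; rewrite inE.
Qed.

Lemma pstate_no_measurement S z x y :
  pstate S set0 z x y = ev k (fun v => if v \in S then ketbra (y v) (x v) else idop).
Proof. by apply: eq_ev => v b a; rewrite /site_op inE; case: ifP. Qed.

Lemma pstate_sum_outcome S M z x y u : u \notin M -> u \notin S ->
  \sum_o pstate S (u |: M) (upd z u o) x y = pstate S M z x y.
Proof.
move=> uM uS; apply/esym.
rewrite {1}/pstate (@ev_site R V d Om _ u (fun=> 1) (fun o v =>
  site_op (v \in S) (v \in u |: M) (upd z u o v) (x v) (y v))).
- by apply: eq_bigr => o _; rewrite mul1r.
- by move=> o v b a vu; rewrite upd_neq // !inE (negbTE vu).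
- move=> b a; rewrite (negbTE uS) (negbTE uM) /site_op !inE eqxx /= -sum_proj.
  by apply: eq_bigr => o _; rewrite upd_id mul1r.
Qed.

Lemma pstate_sum_on S M x y : [disjoint M & S] ->
  sum_on o0 M (fun z => pstate S M z x y) = pstate S set0 [ffun=> o0] x y.
Proof.
move=> MS; pose N v o := site_op (v \in S) (v \in M) o (x v) (y v).
transitivity (sum_on o0 M (fun z => ev k (fun v => N v (z v)))) => //.
rewrite ev_sum_on; apply: eq_ev => v b a; rewrite /N /site_op inE.
have [vM|vM] := boolP (v \in M) => //.
by rewrite (disjointFr MS vM) sum_proj.
Qed.

(** Measuring a kept, unmeasured site moves it from the kept set to the measured set. *)
Lemma pstate_outcome S M z x y u o : u \notin M -> u \notin S ->
  outcome (phi o) (fun j j' => pstate (u |: S) M z (upd x u j) (upd y u j')) =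
  pstate S (u |: M) (upd z u o) x y.
Proof.
move=> uM uS; apply/esym; rewrite {1}/pstate.
rewrite (@ev_site R V d ('I_d * 'I_d)%type _ u (fun j => phi o j.2 * conjc (phi o j.1))
  (fun j v => site_op (v \in u |: S) (v \in M) (z v) (upd x u j.1 v) (upd y u j.2 v))).
- rewrite /outcome pair_big /=; apply: eq_bigr => j _; exact: mulrC.
- by move=> j v b a vu; rewrite !upd_neq // !inE (negbTE vu).
- move=> b a; rewrite /site_op !inE eqxx (negbTE uM) (negbTE uS) /= !upd_id.
  under eq_bigr do rewrite !upd_id.
  rewrite (bigD1 (a, b)) //= /ketbra !eqxx mulr1 big1 ?addr0 // => -[j j'].
  rewrite xpair_eqE [b == j']eq_sym [a == j]eq_sym andbC /= => /negbTE ->.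
  by rewrite mulr0.
Qed.

Lemma pstate_sum_site S M z x y u : u \notin S ->
  \sum_j pstate (u |: S) M z (upd x u j) (upd y u j) = pstate S M z x y.
Proof.
move=> uS; apply/esym; rewrite {1}/pstate.
rewrite (@ev_site R V d 'I_d _ u (fun=> 1) (fun j v =>
  site_op (v \in u |: S) (v \in M) (z v) (upd x u j v) (upd y u j v))).
- by apply: eq_bigr => j _; rewrite mul1r.
- by move=> j v b a vu; rewrite !upd_neq // !inE (negbTE vu).
- move=> b a; rewrite (negbTE uS) -(sum_site_op _ _ (x u) (y u)).
  by apply: eq_bigr => j _; rewrite mul1r !inE eqxx !upd_id.
Qed.

Lemma prob_consistent : consistent_family prob.
Proof.
split=> [M z|z|M u z o uM|M u z uM].
- by rewrite -ler0c -(pstate_set0 M z [ffun=> i0] [ffun=> i0]) gram_ge0 //; exact: pstate_gram.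
- apply: (@complexI R); rewrite rmorph1 -(pstate_set0 _ _ [ffun=> i0] [ffun=> i0]) -k_tr.
  rewrite pstate_no_measurement (ev_mix i0) setC0 sum_on_setT.
  by apply: eq_bigr => t _; congr k; apply/ffunP => v; rewrite ffunE inE.
- apply: (@complexI R); rewrite -!(pstate_set0 _ _ [ffun=> i0] [ffun=> i0]).
  by apply: pstate_local => // v vM; rewrite upd_neq //; apply: contraNneq uM => <-.
- apply: (@complexI R); rewrite rmorph_sum /= -(pstate_set0 _ _ [ffun=> i0] [ffun=> i0]).
  rewrite -(pstate_sum_outcome _ _ _ uM) ?inE //.
  by apply: eq_bigr => o _; rewrite -(pstate_set0 _ _ [ffun=> i0] [ffun=> i0]).
Qed.

Lemma pstate_trace S M z : sum_on i0 S (fun t => pstate S M z t t) = real_complex R (prob M z).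
Proof.
rewrite -(pstate_set0 M z [ffun=> i0] [ffun=> i0]) -(pstate_marginal M z _ _ (sub0set S)) setD0.
by apply: eq_sum_on => t; apply: pstate_local => // v vS; rewrite ffunE inE.
Qed.

Lemma pstate_eq0 S M z x y : prob M z = 0 -> pstate S M z x y = 0.
Proof.
move=> p0; apply: (gram_eq0 _ (pstate_gram S M z)).
pose x' : cfg := [ffun v => if v \in S then x v else i0].
have -> : pstate S M z x x = pstate S M z x' x'.
  by apply: pstate_local => // v vS; rewrite ffunE vS.
have := pstate_trace S M z; rewrite p0 /= => /eqP.
rewrite /sum_on psumr_eq0 => [/allP h|t _]; last by apply: gram_ge0; exact: pstate_gram.
apply/eqP; have := h x'; rewrite mem_index_enum => /(_ isT)/implyP; apply.
by apply/forallP => v; rewrite ffunE; case: ifP; rewrite ?eqxx.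
Qed.

(** At outcomes of probability 0 the maximally mixed state is a default that keeps every value a
    density. *)
Definition cond_state S M z : op R (cfgS d S) :=
  \matrix_(a, b) if prob M z == 0 then
      real_complex R (#|cfgS d S|%:R^-1) * (a == b)%:R
    else real_complex R (prob M z)^-1 *
      pstate S M z (ext i0 (enum_val a)) (ext i0 (enum_val b)).

Lemma cond_stateE S M z x y : prob M z != 0 ->
  opE (cond_state S M z) (restrict S x) (restrict S y) =
  real_complex R (prob M z)^-1 * pstate S M z x y.
Proof.
move=> /negbTE p0; rewrite /opE mxE !enum_rankK p0; congr (_ * _).
have extE (w : cfg) v : v \in S -> ext i0 (restrict S w) v = w v.
  by move=> vS; rewrite ffunE insubT ffunE.
by apply: pstate_local => // v; exact: extE.
Qed.

Lemma density_cond_state S M z : density (cond_state S M z).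
Proof.
have c_neq0 : #|cfgS d S|%:R != 0 :> R.
  rewrite pnatr_eq0 -lt0n; apply/card_gt0P.
  by exists [ffun=> i0].
have [p_ge0 _ _ _] := prob_consistent.
split.
  apply: gram_psd; have [p0|p_neq0] := eqVneq (prob M z) 0.
    exists (cfgS d S : finType),
      (fun s a => real_complex R (Num.sqrt #|cfgS d S|%:R^-1) * (a == s)%:R) => a b.
    rewrite /opE mxE p0 eqxx (inj_eq enum_rank_inj) (bigD1 a) //= big1 ?addr0 => [|s].
      rewrite eqxx mulr1 conjcM conjc_real conjc_bool [b == a]eq_sym.
      by rewrite mulrA -rmorphM /= -expr2 sqr_sqrtr ?invr_ge0.
    by rewrite eq_sym => /negbTE ->; rewrite mulr0 mul0r.
  have [I [g gE]] := pstate_gram S M z.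
  exists I, (fun i a => real_complex R (Num.sqrt (prob M z)^-1) * g i (ext i0 a)) => a b.
  rewrite -(extK i0 a) -(extK i0 b) cond_stateE // gE !extK mulr_sumr; apply: eq_bigr => i _.
  rewrite conjcM conjc_real -[in LHS](sqr_sqrtr (a := (prob M z)^-1)) ?invr_ge0 //.
  by rewrite expr2 rmorphM /=; ring.
rewrite mxtrace_opE; have [p0|p_neq0] := eqVneq (prob M z) 0.
  rewrite (eq_bigr (fun=> real_complex R (#|cfgS d S|%:R^-1))) => [|a _].
    by rewrite sumr_const -[_ *+ _]mulr_natl -(rmorph_nat (real_complex R)) -rmorphM /= divff.
  by rewrite /opE mxE p0 !eqxx mulr1.
rewrite (sum_cfgS i0); under eq_sum_on do rewrite cond_stateE //.
rewrite /sum_on -mulr_sumr -/(sum_on i0 S (fun t => pstate S M z t t)) pstate_trace.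
by rewrite -rmorphM /= mulVf.
Qed.

End MeasuredStates.

Lemma gramM {R : realType} (T : finType) (k1 k2 : T -> T -> complex R) :
  gram k1 -> gram k2 -> gram (fun x y => k1 x y * k2 x y).
Proof.
move=> [I1 [g1 k1E]] [I2 [g2 k2E]].
exists (I1 * I2)%type, (fun i x => g1 i.1 x * g2 i.2 x) => x y.
rewrite k1E k2E mulr_suml -(pair_big xpredT xpredT
  (fun i j => g1 i x * g2 j x * conjc (g1 i y * g2 j y))) /=.
apply: eq_bigr => i _; rewrite mulr_sumr; apply: eq_bigr => j _.
by rewrite conjcM; ring.
Qed.

Lemma gram_prod {R : realType} (T : finType) (I : Type) (s : seq I)
    (k : I -> T -> T -> complex R) :
  (forall i, gram (k i)) -> gram (fun x y => \prod_(i <- s) k i x y).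
Proof.
move=> kP; elim: s => [|i s [J [g gE]]].
  by exists unit, (fun _ _ => 1) => x y; rewrite big_nil (big_pred1 tt) ?conjc1 ?mulr1 // => -[].
have [J' [g' gE']] := gramM (kP i) (ex_intro _ J (ex_intro _ g gE)).
by exists J', g' => x y; rewrite big_cons -gE'.
Qed.

Lemma gram_sum {R : realType} (T : finType) (I : finType) (w : I -> R)
    (k : I -> T -> T -> complex R) :
  (forall i, 0 <= w i) -> (forall i, gram (k i)) ->
  gram (fun x y => \sum_i real_complex R (w i) * k i x y).
Proof.
move=> w0 kP.
suff : forall s : seq I, gram (fun x y => \sum_(i <- s) real_complex R (w i) * k i x y).
  exact.
elim=> [|i s [J [g gE]]].
  by exists void, (fun _ _ => 0) => x y; rewrite big_nil big_pred0 // => -[].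
have [J' [g' gE']] := kP i.
exists (J' + J)%type, (fun j x => match j with
  | inl j => real_complex R (Num.sqrt (w i)) * g' j x | inr j => g j x end) => x y.
rewrite big_sumType big_cons /= gE gE' mulr_sumr; congr (_ + _).
apply: eq_bigr => j _; rewrite conjcM conjc_real.
by rewrite -[in LHS](sqr_sqrtr (w0 i)) expr2 rmorphM /=; ring.
Qed.

Lemma gram_comp {R : realType} (T T' : finType) (f : T' -> T) (k : T -> T -> complex R) :
  gram k -> gram (fun x y => k (f x) (f y)).
Proof. by move=> [I [g kE]]; exists I, (fun i x => g i (f x)) => x y; rewrite kE. Qed.

(** * The separable approximation *)

Section Clusters.
Import boot.finset.
Context {R : realType} {V : finType} {d : nat} {K : nat} (i0 : 'I_d).
Local Notation C := (complex R).
Local Notation cfg := (cfg V d).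
Local Notation restrict := (@Defs.restrict V d).
Variables (P : 'I_K -> {set V}).
Hypotheses (Pdisj : forall i j, i != j -> [disjoint P i & P j]).
Hypotheses (Pcover : \bigcup_(i < K) P i = [set: V]).

Lemma cluster_inj v i j : v \in P i -> v \in P j -> i = j.
Proof.
move=> vi vj; apply/eqP; apply: contraT => /Pdisj /disjointFr /(_ vi).
by rewrite vj.
Qed.

Lemma mem_cluster v : exists i, v \in P i.
Proof.
by have : v \in \bigcup_(i < K) P i; [rewrite Pcover inE | case/bigcupP => i _ vi; exists i].
Qed.

(** The blocks partition [V], so a string frozen outside [S] amounts to an independent choice of one
    frozen string per block; the sum of products then factors. *)
Lemma sum_on_prod (J : finType) (j0 : J) (S : {set V}) (f : 'I_K -> {ffun V -> J} -> C) :
  (forall i (t t' : {ffun V -> J}), (forall v, v \in P i -> t v = t' v) -> f i t = f i t') ->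
  sum_on j0 S (fun t => \prod_i f i t) = \prod_i sum_on j0 (S :&: P i) (f i).
Proof.
move=> f_local; rewrite /sum_on.
have /choice [cl clP] := mem_cluster.
rewrite (bigA_distr_big_dep (fun i (t : {ffun V -> J}) =>
  [forall w, (w \notin S :&: P i) ==> (t w == j0)]) f).
pose h (t : {ffun V -> J}) : {ffun 'I_K -> {ffun V -> J}} :=
  [ffun i => [ffun v => if v \in P i then t v else j0]].
pose h' (tau : {ffun 'I_K -> {ffun V -> J}}) : {ffun V -> J} := [ffun v => tau (cl v) v].
rewrite [RHS](reindex_onto h h') => [|tau /familyP tauP]; last first.
  apply/ffunP => i; apply/ffunP => v; rewrite !ffunE.
  have [vi|vi] := boolP (v \in P i); first by rewrite (cluster_inj (clP v) vi).
  by have /forallP/(_ v) := tauP i; rewrite inE (negbTE vi) andbF => /eqP.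
apply: eq_big => [t|t _]; last first.
  by apply: eq_bigr => i _; apply: f_local => v vi; rewrite !ffunE vi.
have -> : h' (h t) == t by apply/eqP/ffunP => v; rewrite !ffunE clP.
rewrite andbT; apply/forallP/familyP => [tS i|tS v].
  apply/forallP => v; rewrite !ffunE inE negb_and; apply/implyP.
  have [vi|//] := boolP (v \in P i); rewrite orbF => vS.
  by have := tS v; rewrite vS.
have /forallP/(_ v) := tS (cl v).
by rewrite !ffunE inE clP andbT.
Qed.

Lemma opE_tensor (s : forall i : 'I_K, op R (cfgS d (P i))) (x y : cfg) :
  opE (tensor s) x y = \prod_i opE (s i) (restrict (P i) x) (restrict (P i) y).
Proof. by rewrite {1}/opE mxE !enum_rankK. Qed.

Lemma gram_tensor (s : forall i : 'I_K, op R (cfgS d (P i))) :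
  (forall i, density (s i)) -> gram (opE (tensor s)).
Proof.
move=> sP; have [J [g gE]] := @gram_prod R cfg _ (index_enum 'I_K)
  (fun i x y => opE (s i) (restrict (P i) x) (restrict (P i) y))
  (fun i => gram_comp _ (gram_of_psd (proj1 (sP i)))).
by exists J, g => x y; rewrite opE_tensor gE.
Qed.

Lemma trace_tensor (s : forall i : 'I_K, op R (cfgS d (P i))) :
  (forall i, density (s i)) -> \tr (tensor s) = 1.
Proof.
move=> sP; rewrite mxtrace_opE -(sum_on_setT i0).
rewrite (@eq_sum_on _ _ _ _ _ _ (fun x => \prod_i opE (s i) (restrict (P i) x) (restrict (P i) x))).
  rewrite sum_on_prod => [|i t t' tt'].
    rewrite big1 // => i _; rewrite setTI -(sum_cfgS i0 (fun a => opE (s i) a a)).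
    by rewrite -mxtrace_opE (sP i).2.
  by have /eqP -> : restrict (P i) t == restrict (P i) t' by apply/restrict_eqP.
by move=> x; exact: opE_tensor.
Qed.

Lemma opE_sum (T : finType) (I : finType) (c : I -> C) (A : I -> op R T) x y :
  opE (\sum_i c i *: A i) x y = \sum_i c i * opE (A i) x y.
Proof. by rewrite /opE summxE; apply: eq_bigr => i _; rewrite mxE. Qed.

Lemma density_mixture (I : finType) (p : I -> R)
    (s : I -> forall i : 'I_K, op R (cfgS d (P i))) :
  (forall z, 0 <= p z) -> \sum_z p z = 1 -> (forall z i, density (s z i)) ->
  density (\sum_z real_complex R (p z) *: tensor (s z)).
Proof.
move=> p0 p1 sP; split.
  apply: gram_psd; have [J [g gE]] := gram_sum p0 (fun z => gram_tensor (sP z)).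
  by exists J, g => x y; rewrite opE_sum gE.
rewrite linear_sum /=; under eq_bigr do rewrite linearZ /= trace_tensor // mulr1.
by rewrite -rmorph_sum p1.
Qed.

Lemma separable_mixture (I : finType) (p : I -> R)
    (s : I -> forall i : 'I_K, op R (cfgS d (P i))) :
  (forall z, 0 <= p z) -> \sum_z p z = 1 -> (forall z i, density (s z i)) ->
  separable P (\sum_z real_complex R (p z) *: tensor (s z)).
Proof.
move=> p0 p1 sP; exists #|I|, (fun n => p (enum_val n)), (fun n => s (enum_val n)).
split=> //; last by rewrite (reindex _ (onW_bij _ (enum_val_bij I))).
by rewrite -p1 [RHS](reindex _ (onW_bij _ (enum_val_bij I))).
Qed.

Lemma density_ptrace (S : {set V}) (A : op R cfg) : density A -> density (ptrace S A).
Proof.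
move=> [Apsd trA]; split.
  apply: gram_psd; have [J [g gE]] := gram_of_psd Apsd.
  pose frozen (t : cfg) := [forall v, (v \notin ~: S) ==> (t v == i0)].
  exists (J * cfg)%type, (fun (i : J * cfg) a =>
    if frozen i.2 then g i.1 (mix S (ext i0 a) i.2) else 0) => a b.
  rewrite -(extK i0 a) -(extK i0 b) (ptraceE i0) /sum_on big_mkcond /=.
  rewrite -(pair_big xpredT xpredT (fun i (t : cfg) =>
    (if frozen t then g i (mix S (ext i0 (restrict S (ext i0 a))) t) else 0) *
    conjc (if frozen t then g i (mix S (ext i0 (restrict S (ext i0 b))) t) else 0))) /=.
  rewrite exchange_big /=; apply: eq_bigr => t _; rewrite -/(frozen t); case: ifP => _.
    by rewrite gE !extK.
  by rewrite big1 // => i _; rewrite mul0r.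
rewrite mxtrace_opE (sum_cfgS i0).
rewrite (@eq_sum_on _ _ _ _ _ _ (fun x =>
  sum_on i0 (~: S) (fun t => opE A (mix S x t) (mix S x t)))); last first.
  by move=> x; exact: ptraceE.
rewrite -trA mxtrace_opE /sum_on pair_big_dep /=.
rewrite [RHS](reindex_onto (fun xt : cfg * cfg => mix S xt.1 xt.2)
  (fun y => ([ffun v => if v \in S then y v else i0], [ffun v => if v \in S then i0 else y v]))) /=.
  apply: eq_bigl => -[x t] /=; apply/andP/eqP => [[/forallP xS /forallP tS]|[xE tE]].
    congr (_, _); apply/ffunP => v; rewrite !ffunE; have [vS|vS] := boolP (v \in S) => //.
      by have := xS v; rewrite vS => /eqP ->.
    by have := tS v; rewrite in_setC vS => /eqP ->.
  split; apply/forallP => v; apply/implyP => vS.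
    by rewrite -xE ffunE (negbTE vS).
  by rewrite -tE ffunE; move: vS; rewrite in_setC negbK => ->.
by move=> y _; apply/ffunP => v; rewrite !ffunE; case: (v \in S).
Qed.

Context {Om : finType} (o0 : Om).
Variables (phi : Om -> 'I_d -> C) (rho : op R cfg) (M : {set V}).
Hypotheses (phiP : frame phi) (rhoP : density rho).
Local Notation k := (opE rho).
Local Notation prob := (prob i0 phi k).
Local Notation pstate := (pstate phi k).

Let kP : gram k. Proof. exact: gram_of_psd (proj1 rhoP). Qed.
Let k_tr : \sum_x k x x = 1. Proof. by rewrite -mxtrace_opE (proj2 rhoP). Qed.

(* The sum is over the outcomes on [M]: [z] is frozen to [o0] elsewhere. *)
Definition measured_product : op R cfg :=
  \sum_(z : {ffun V -> Om})
    real_complex R (if [forall w, (w \notin M) ==> (z w == o0)] then prob M z else 0)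
    *: tensor (fun i => cond_state i0 phi k (P i) M z).

Let probP := prob_consistent i0 phiP kP k_tr.

Let weight_ge0 (z : {ffun V -> Om}) :
  0 <= (if [forall w, (w \notin M) ==> (z w == o0)] then prob M z else 0).
Proof. by case: ifP => // _; case: probP. Qed.

Let weight_sum : \sum_(z : {ffun V -> Om})
  (if [forall w, (w \notin M) ==> (z w == o0)] then prob M z else 0) = 1.
Proof. by rewrite -big_mkcond; exact: (sum_on_total o0 probP). Qed.

Lemma density_measured_product : density measured_product.
Proof.
by apply: density_mixture => // z i; exact: (density_cond_state i0 phiP kP k_tr).
Qed.

Lemma separable_measured_product : separable P measured_product.
Proof.
by apply: separable_mixture => // z i; exact: (density_cond_state i0 phiP kP k_tr).
Qed.

(** For a fixed outcome the state is a product over blocks, so the partial trace acts in each block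
    separately and leaves the marginal on [S :&: P i]. *)
Lemma ptrace_measured_product (S : {set V}) (x y : cfg) :
  opE (ptrace S measured_product) (restrict S x) (restrict S y) =
  sum_on o0 M (fun z => real_complex R (prob M z) *
    \prod_i (real_complex R (prob M z)^-1 * pstate (S :&: P i) M z x y)).
Proof.
rewrite (ptraceE i0).
transitivity (sum_on i0 (~: S) (fun t => sum_on o0 M (fun z =>
    real_complex R (prob M z) * \prod_i (real_complex R (prob M z)^-1 *
      pstate (P i) M z (mix S x t) (mix S y t))))).
  apply: eq_sum_on => t; rewrite opE_sum /sum_on [RHS]big_mkcond /=.
  apply: eq_bigr => z _; case: ifP => _; last by rewrite mul0r.
  have [p0|p_neq0] := eqVneq (prob M z) 0; first by rewrite p0 !mul0r.
  rewrite opE_tensor; congr (_ * _); apply: eq_bigr => i _.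
  exact: cond_stateE.
rewrite /sum_on exchange_big /=; apply: eq_bigr => z _.
rewrite -mulr_sumr; congr (_ * _).
rewrite -[LHS]/(sum_on i0 (~: S) (fun t => \prod_i (real_complex R (prob M z)^-1 *
      pstate (P i) M z (mix S x t) (mix S y t)))).
rewrite sum_on_prod => [|i t t' tt']; last first.
  congr (_ * _); apply: pstate_local => // v vi; rewrite !ffunE; case: ifP => // _; exact: tt'.
apply: eq_bigr => i _.
rewrite -(pstate_marginal i0 phi k M z x y (subsetIr S (P i))).
have -> : P i :\: (S :&: P i) = ~: S :&: P i.
  by apply/setP => v; rewrite !inE; case: (v \in P i); rewrite ?andbF ?andbT.
rewrite /sum_on mulr_sumr; apply: eq_bigr => t _; congr (_ * _).
by apply: pstate_local => // v vi; rewrite !ffunE inE vi andbT.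
Qed.

End Clusters.

Lemma sqrt_sqn_sum {R : realType} (I : Type) (s : seq I) (P : pred I) (f : I -> complex R) :
  Num.sqrt (sqn (\sum_(i <- s | P i) f i)) <= \sum_(i <- s | P i) Num.sqrt (sqn (f i)).
Proof.
elim/big_rec2: _ => [|i x y _ le_xy]; first by rewrite sqn0 sqrtr0.
have sqn_norm z : Num.sqrt (sqn z) = ComplexField.Normc.normc z by case: z.
by rewrite !sqn_norm in le_xy *; apply: le_trans (le_normcD _ _) _; rewrite lerD2l.
Qed.

Lemma trnorm0 {R : realType} (T : finType) (A : op R T) :
  (forall x y, opE A x y = 0) -> trnorm A = 0.
Proof.
move=> A0; have Aherm : adjmx A = A by apply: adjmx_opE => x y; rewrite !A0 conjc0.
apply/eqP; rewrite eq_le; apply/andP; split; last first.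
  by apply: sumr_ge0 => l _; exact: sqrtr_ge0.
apply: le_trans (trnorm_le_frobenius Aherm) _.
rewrite [X in _ * Num.sqrt X]big1 ?sqrtr0 ?mulr0 // => x _.
by rewrite big1 // => y _; rewrite A0 sqn0.
Qed.

Lemma outcome_subM {R : realType} (T : finType) (p q : T -> complex R)
    (f : T -> T -> T -> T -> complex R) (g h : T -> T -> complex R) (r : complex R) :
  outcome p (fun a b => outcome q (fun a' b' => f a b a' b' - g a b * h a' b' / r)) =
  outcome p (fun a b => outcome q (f a b)) - outcome p g * outcome q h / r.
Proof.
rewrite /outcome !mulr_suml -sumrB; apply: eq_bigr => a _.
rewrite !mulr_suml -sumrB; apply: eq_bigr => b _.
rewrite !mulr_sumr !mulr_suml -sumrB; apply: eq_bigr => a' _.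
rewrite !mulr_sumr !mulr_suml -sumrB; apply: eq_bigr => b' _.
ring.
Qed.

(** * Trace distance of the two-qudit reduced states *)

Section PairBounds.
Import boot.finset.
Context {R : realType} {V : finType} {d : nat} {K : nat} (i0 : 'I_d).
Local Notation C := (complex R).
Local Notation cfg := (cfg V d).
Local Notation restrict := (@Defs.restrict V d).
Variables (P : 'I_K -> {set V}).
Hypotheses (Pdisj : forall i j, i != j -> [disjoint P i & P j]).
Hypotheses (Pcover : \bigcup_(i < K) P i = [set: V]).
Context {Om : finType} (o0 : Om).
Variables (phi : Om -> 'I_d -> C) (rho : op R cfg) (M : {set V}).
Hypotheses (phiP : frame phi) (rhoP : density rho).
Local Notation k := (opE rho).
Local Notation prob := (prob i0 phi k).
Local Notation pstate := (pstate phi k).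
Local Notation sigma := (measured_product i0 P o0 phi rho M).

Let kP : gram k. Proof. exact: gram_of_psd (proj1 rhoP). Qed.
Let k_tr : \sum_x k x x = 1. Proof. by rewrite -mxtrace_opE (proj2 rhoP). Qed.
Let probP := prob_consistent i0 phiP kP k_tr.
Let sigmaP : density sigma. Proof. exact: density_measured_product. Qed.

Lemma pair_trnorm_le2 (u v : V) :
  trnorm (ptrace [set u; v] rho - ptrace [set u; v] sigma) <= 2.
Proof. by apply: trnorm_density_sub; exact: (density_ptrace i0). Qed.

Lemma ptrace_pstate (S : {set V}) (x y : cfg) : [disjoint M & S] ->
  opE (ptrace S rho) (restrict S x) (restrict S y) =
  sum_on o0 M (fun z => pstate S M z x y).
Proof.
move=> MS; rewrite (pstate_sum_on o0 k phiP _ _ MS) pstate_no_measurement.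
by rewrite (ev_mix i0) (ptraceE i0).
Qed.

Lemma opE_sub (T : finType) (A B : op R T) x y : opE (A - B) x y = opE A x y - opE B x y.
Proof. by rewrite /opE !mxE. Qed.

Lemma surj_restrict (S : {set V}) (a : cfgS d S) : exists x, a = restrict S x.
Proof. by exists (ext i0 a); rewrite extK. Qed.

(** A block that misses [S] is traced out completely and contributes the trace 1 of its conditional
    state. *)
Lemma prod_unmeasured (S : {set V}) (z : {ffun V -> Om}) (x y : cfg) (Q : pred 'I_K) :
  prob M z != 0 -> (forall i, Q i -> S :&: P i = set0) ->
  \prod_(i | Q i) (real_complex R (prob M z)^-1 * pstate (S :&: P i) M z x y) = 1.
Proof.
move=> p0 QS; apply: big1 => i /QS ->; rewrite (pstate_set0 i0 phi kP).
by rewrite -rmorphM /= mulVf.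
Qed.

(** Only the block of the pair contributes; its normalisation cancels the outcome probability, and
    averaging over outcomes on other qudits restores [rho]. *)
Lemma pair_trnorm_same (u v : V) (i : 'I_K) : u \in P i -> v \in P i ->
  u \notin M -> v \notin M ->
  trnorm (ptrace [set u; v] rho - ptrace [set u; v] sigma) = 0.
Proof.
move=> ui vi uM vM; have uvM : [disjoint M & [set u; v]].
  by rewrite disjoint_sym disjoints_subset subUset !sub1set !inE uM vM.
apply: trnorm0 => a b; have [x ->] := surj_restrict a; have [y ->] := surj_restrict b.
rewrite opE_sub ptrace_pstate // (ptrace_measured_product _ Pdisj) //.
apply/eqP; rewrite subr_eq0; apply/eqP.
apply: eq_sum_on => z; have [p0|p_neq0] := eqVneq (prob M z) 0.
  by rewrite (pstate_eq0 (i0 := i0) kP) // p0 mul0r.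
rewrite (bigD1 i) //= (prod_unmeasured _ _ p_neq0) => [|j ji].
  rewrite mulr1 mulrA -rmorphM /= mulfV // mul1r.
  suff -> : [set u; v] :&: P i = [set u; v] by [].
  by apply/setIidPl; rewrite subUset !sub1set ui.
apply/eqP; rewrite setI_eq0 disjoints_subset subUset !sub1set !inE.
by apply/andP; split; apply: contra ji => w; apply/eqP; exact: (cluster_inj Pdisj w).
Qed.

Section Cross.
Variables (u v : V) (i j : 'I_K).
Hypotheses (ui : u \in P i) (vj : v \in P j) (ij : i != j) (uM : u \notin M) (vM : v \notin M).

Let uv : u != v.
Proof. by apply: contraNneq ij => uv; apply/eqP/(cluster_inj Pdisj ui); rewrite uv. Qed.
Let c : cfg := [ffun=> i0].
Let u0 : u \notin (set0 : {set V}). Proof. by rewrite inE. Qed.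
Let v0 : v \notin (set0 : {set V}). Proof. by rewrite inE. Qed.
Let uv1 : u \notin [set v]. Proof. by rewrite inE. Qed.
Let vu1 : v \notin [set u]. Proof. by rewrite inE eq_sym. Qed.

Let su z (a b : 'I_d) := pstate [set u] M z (upd c u a) (upd c u b).
Let sv z (a b : 'I_d) := pstate [set v] M z (upd c v a) (upd c v b).
Let suv z (a b a' b' : 'I_d) :=
  pstate [set u; v] M z (upd (upd c v a') u a) (upd (upd c v b') u b).
(** The correlation of [u] and [v] given the outcome [z], weighted by its probability. Both partial
    traces vanish, and measuring it gives the classical difference that [cond_pinsker] controls. *)
Let xi z a b a' b' := suv z a b a' b' - su z a b * sv z a' b' / real_complex R (prob M z).

Let upd_comm (x : cfg) a a' : upd (upd x v a') u a = upd (upd x u a) v a'.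
Proof.
by apply/ffunP => w; rewrite !ffunE; case: eqVneq => // ->; rewrite (negbTE uv).
Qed.

Let sum_su z : \sum_a su z a a = real_complex R (prob M z).
Proof.
by rewrite -(pstate_set0 i0 phi kP M z c c) -(pstate_sum_site i0 phi k M z c c u0) setU0.
Qed.

Let sum_sv z : \sum_a sv z a a = real_complex R (prob M z).
Proof.
by rewrite -(pstate_set0 i0 phi kP M z c c) -(pstate_sum_site i0 phi k M z c c v0) setU0.
Qed.

Let su_eq0 z a b : prob M z = 0 -> su z a b = 0.
Proof. by move=> p0; rewrite /su (pstate_eq0 (i0 := i0) kP). Qed.

Let xi_left z a' b' : \sum_a xi z a a a' b' = 0.
Proof.
rewrite /xi sumrB -mulr_suml -mulr_suml sum_su.
have -> : \sum_a suv z a a a' b' = sv z a' b'.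
  by rewrite /sv -(pstate_sum_site i0 phi k M z _ _ uv1).
have [p0|p_neq0] := eqVneq (prob M z) 0.
  by rewrite p0 mul0r mul0r subr0 /sv (pstate_eq0 (i0 := i0) kP).
by rewrite mulrAC divff ?mul1r ?subrr // (inj_eq (@complexI R) _ 0).
Qed.

Let xi_right z a b : \sum_a' xi z a b a' a' = 0.
Proof.
rewrite /xi sumrB -mulr_suml -mulr_sumr sum_sv.
have -> : \sum_a' suv z a b a' a' = su z a b.
  rewrite /su -(pstate_sum_site i0 phi k M z _ _ vu1); apply: eq_bigr => a' _.
  by rewrite /suv !upd_comm setUC.
have [p0|p_neq0] := eqVneq (prob M z) 0.
  by rewrite p0 mulr0 mul0r subr0 su_eq0.
by rewrite mulfK ?subrr // (inj_eq (@complexI R) _ 0).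
Qed.

Let outcome_xi z o o' :
  outcome (phi o) (fun a b => outcome (phi o') (xi z a b)) =
  real_complex R (prob (u |: (v |: M)) (upd (upd z v o') u o)
    - prob (u |: M) (upd z u o) * prob (v |: M) (upd z v o') / prob M z).
Proof.
have uvM : u \notin v |: M by rewrite !inE negb_or uv.
rewrite /xi outcome_subM.
have -> : outcome (phi o) (su z) = real_complex R (prob (u |: M) (upd z u o)).
  rewrite -(pstate_set0 i0 phi kP _ _ c c) -(pstate_outcome phi k z c c o uM u0).
  by rewrite /su setU0.
have -> : outcome (phi o') (sv z) = real_complex R (prob (v |: M) (upd z v o')).
  rewrite -(pstate_set0 i0 phi kP _ _ c c) -(pstate_outcome phi k z c c o' vM v0).
  by rewrite /sv setU0.
have -> : outcome (phi o) (fun a b => outcome (phi o') (suv z a b)) =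
    real_complex R (prob (u |: (v |: M)) (upd (upd z v o') u o)).
  rewrite -(pstate_set0 i0 phi kP _ _ c c) -(pstate_outcome phi k _ c c o uvM u0).
  rewrite setU0; apply: eq_bigr => a _; apply: eq_bigr => b _; congr (_ * _).
  rewrite -(pstate_outcome phi k z _ _ o' vM vu1) /outcome.
  apply: eq_bigr => a' _; apply: eq_bigr => b' _; congr (_ * _).
  by rewrite /suv !upd_comm setUC.
by rewrite rmorphB /= !rmorphM /= fmorphV.
Qed.

Let reduced_diff (x y : cfg) :
  opE (ptrace [set u; v] rho - ptrace [set u; v] sigma) (restrict _ x) (restrict _ y) =
  sum_on o0 M (fun z => xi z (x u) (y u) (x v) (y v)).
Proof.
have uvM : [disjoint M & [set u; v]].
  by rewrite disjoint_sym disjoints_subset subUset !sub1set !inE uM vM.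
rewrite opE_sub ptrace_pstate // (ptrace_measured_product _ Pdisj) // /sum_on -sumrB.
apply: eq_bigr => z _; rewrite /xi; congr (_ - _).
  by apply: pstate_local => // w; rewrite !inE => /orP[]/eqP ->;
    rewrite ?upd_id // upd_neq ?upd_id // eq_sym.
have [p0|p_neq0] := eqVneq (prob M z) 0; first by rewrite p0 mul0r su_eq0 // !mul0r.
rewrite (bigD1 i) //= (bigD1 j) 1?eq_sym //= (prod_unmeasured _ _ p_neq0) => [|l /andP[li lj]].
  have -> : [set u; v] :&: P i = [set u].
    apply/setP => w; rewrite !inE; case: eqVneq => [->|wu]; first by rewrite ui.
    case: eqVneq => //= ->; apply: contraNF ij => vi.
    by apply/eqP/(cluster_inj Pdisj vi).
  have -> : [set u; v] :&: P j = [set v].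
    apply/setP => w; rewrite !inE orbC; case: eqVneq => [->|wu]; first by rewrite vj.
    case: eqVneq => //= ->; apply: contraNF ij => uj.
    by apply/eqP/(cluster_inj Pdisj ui).
  rewrite (_ : pstate [set u] M z x y = su z (x u) (y u)); last first.
    by apply: pstate_local => // w; rewrite inE => /eqP ->; rewrite upd_id.
  rewrite (_ : pstate [set v] M z x y = sv z (x v) (y v)); last first.
    by apply: pstate_local => // w; rewrite inE => /eqP ->; rewrite upd_id.
  rewrite fmorphV; field; by rewrite (inj_eq (@complexI R) _ 0).
apply/eqP; rewrite setI_eq0 disjoints_subset subUset !sub1set !inE.
apply/andP; split; [apply: contra li|apply: contra lj] => w; apply/eqP.
  exact: (cluster_inj Pdisj w).
exact: (cluster_inj Pdisj w).
Qed.

Lemma pair_trnorm_cross (t : R) : 0 < t ->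
  (forall X : 'I_d -> 'I_d -> C, \sum_x X x x = 0 ->
    frob X <= 4 * \sum_o Num.sqrt (sqn (outcome (phi o) X))) ->
  trnorm (ptrace [set u; v] rho - ptrace [set u; v] sigma) <=
  16 * d%:R * (t * cond_info o0 prob u v M + (2 * t)^-1).
Proof.
move=> t_gt0 phi_frob.
set Delta := _ - _.
have Dherm : adjmx Delta = Delta.
  by apply: adjmxB; [have [[]] := density_ptrace i0 [set u; v] rhoP
    | have [[]] := density_ptrace i0 [set u; v] sigmaP].
apply: le_trans (trnorm_le_frobenius Dherm) _.
have -> : Num.sqrt #|cfgS d [set u; v]|%:R = d%:R :> R.
  rewrite card_ffun card_ord card_sig (eq_card (B := [set u; v])) => [|w]; last by rewrite inE.
  by rewrite cards2 uv natrX sqrtr_sqr ger0_norm.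
rewrite [16 * _]mulrC -mulrA ler_wpM2l //.
pose I : finType := (('I_d * 'I_d) * ('I_d * 'I_d))%type.
have -> : \sum_a \sum_b sqn (opE Delta a b) =
   \sum_(q : I) sqn (sum_on o0 M (fun z => xi z q.1.1 q.1.2 q.2.1 q.2.2)).
  have sum_uv (h : cfg -> R) :
      sum_on i0 [set u; v] h = \sum_a' \sum_a h (upd (upd c v a') u a).
    by rewrite sum_onU1 // -[[set v]]setU0 sum_onU1 // sum_on_set0.
  have sum_pair (h : cfgS d [set u; v] -> R) :
      \sum_a h a = \sum_a' \sum_a h (restrict [set u; v] (upd (upd c v a') u a)).
    by rewrite (sum_cfgS i0) sum_uv.
  rewrite -(pair_big xpredT xpredT (fun p q : 'I_d * 'I_d =>
    sqn (sum_on o0 M (fun z => xi z p.1 p.2 q.1 q.2)))) /=.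
  rewrite -(pair_big xpredT xpredT (fun a b : 'I_d => \sum_(q : 'I_d * 'I_d)
    sqn (sum_on o0 M (fun z => xi z a b q.1 q.2)))) /=.
  under [RHS]eq_bigr => a _ do under eq_bigr => b _ do
    rewrite -(pair_big xpredT xpredT (fun a' b' : 'I_d =>
      sqn (sum_on o0 M (fun z => xi z a b a' b')))) /=.
  rewrite sum_pair exchange_big /=; apply: eq_bigr => a _.
  rewrite [RHS]exchange_big /=; apply: eq_bigr => a' _.
  rewrite sum_pair exchange_big /=; apply: eq_bigr => b _.
  apply: eq_bigr => b' _; rewrite reduced_diff !upd_id.
  by do 2!(rewrite upd_neq ?upd_id; last by rewrite eq_sym).
pose off (z : {ffun V -> Om}) := [forall w, (w \notin M) ==> (z w == o0)].
pose f (z : {ffun V -> Om}) (q : I) : R :=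
  if off z then Num.sqrt (sqn (xi z q.1.1 q.1.2 q.2.1 q.2.2)) else 0.
apply: (@le_trans _ _ (Num.sqrt (\sum_q (\sum_z f z q) ^+ 2))).
  apply: ler_wsqrtr; apply: ler_sum => q _.
  rewrite -[leLHS](sqr_sqrtr (sqn_ge0 _)) lerXn2r ?nnegrE ?sqrtr_ge0 //.
    by apply: sumr_ge0 => z _; rewrite /f; case: ifP => // _; exact: sqrtr_ge0.
  by rewrite /f -big_mkcond; exact: sqrt_sqn_sum.
(* Moving the sum over outcomes out of the norm lets the distortion bound act on each [xi z]
   separately. *)
apply: le_trans (minkowski_sum f) _.
apply: (@le_trans _ _ (16 * sum_on o0 M (fun z => \sum_o \sum_o'
    `|prob (u |: (v |: M)) (upd (upd z v o') u o)
      - prob (u |: M) (upd z u o) * prob (v |: M) (upd z v o') / prob M z|))); last first.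
  by rewrite ler_wpM2l //; exact: (cond_pinsker o0 probP uv uM vM t_gt0).
rewrite /sum_on mulr_sumr [leRHS]big_mkcond /=; apply: ler_sum => z _.
rewrite /f -/(off z); case: ifP => _; last by rewrite big1 ?sqrtr0 // => q _; rewrite expr0n.
have -> : \sum_(q : I) Num.sqrt (sqn (xi z q.1.1 q.1.2 q.2.1 q.2.2)) ^+ 2 =
    \sum_a \sum_b frob (xi z a b) ^+ 2.
  rewrite pair_big /= -(pair_big xpredT xpredT (fun p q : 'I_d * 'I_d =>
    Num.sqrt (sqn (xi z p.1 p.2 q.1 q.2)) ^+ 2)) /=.
  apply: eq_bigr => p _; rewrite /frob sqr_sqrtr; last first.
    by do 2!apply: sumr_ge0 => ? _; exact: sqn_ge0.
  by rewrite pair_big /=; apply: eq_bigr => q _; rewrite sqr_sqrtr ?sqn_ge0.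
apply: le_trans (outcome_tensor_frob _ phi_frob (xi_left z) (xi_right z)) _ => //.
rewrite (_ : 4 ^+ 2 = 16) ?ler_wpM2l //; last by ring.
apply: ler_sum => o _; apply: ler_sum => o' _.
by rewrite outcome_xi sqn_real sqrtr_sqr.
Qed.

End Cross.

End PairBounds.

(** * Classical versus quantum mutual information *)

Section MutualInformation.
Import boot.finset.
Context {R : realType} {V : finType} {d : nat} (i0 : 'I_d).
Local Notation C := (complex R).
Local Notation cfg := (cfg V d).
Local Notation restrict := (@Defs.restrict V d).
Implicit Types (S : {set V}).

Lemma restrict_inj S (x y : cfg) :
  (restrict S x == restrict S y) && (restrict (~: S) x == restrict (~: S) y) = (x == y).
Proof.
apply/andP/eqP => [[/restrict_eqP h1 /restrict_eqP h2]|-> //].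
apply/ffunP => v; have [vS|vS] := boolP (v \in S); first exact: h1.
by apply: h2; rewrite in_setC.
Qed.

Lemma sum_cfg_split S (F : cfgS d S -> cfgS d (~: S) -> C) :
  \sum_x F (restrict S x) (restrict (~: S) x) = \sum_a \sum_b F a b.
Proof.
rewrite pair_big /= (reindex_onto (fun ab : cfgS d S * cfgS d (~: S) =>
  mix S (ext i0 ab.1) (ext i0 ab.2)) (fun x => (restrict S x, restrict (~: S) x))); last first.
  move=> x _; apply/eqP; rewrite -(restrict_inj S) restrict_mix extK eqxx /=.
  apply/restrict_eqP => v; rewrite in_setC ffunE => /[dup] vS /negbTE ->.
  by rewrite ffunE insubT ?in_setC // => h; rewrite ffunE.
have rC a b : restrict (~: S) (mix S (ext i0 a) (ext i0 b)) = b.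
  rewrite -[RHS](extK i0); apply/eqP/restrict_eqP => v.
  by rewrite in_setC ffunE => /negbTE ->.
apply: eq_big => [[a b]|[a b] _] /=; last by rewrite restrict_mix extK rC.
by rewrite restrict_mix extK rC !eqxx.
Qed.

Lemma quad_eigen_sum (T A : finType) (k : T -> T -> C) (u : A -> T -> C) (l : A -> R)
    (e : T -> C) :
  (forall x y, k x y = \sum_a real_complex R (l a) * u a x * conjc (u a y)) ->
  quad k e = real_complex R (\sum_a l a * sqn (coef e (u a))).
Proof.
move=> kE; rewrite /quad rmorph_sum /=.
transitivity (\sum_a \sum_x \sum_y
    conjc (e x) * (real_complex R (l a) * u a x * conjc (u a y)) * e y).
  rewrite [RHS]exchange_big; apply: eq_bigr => x _; rewrite [RHS]exchange_big.
  by apply: eq_bigr => y _; rewrite kE mulr_sumr mulr_suml.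
apply: eq_bigr => a _; rewrite rmorphM /= sqnE /coef conjc_sum mulr_suml mulr_sumr.
apply: eq_bigr => x _; rewrite !mulr_sumr; apply: eq_bigr => y _.
by rewrite conjcM conjcK; ring.
Qed.

Lemma quad_ptrace S (A : op R cfg) (f : cfgS d S -> C) :
  quad (opE (ptrace S A)) f = \sum_x \sum_y
    (restrict (~: S) x == restrict (~: S) y)%:R *
    (conjc (f (restrict S x)) * opE A x y * f (restrict S y)).
Proof.
transitivity (\sum_a \sum_b \sum_x \sum_y (restrict S x == a)%:R * ((restrict S y == b)%:R *
    ((restrict (~: S) x == restrict (~: S) y)%:R * (conjc (f a) * opE A x y * f b)))).
  apply: eq_bigr => a _; apply: eq_bigr => b _.
  rewrite {1}/opE mxE !enum_rankK mulr_sumr mulr_suml; apply: eq_bigr => x _.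
  rewrite big_mkcond mulr_sumr mulr_suml; apply: eq_bigr => y _.
  case: (restrict S x == a); case: (restrict S y == b);
    case: (restrict (~: S) x == restrict (~: S) y); rewrite /= ?(mul1r, mul0r, mulr0) //.
transitivity (\sum_x \sum_y \sum_a \sum_b (restrict S x == a)%:R * ((restrict S y == b)%:R *
    ((restrict (~: S) x == restrict (~: S) y)%:R * (conjc (f a) * opE A x y * f b)))).
  under eq_bigr do rewrite exchange_big /=.
  rewrite exchange_big /=; apply: eq_bigr => x _.
  under eq_bigr do rewrite exchange_big /=.
  by rewrite exchange_big.
apply: eq_bigr => x _; apply: eq_bigr => y _.
under eq_bigr do rewrite -mulr_sumr sum_delta.
by rewrite sum_delta.
Qed.

Context {Om : finType} (o0 : Om).
Variables (phi : Om -> 'I_d -> C) (rho : op R cfg).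
Hypotheses (phiP : frame phi) (rhoP : density rho).
Local Notation k := (opE rho).
Local Notation prob := (prob i0 phi k).

Let kP : gram k. Proof. exact: gram_of_psd (proj1 rhoP). Qed.
Let k_tr : \sum_x k x x = 1. Proof. by rewrite -mxtrace_opE (proj2 rhoP). Qed.
Let probP := prob_consistent i0 phiP kP k_tr.

Let eS S (z : {ffun V -> Om}) (a : cfgS d S) : C := \prod_s phi (z (val s)) (a s).

Let eS_restrict S z (x : cfg) : eS z (restrict S x) = \prod_(v in S) phi (z v) (x v).
Proof.
rewrite /eS [RHS]big_sub /=.
by apply: eq_bigr => s _; rewrite ffunE.
Qed.

Let prob_quad S z : real_complex R (prob S z) = quad (opE (ptrace S rho)) (@eS S z).
Proof.
rewrite -(pstate_set0 i0 phi kP S z [ffun=> i0] [ffun=> i0]) quad_ptrace.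
apply: eq_bigr => x _; apply: eq_bigr => y _; rewrite !eS_restrict.
have -> : \prod_v site_op phi (v \in set0) (v \in S) (z v)
      ([ffun=> i0] v) ([ffun=> i0] v) (y v) (x v) =
    (\prod_(v in S) (phi (z v) (y v) * conjc (phi (z v) (x v)))) *
    (\prod_(v | v \notin S) (y v == x v)%:R).
  rewrite (bigID (mem S)) /=; congr (_ * _); apply: eq_bigr => v vS.
    by rewrite /site_op in_set0 vS.
  by rewrite /site_op in_set0 (negbTE vS).
have -> : \prod_(v | v \notin S) (y v == x v)%:R =
    (restrict (~: S) x == restrict (~: S) y)%:R :> C.
  rewrite big_mkcond (eq_bigr (fun v => ((v \notin S) ==> (y v == x v))%:R)) => [|v _].
    rewrite prod_bool; congr (nat_of_bool _)%:R.
    apply/forallP/restrict_eqP => [h v|h v].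
      by rewrite in_setC => vS; have := h v; rewrite vS => /eqP.
    by apply/implyP => vS; rewrite h // in_setC.
  by case: ifP.
by rewrite conjc_prod big_split /=; ring.
Qed.

Let e (z : {ffun V -> Om}) (x : cfg) : C := \prod_v phi (z v) (x v).

Let e_split S z x : e z x = eS z (restrict S x) * eS z (restrict (~: S) x).
Proof.
rewrite !eS_restrict /e (bigID (mem S)) /=; congr (_ * _).
by apply: eq_bigl => v; rewrite in_setC.
Qed.

(** Data processing for [rho] against the product of its two marginals. The frame [h] consists of
    products of eigenvectors of the marginals and [e] of the product vectors of the measurement. The
    diagonal [r] of [rho] in [h] has marginals [mu] and [nu], which turns the cross term into the
    two marginal entropies. *)
Lemma cut_info_le_mutinf S : cut_info o0 prob S [set: V] <= mutinf S rho.
Proof.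
have [u [l [fu ou kE sE l0]]] := psd_eigenbasis (proj1 rhoP).
have [f [mu [ff of_ AE sA mu0]]] := psd_eigenbasis (proj1 (density_ptrace i0 S rhoP)).
have [g [nu [fg og BE sB nu0]]] := psd_eigenbasis (proj1 (density_ptrace i0 (~: S) rhoP)).
pose h (bc : cfgS d S * cfgS d (~: S)) (x : cfg) :=
  f bc.1 (restrict S x) * g bc.2 (restrict (~: S) x).
pose r bc := \sum_a sqn (coef (h bc) (u a)) * l a.
have r0 bc : 0 <= r bc by apply: sumr_ge0 => a _; rewrite mulr_ge0 ?sqn_ge0.
have rE bc : real_complex R (r bc) = quad k (h bc).
  rewrite (quad_eigen_sum _ kE); congr (real_complex R _).
  by apply: eq_bigr => a _; rewrite mulrC.
have rb b : \sum_c r (b, c) = mu b.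
  apply: (@complexI R); rewrite -(quad_eigen b AE of_) quad_ptrace rmorph_sum /=.
  under eq_bigr do rewrite rE.
  rewrite /quad exchange_big /=; apply: eq_bigr => x _.
  rewrite exchange_big /=; apply: eq_bigr => y _.
  rewrite eq_sym -fg mulr_suml; apply: eq_bigr => c _.
  by rewrite /h /= conjcM; ring.
have rc c : \sum_b r (b, c) = nu c.
  apply: (@complexI R); rewrite -(quad_eigen c BE og) quad_ptrace rmorph_sum /=.
  under eq_bigr do rewrite rE.
  rewrite /quad exchange_big /=; apply: eq_bigr => x _.
  rewrite exchange_big /=; apply: eq_bigr => y _.
  rewrite setCK eq_sym -ff mulr_suml; apply: eq_bigr => b _.
  by rewrite /h /= conjcM; ring.
have r_mu b c : mu b = 0 -> r (b, c) = 0.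
  rewrite -rb => /eqP; rewrite psumr_eq0 // => /allP/(_ c).
  by rewrite mem_index_enum => /(_ isT)/eqP.
have r_nu b c : nu c = 0 -> r (b, c) = 0.
  rewrite -rc => /eqP; rewrite psumr_eq0 // => /allP/(_ b).
  by rewrite mem_index_enum => /(_ isT)/eqP.
have fh : frame h.
  move=> x y; rewrite -(restrict_inj S x y) -mulnb natrM -ff -fg mulr_suml.
  rewrite -(pair_big xpredT xpredT (fun b c => h (b, c) x * conjc (h (b, c) y))) /=.
  apply: eq_bigr => b _; rewrite mulr_sumr; apply: eq_bigr => c _.
  by rewrite /h /= conjcM; ring.
have fe : frame e.
  move=> x y; transitivity (\prod_v \sum_o phi o (x v) * conjc (phi o (y v))).
    rewrite bigA_distr_bigA; apply: eq_bigr => z _.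
    by rewrite /e conjc_prod -big_split.
  under eq_bigr do rewrite phiP.
  rewrite prod_bool; congr (nat_of_bool _)%:R.
  by apply/forallP/eqP => [xy|-> //]; apply/ffunP => v; apply/eqP.
have u1 a : \sum_x sqn (u a x) = 1.
  by apply: (@complexI R); rewrite -coefxx ou eqxx rmorph1.
have supp a bc : sqn (coef (h bc) (u a)) * l a != 0 -> 0 < mu bc.1 * nu bc.2.
  case: bc => b c wl; rewrite lt0r mulr_ge0 // andbT.
  have : r (b, c) != 0.
    rewrite /r psumr_eq0 => [|a' _]; last by rewrite mulr_ge0 ?sqn_ge0.
    by apply/allPn; exists a; rewrite ?mem_index_enum.
  by apply: contra; rewrite mulf_eq0 => /orP[]/eqP /=; [move=> /r_mu ->|move=> /r_nu ->].
have pE z : prob [set: V] z = \sum_a l a * sqn (coef (e z) (u a)).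
  apply: (@complexI R); rewrite -(quad_eigen_sum (e z) kE).
  rewrite -(pstate_set0 i0 phi kP _ z [ffun=> i0] [ffun=> i0]).
  apply: eq_bigr => x _; apply: eq_bigr => y _.
  rewrite /e conjc_prod mulrAC mulrC -big_split /=; congr (_ * _).
  by apply: eq_bigr => v _; rewrite /site_op !inE mulrC.
have qE z : prob S z * prob (~: S) z =
    \sum_bc mu bc.1 * nu bc.2 * sqn (coef (e z) (h bc)).
  have coefE bc : coef (e z) (h bc) = coef (@eS S z) (f bc.1) * coef (@eS (~: S) z) (g bc.2).
    rewrite /coef mulr_suml.
    under [RHS]eq_bigr do rewrite mulr_sumr.
    rewrite -(sum_cfg_split (fun a b => conjc (eS z a) * f bc.1 a * (conjc (eS z b) * g bc.2 b))).
    by apply: eq_bigr => x _; rewrite /h (e_split S) conjcM; ring.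
  apply: (@complexI R); rewrite rmorphM /= !prob_quad.
  rewrite (quad_eigen_sum _ AE) (quad_eigen_sum _ BE) -rmorphM /=; congr (real_complex R _).
  rewrite mulr_suml.
  rewrite -(pair_big xpredT xpredT (fun b c => mu b * nu c * sqn (coef (e z) (h (b, c))))) /=.
  apply: eq_bigr => b _; rewrite mulr_sumr; apply: eq_bigr => c _.
  by rewrite coefE sqnM; ring.
have mn0 bc : 0 <= mu bc.1 * nu bc.2 by rewrite mulr_ge0.
have := measured_relative_entropy fu fh fe u1 l0 mn0 supp pE qE.
have p_ge0 M z : 0 <= prob M z by case: probP.
have pSC (M : {set V}) z : prob [set: V] z != 0 -> 0 < prob M z.
  move=> pz; rewrite lt0r p_ge0 andbT; apply: contraNneq pz => pM.
  by rewrite eq_le p_ge0 andbT -pM (consistent_le probP) ?subsetT.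
have -> : \sum_z prob [set: V] z * (ln (prob [set: V] z) - ln (prob S z * prob (~: S) z)) =
    cut_info o0 prob S [set: V].
  rewrite /cut_info setTI setTD (ent_sum o0 probP (subsetT S)) (ent_sum o0 probP (subsetT (~: S))).
  rewrite /ent !sum_on_setT.
  transitivity (\sum_z prob [set: V] z * ln (prob [set: V] z)
    - \sum_z prob [set: V] z * ln (prob S z)
    - \sum_z prob [set: V] z * ln (prob (~: S) z)); last by ring.
  rewrite -!sumrB; apply: eq_bigr => z _.
  have [->|pz] := eqVneq (prob [set: V] z) 0; first by rewrite !mul0r !subr0.
  by rewrite lnM ?posrE ?pSC //; ring.
move=> /le_trans; apply; rewrite le_eqVlt; apply/orP; left; apply/eqP.
rewrite /mutinf /entropy (sE (fun x => x * ln x)) (sA (fun x => x * ln x)) (sB (fun x => x * ln x)).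
transitivity (\sum_a l a * ln (l a) - \sum_bc r bc * ln (mu bc.1 * nu bc.2)).
  have -> : \sum_bc r bc * ln (mu bc.1 * nu bc.2) =
      \sum_a \sum_bc sqn (coef (h bc) (u a)) * l a * ln (mu bc.1 * nu bc.2).
    by rewrite exchange_big /=; apply: eq_bigr => bc _; rewrite mulr_suml.
  rewrite -sumrB; apply: eq_bigr => a _.
  transitivity (\sum_bc (sqn (coef (h bc) (u a)) * (l a * ln (l a))
     - sqn (coef (h bc) (u a)) * l a * ln (mu bc.1 * nu bc.2))).
    by apply: eq_bigr => bc _; ring.
  by rewrite sumrB -mulr_suml parseval // u1 mul1r.
have -> : \sum_bc r bc * ln (mu bc.1 * nu bc.2) =
    \sum_b mu b * ln (mu b) + \sum_c nu c * ln (nu c).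
  transitivity (\sum_bc (r bc * ln (mu bc.1) + r bc * ln (nu bc.2))).
    apply: eq_bigr => -[b c] _ /=.
    have [/r_mu ->|mub] := eqVneq (mu b) 0; first by rewrite !mul0r addr0.
    have [/r_nu ->|nuc] := eqVneq (nu c) 0; first by rewrite !mul0r addr0.
    by rewrite lnM ?posrE ?lt0r ?mub ?nuc ?mu0 ?nu0 //= mulrDr.
  rewrite big_split /=; congr (_ + _).
    rewrite -(pair_big xpredT xpredT (fun b c => r (b, c) * ln (mu b))) /=.
    by apply: eq_bigr => b _; rewrite -mulr_suml rb.
  rewrite -(pair_big xpredT xpredT (fun b c => r (b, c) * ln (nu c))) /= exchange_big /=.
  by apply: eq_bigr => c _; rewrite -mulr_suml rc.
ring.
Qed.

End MutualInformation.

(** * Averaging over edges *)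

Section Optimization.
Context {R : realType}.
Implicit Types x y w Phi B c q : R.

(** Only one of the two [theta] terms is present, and [theta] can be taken so small or so large that
    it stays below [x / 4]. With [delta = x / 8] the right side is then less than [x / 2 + x / 4].
    The shifts [B + 1] and [Phi + 1] avoid a zero denominator. *)
Lemma optimize_eq0 x Phi B c : 0 <= Phi -> 0 <= B -> 0 < c -> Phi * B = 0 ->
  (forall delta theta, 0 < delta -> 0 < theta ->
    x <= 4 * delta + 16 * c * (theta * B / delta ^+ 2 + Phi / (2 * theta))) -> x <= 0.
Proof.
move=> Phi0 B0 c0 PB H; rewrite leNgt; apply/negP => x0.
have d0 : 0 < x / 8 by rewrite divr_gt0.
have := H (x / 8) _ d0; move/eqP: PB; rewrite mulf_eq0 => /orP[]/eqP -> {}H.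
- have B1 : 0 < B + 1 by lra.
  have /H : 0 < (x / 8) ^+ 2 * x / (64 * c * (B + 1)).
    by rewrite divr_gt0 ?mulr_gt0 ?exprn_gt0.
  have -> : (x / 8) ^+ 2 * x / (64 * c * (B + 1)) * B / (x / 8) ^+ 2 =
      x / (64 * c) * (1 - (B + 1)^-1) by field; lra.
  rewrite mul0r addr0.
  have -> : 16 * c * (x / (64 * c) * (1 - (B + 1)^-1)) = x / 4 - x / 4 * (B + 1)^-1.
    by field; lra.
  have : 0 < x / 4 * (B + 1)^-1 by rewrite mulr_gt0 ?invr_gt0 //; lra.
  lra.
- have P1 : 0 < Phi + 1 by lra.
  have /H : 0 < 32 * c * (Phi + 1) / x by rewrite divr_gt0 ?mulr_gt0.
  rewrite mulr0 mul0r add0r.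
  have -> : 16 * c * (Phi / (2 * (32 * c * (Phi + 1) / x))) = x / 4 - x / 4 * (Phi + 1)^-1.
    by field; lra.
  have : 0 < x / 4 * (Phi + 1)^-1 by rewrite mulr_gt0 ?invr_gt0 //; lra.
  lra.
Qed.

(* The optimal choice gives [16 * 2^(1/4) * w^3], at most [9 * w^2] whenever the
   latter is below the trivial bound [2]. *)
Lemma optimize_gt0 x Phi B c w : 0 < Phi -> 0 < B -> 0 < c -> 0 < w ->
  w ^+ 12 = c ^+ 2 * Phi * B -> x <= 2 ->
  (forall delta theta, 0 < delta -> 0 < theta ->
    x <= 4 * delta + 16 * c * (theta * B / delta ^+ 2 + Phi / (2 * theta))) ->
  x <= 9 * w ^+ 2.
Proof.
move=> Phi0 B0 c0 w0 wE x2 H.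
have [|w_small] := leP 2 (9 * w ^+ 2); first lra.
pose q : R := Num.sqrt (Num.sqrt 2).
have q0 : 0 < q by rewrite !sqrtr_gt0.
have q4 : q ^+ 4 = 2 by rewrite (exprM q 2 2) !sqr_sqrtr ?sqrtr_ge0.
(* For fixed [delta] the best [theta] is [delta sqrt (Phi / (2 B))]. It leaves
   [4 delta + 16 sqrt 2 w^6 / delta], which is least at [delta = 2 q w^3]. *)
have d0 : 0 < 2 * q * w ^+ 3 by rewrite !mulr_gt0 ?exprn_gt0.
have t0 : 0 < 2 * Phi * c / (q * w ^+ 3) by rewrite divr_gt0 ?mulr_gt0 ?exprn_gt0.
have := H _ _ d0 t0.
have -> : 16 * c * (2 * Phi * c / (q * w ^+ 3) * B / (2 * q * w ^+ 3) ^+ 2 +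
      Phi / (2 * (2 * Phi * c / (q * w ^+ 3)))) =
    8 * (c ^+ 2 * Phi * B) / (q ^+ 3 * w ^+ 9) + 4 * q * w ^+ 3.
  by field; rewrite !lt0r_neq0.
rewrite -wE.
have -> : 8 * w ^+ 12 / (q ^+ 3 * w ^+ 9) = 4 * q * w ^+ 3 * (2 / q ^+ 4).
  by field; rewrite !lt0r_neq0.
rewrite q4 divff // mulr1.
have -> : 4 * (2 * q * w ^+ 3) + (4 * q * w ^+ 3 + 4 * q * w ^+ 3) = w ^+ 2 * (16 * (q * w)).
  by ring.
move=> /le_trans; apply; rewrite mulrC; apply: ler_wpM2r; first by rewrite exprn_ge0 // ltW.
(* Here [w^2 < 2/9], and [2 (2/9)^2 < (9/16)^4] shows that the constant 9 suffices. *)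
have [|qw] := leP (q * w) (9 / 16); first lra.
have : (9 / 16) ^+ 4 < (q * w) ^+ 4.
  by rewrite ltr_pXn2r // nnegrE ?mulr_ge0 ?(ltW q0) ?(ltW w0) //; lra.
rewrite [in X in _ < X]exprMn q4 (exprM w 2 2).
have : (w ^+ 2) ^+ 2 < (2 / 9) ^+ 2.
  by rewrite ltr_pXn2r // ?nnegrE ?exprn_ge0 ?(ltW w0) //; lra.
lra.
Qed.

Lemma optimize x Phi B c : 0 <= Phi -> 0 <= B -> 0 < c -> x <= 2 ->
  (forall delta theta, 0 < delta -> 0 < theta ->
    x <= 4 * delta + 16 * c * (theta * B / delta ^+ 2 + Phi / (2 * theta))) ->
  x <= 9 * (c ^+ 2 * Phi * B) `^ (6%:R^-1).
Proof.
move=> Phi0 B0 c0 x2 H.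
have [PB|PB] := eqVneq (Phi * B) 0.
  by apply: le_trans (optimize_eq0 Phi0 B0 c0 PB H) _; rewrite mulr_ge0 ?powR_ge0.
have Phi_gt0 : 0 < Phi by rewrite lt0r Phi0 andbT; apply: contraNneq PB => ->; rewrite mul0r.
have B_gt0 : 0 < B by rewrite lt0r B0 andbT; apply: contraNneq PB => ->; rewrite mulr0.
have y0 : 0 < c ^+ 2 * Phi * B by rewrite !mulr_gt0 ?exprn_gt0.
pose w := (c ^+ 2 * Phi * B) `^ (12%:R^-1).
have -> : (c ^+ 2 * Phi * B) `^ (6%:R^-1) = w ^+ 2.
  by rewrite -[RHS]powR_mulrn ?powR_ge0 // /w -powRrM; congr (_ `^ _); field.
apply: (optimize_gt0 Phi_gt0 B_gt0 c0 _ _ x2 H); first exact: powR_gt0.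
rewrite -[LHS]powR_mulrn ?powR_ge0 // /w -powRrM mulVf ?powRr1 //; exact: ltW.
Qed.

End Optimization.

(** * From pair bounds to the average over edges *)

Section EdgeAverage.
Import boot.finset.
Context {R : realType} {V : finType} (e : rel V) (D m k : nat) (P : 'I_k -> {set V}).
Hypotheses (e_sym : symmetric e) (D0 : (0 < D)%N).
Hypotheses (e_reg : forall v, #|[set u | e v u]| = D) (m0 : (0 < m)%N).
Hypotheses (V0 : (0 < #|V|)%N) (VE : #|V| = (k * m)%N) (Pm : forall i, #|P i| = m).
Hypotheses (Pdisj : forall i j, i != j -> [disjoint P i & P j]).
Hypothesis Pcover : \bigcup_(i < k) P i = [set: V].

Lemma sum_clusters (h : V -> R) : \sum_u h u = \sum_i \sum_(u in P i) h u.
Proof.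
rewrite (exchange_big_dep xpredT) //=; apply: eq_bigr => u _.
have [i ui] := mem_cluster Pcover u.
rewrite (big_pred1 i) // => j; apply/idP/eqP => [uj|->] //.
exact: (cluster_inj Pdisj uj ui).
Qed.

Lemma card_pairs (p : rel V) :
  #|[set uv : V * V | p uv.1 uv.2]|%:R = \sum_u \sum_(v | p u v) 1 :> R.
Proof.
rewrite -sum1_card natr_sum pair_big_dep /=.
by apply: eq_bigl => uv; rewrite inE.
Qed.

Lemma sum_degree (u : V) (c : R) : \sum_(v | e u v) c = D%:R * c.
Proof.
rewrite sumr_const -(e_reg u) mulr_natl; congr (_ *+ _).
by apply: eq_card => v; rewrite inE.
Qed.

Lemma nedges_regular : (nedges e)%:R = #|V|%:R * D%:R :> R.
Proof.
rewrite /nedges card_pairs; under eq_bigr do rewrite sum_degree mulr1.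
by rewrite sumr_const mulr_natl.
Qed.

Lemma expansion_regular i : expansion R e (P i) =
  (\sum_(u in P i) \sum_(v in ~: P i | e u v) 1) / (m%:R * D%:R).
Proof.
rewrite /expansion (card_pairs (fun u v => [&& e u v, u \in P i & v \notin P i])).
rewrite (card_pairs (fun u v => e u v && (u \in P i))); congr (_ / _).
  rewrite [RHS]big_mkcond; apply: eq_bigr => u _; case: ifP => uP.
    by apply: eq_bigl => v; rewrite in_setC /= andbC.
  by rewrite big_pred0 // => v; rewrite /= andbF.
transitivity (\sum_(u in P i) D%:R : R); last by rewrite sumr_const Pm mulr_natl.
rewrite [RHS]big_mkcond; apply: eq_bigr => u _; case: ifP => uP.
  by under eq_bigl do rewrite andbT; rewrite sum_degree mulr1.
by rewrite big_pred0 // => v; rewrite /= andbF.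
Qed.

Variables (c : R) (f : {set V} -> V -> V -> R) (F : 'I_k -> {set V} -> R) (I : 'I_k -> R).
Hypotheses (c0 : 0 < c).
Hypotheses (F_super : forall i, supermodular_across (P i) (F i)).
Hypotheses (F0 : forall i C, 0 <= F i C) (FI : forall i C, F i C <= I i).
Hypothesis (F_mono : forall i v C, F i C <= F i (v |: C)).
Hypothesis f_le2 : forall C u v, f C u v <= 2.
Hypothesis f_same : forall (C : {set V}) i u v, u \in P i -> v \in P i ->
  u \notin C -> v \notin C -> f C u v <= 0.
Hypothesis f_cross : forall (C : {set V}) i u v t, u \in P i -> v \notin P i ->
  u \notin C -> v \notin C -> 0 < t ->
  f C u v <= 16 * c * (t * mixed_diff (F i) u v C + (2 * t)^-1).

(** Every measured endpoint pays the trivial bound 2. The mixed differences are nonnegative, so they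
    may be summed over all [v] outside the block, adjacent or not; the constant is charged to cut
    edges only. *)
Let edge_row t (C : {set V}) i u : 0 < t -> u \in P i ->
  \sum_(v | e u v) f C u v <=
    \sum_(v | e u v) 2 * ((u \in C)%:R + (v \in C)%:R) +
    (16 * c * t * (\sum_(v in ~: P i) mixed_diff (F i) u v C) +
     16 * c / (2 * t) * (\sum_(v in ~: P i | e u v) 1)).
Proof.
move=> t0 uP; rewrite !mulr_sumr [leLHS]big_mkcond [X in X + _]big_mkcond.
rewrite [X in _ + (X + _)]big_mkcond [X in _ + (_ + X)]big_mkcond /= -!big_split /=.
apply: ler_sum => v _; rewrite in_setC.
have md0 : v \notin P i -> 0 <= 16 * c * t * mixed_diff (F i) u v C.
  by move=> vP; rewrite !mulr_ge0 ?(ltW c0) ?(ltW t0) ?F_super.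
have t1 : 0 <= 16 * c / (2 * t) by rewrite divr_ge0 ?mulr_ge0 ?(ltW c0) ?(ltW t0).
have [euv|_] := boolP (e u v); last first.
  by case: ifPn => [/md0|] /=; rewrite ?add0r ?addr0.
have [uC|uC] := boolP (u \in C).
  have := f_le2 C u v; have := ler0n R (v \in C).
  by case: ifPn => [/md0|] /=; lra.
have [vC|vC] := boolP (v \in C).
  have := f_le2 C u v.
  by case: ifPn => [/md0|] /=; lra.
case: ifPn => [vP|] /=; last by rewrite negbK => vP; have := f_same uP vP uC vC; lra.
have := f_cross uP vP uC vC t0; lra.
Qed.

Lemma edge_avg_le_random x delta t : (forall C, x <= edge_avg e (f C)) ->
  0 < delta -> 0 < t ->
  x <= 4 * delta + 16 * c *
    (t * ((k%:R^-1 * \sum_i I i) / m%:R / D%:R) / delta ^+ 2 +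
     (k%:R^-1 * \sum_i expansion R e (P i)) / (2 * t)).
Proof.
move=> xf d0 t0.
have [Q avQ [Qv QF]] := exists_random_set V0 m0 Pm Pdisj d0.
have nD0 : 0 < #|V|%:R * D%:R :> R by rewrite mulr_gt0 ?ltr0n.
(* An upper bound that depends on [C] only through the quantities whose means over the random set
   are known. *)
pose G (C : {set V}) := (#|V|%:R * D%:R)^-1 * (4 * D%:R * (\sum_u (u \in C)%:R) +
  (16 * c * t * (\sum_i \sum_(u in P i) \sum_(v in ~: P i) mixed_diff (F i) u v C) +
   16 * c / (2 * t) * (\sum_i m%:R * D%:R * expansion R e (P i)))).
have fG C : x <= G C.
  apply: le_trans (xf C) _; rewrite /edge_avg nedges_regular mulrC.
  apply: ler_wpM2l; first by rewrite invr_ge0 ltW.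
  rewrite sum_clusters.
  have /le_trans -> // : \sum_i \sum_(u in P i) \sum_(v | e u v) f C u v <=
      \sum_i \sum_(u in P i) (\sum_(v | e u v) 2 * ((u \in C)%:R + (v \in C)%:R) +
      (16 * c * t * (\sum_(v in ~: P i) mixed_diff (F i) u v C) +
      16 * c / (2 * t) * (\sum_(v in ~: P i | e u v) 1))).
    by apply: ler_sum => i _; apply: ler_sum => u; apply: edge_row.
  rewrite le_eqVlt; apply/orP; left; apply/eqP.
  under eq_bigr do rewrite big_split /=.
  rewrite big_split /= -sum_clusters; congr (_ + _).
    transitivity (\sum_u \sum_(v | e u v) 2 * (u \in C)%:R +
        \sum_u \sum_(v | e u v) 2 * (v \in C)%:R : R).
      rewrite -big_split /=; apply: eq_bigr => u _; rewrite -big_split /=.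
      by apply: eq_bigr => v _; rewrite mulrDr.
    rewrite [X in _ + X](exchange_big_dep xpredT) //= -big_split mulr_sumr /=.
    apply: eq_bigr => u _; under [X in _ + X]eq_bigl do rewrite e_sym.
    by rewrite !sum_degree; ring.
  rewrite !mulr_sumr -big_split; apply: eq_bigr => i _ /=.
  rewrite big_split /= -!mulr_sumr expansion_regular; congr (_ + _ * _).
  by rewrite mulrC divfK // mulf_neq0 ?pnatr_eq0 -?lt0n.
rewrite -(set_average_cst x set0 avQ); apply: le_trans (set_average_le set0 avQ fG) _.
rewrite /G set_averageZ // set_averageD // set_averageZ // set_averageD // set_averageZ //.
rewrite set_average_cst // !set_average_sum //.
have : \sum_u Q (fun C => (u \in C)%:R) set0 <= #|V|%:R * delta.
  rewrite mulr_natl -sumr_const; apply: ler_sum => u _; exact: Qv.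
have : \sum_i Q (fun C => \sum_(u in P i) \sum_(v in ~: P i) mixed_diff (F i) u v C) set0 <=
    (\sum_i I i) / delta ^+ 2.
  by rewrite mulr_suml; apply: ler_sum => i _; apply: QF.
set Y := \sum_i Q _ _; set X := \sum_u Q _ _ => YI Xd.
rewrite -mulr_sumr; set S := \sum_i I i in YI *; set E := \sum_i expansion _ _ _.
have k0 : (0 < k)%N by move: V0; rewrite VE muln_gt0 => /andP[].
rewrite -subr_ge0.
have -> : 4 * delta + 16 * c * (t * (k%:R^-1 * S / m%:R / D%:R) / delta ^+ 2 +
      k%:R^-1 * E / (2 * t)) - (#|V|%:R * D%:R)^-1 * (4 * D%:R * X +
      (16 * c * t * Y + 16 * c / (2 * t) * (m%:R * D%:R * E))) =
    (#|V|%:R * D%:R)^-1 * (4 * D%:R * (#|V|%:R * delta - X) +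
      16 * c * t * (S / delta ^+ 2 - Y)).
  by rewrite VE natrM; field; rewrite ?pnatr_eq0 -?lt0n ?m0 ?D0 ?k0 ?lt0r_neq0.
apply: mulr_ge0; first by rewrite invr_ge0 ltW.
by rewrite addr_ge0 ?mulr_ge0 ?subr_ge0 ?ler0n ?(ltW c0) ?(ltW t0).
Qed.

End EdgeAverage.

Lemma edge_avg_le {R : realType} (V : finType) (e : rel V) (f : V -> V -> R) (c : R) :
  0 <= c -> (forall u v, f u v <= c) -> edge_avg e f <= c.
Proof.
move=> c0 fc; rewrite /edge_avg; have [->|n0] := eqVneq (nedges e) 0%N.
  by rewrite invr0 mulr0.
rewrite ler_pdivrMr ?ltr0n ?lt0n // /nedges card_pairs mulr_sumr.
by apply: ler_sum => u _; rewrite mulr_sumr; apply: ler_sum => v _; rewrite mulr1.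
Qed.

Lemma expansion_ge0 (R : realType) (V : finType) (e : rel V) (S : {set V}) :
  0 <= expansion R e S.
Proof. by rewrite divr_ge0 ?ler0n. Qed.

Theorem theorem6 (R : realType) (d : nat) (V : finType) (e : rel V) (D m : nat)
    (P : 'I_(#|V| %/ m) -> {set V}) (rho : op R (cfg V d)) :
  (2 <= d)%N ->
  symmetric e -> irreflexive e ->
  (0 < D)%N -> (forall v : V, #|[set u | e v u]| = D) ->
  (0 < m)%N -> (m %| #|V|)%N ->
  (forall i, #|P i| = m) ->
  (forall i j, i != j -> [disjoint P i & P j]) ->
  \bigcup_(i < #|V| %/ m) P i = [set: V] ->
  density rho ->
  let k := (#|V| %/ m)%N in
  let Phibar : R := (k%:R)^-1 * \sum_(i < k) expansion R e (P i) in
  let Ibar : R := (k%:R)^-1 * \sum_(i < k) mutinf (P i) rho in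
  exists sigma : op R (cfg V d),
    [/\ density sigma, separable P sigma &
      edge_avg e (fun u v => trnorm (ptrace [set u; v] rho - ptrace [set u; v] sigma))
        <= 9 * ((d ^ 2)%:R * Phibar / D%:R * (Ibar / m%:R)) `^ (6%:R^-1)
           + (m%:R)^-1 + m%:R / (#|V|)%:R].
Proof.
move=> d2 e_sym e_irr D0 e_reg m0 mV Pm Pdisj Pcover rhoP k Phibar Ibar.
pose i0 : 'I_d := Ordinal (ltnW d2).
have [ Om [ o0 [phi [phiP povm]]]] := exists_povm (R := R) 'I_d.
pose sigma C := measured_product i0 P o0 phi rho C.
pose f C u v := trnorm (ptrace [set u; v] rho - ptrace [set u; v] (sigma C)).
pose p := prob i0 phi (opE rho).
have pP : consistent_family p.
  apply: prob_consistent => //; first exact: gram_of_psd (proj1 rhoP).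
  by rewrite -mxtrace_opE (proj2 rhoP).
(* The best measured set replaces the random one: its edge average is at most that of every set,
   hence at most any mean over sets. *)
have [C _ Cmin] := arg_minP (fun C : {set V} => edge_avg e (f C))
  (i0 := finset.set0) (P := xpredT) isT.
exists (sigma C); split; first exact: density_measured_product.
  exact: separable_measured_product.
rewrite -[leLHS]/(edge_avg e (f C)).
have f2 C' u v : f C' u v <= 2 by exact: pair_trnorm_le2.
(* Nonnegativity of the quantum mutual information is inherited from the classical one. *)
have mi0 i : 0 <= mutinf (P i) rho.
  apply: le_trans (cut_info_le_mutinf i0 o0 phiP rhoP (P i)).
  exact: cut_info_ge0.
have Phi0 : 0 <= Phibar.
  by rewrite mulr_ge0 ?invr_ge0 ?ler0n // sumr_ge0 // => i _; exact: expansion_ge0.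
have I0 : 0 <= Ibar by rewrite mulr_ge0 ?invr_ge0 ?ler0n // sumr_ge0.
have B0 : 0 <= Ibar / m%:R / D%:R by rewrite !divr_ge0.
have d0 : 0 < d%:R :> R by rewrite ltr0n ltnW.
suff : edge_avg e (f C) <= 9 * (d%:R ^+ 2 * Phibar * (Ibar / m%:R / D%:R)) `^ (6%:R^-1).
  rewrite natrX; have -> : d%:R ^+ 2 * Phibar / D%:R * (Ibar / m%:R) =
      d%:R ^+ 2 * Phibar * (Ibar / m%:R / D%:R) by ring.
  by move=> /le_trans; apply; rewrite -addrA lerDl addr_ge0 ?divr_ge0 ?invr_ge0 ?ler0n.
(* Here [c = d] and [B = Ibar / (m D)]; the square [c ^+ 2] is the [d ^ 2] under the root. *)
apply: optimize => //; first exact: edge_avg_le.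
move=> delta t delta0 t0.
(* Since [m] divides 0 the vertex set may be empty; the edge average is then an empty sum. *)
have [V0|V0] := posnP #|V|.
  rewrite /edge_avg big1 => [|u _]; last by have := fintype0 u V0.
  have [[dl0 tl0] dR0] := (ltW delta0, ltW t0, ltW d0).
  rewrite mul0r; apply: addr_ge0; apply: mulr_ge0; rewrite ?mulr_ge0 //.
  by apply: addr_ge0; apply: divr_ge0; rewrite ?exprn_ge0 // mulr_ge0.
have VE : #|V| = (k * m)%N by rewrite divnK.
pose F i := cut_info o0 p (P i).
have F_le i C' : F i C' <= mutinf (P i) rho.
  exact: le_trans (cut_info_le o0 pP _ _) (cut_info_le_mutinf i0 o0 phiP rhoP _).
have f_same (C' : {set V}) i u v : u \in P i -> v \in P i -> u \notin C' -> v \notin C' ->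
    f C' u v <= 0.
  by move=> uP vP uC vC; rewrite /f (pair_trnorm_same i0 Pdisj Pcover o0 phiP rhoP uP vP uC vC).
have f_cross (C' : {set V}) i u v s : u \in P i -> v \notin P i -> u \notin C' -> v \notin C' ->
    0 < s -> f C' u v <= 16 * d%:R * (s * mixed_diff (F i) u v C' + (2 * s)^-1).
  move=> uP vP uC vC s0; rewrite mixed_diff_cut_info //.
  have [j vj] := mem_cluster Pcover v.
  have ij : i != j by apply: contraNneq vP => ->.
  exact: (pair_trnorm_cross i0 Pdisj Pcover o0 phiP rhoP uP vj ij uC vC s0 povm).
exact: (edge_avg_le_random e_sym D0 e_reg m0 V0 VE Pm Pdisj Pcover d0
  (fun i => @supermodular_cut_info _ _ _ o0 p pP (P i)) (fun i => cut_info_ge0 o0 pP (P i))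
  F_le (fun i => cut_info_mono o0 pP (P i)) f2 f_same f_cross (fun C' => Cmin C' isT) delta0 t0).
Qed.
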